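(* Let $p(\cdot)\in\mathcal{P}_0$ with $p(\cdot)\in LH$. Then, for any $w\in\mathcal{A}_{p(\cdot),\infty}$, there exist positive constants $C,C_1,C_2,A,A_1$, depending only on $p(\cdot)$ and $n$, such that, for any $r\in(1,r_w]$ with $$r_w:=1+\frac{1}{C_1[w]_{\mathcal{A}_{p(\cdot),\infty}}^{A_1}2^{C_2[w]_{\mathcal{A}_{p(\cdot),\infty}}}}$$ and for any cube $Q$ in $\mathbb{R}^n$, $$\frac{1}{\|\mathbf{1}_Q\|_{L^{rp(\cdot)}}}\|w\mathbf{1}_Q\|_{L^{rp(\cdot)}}\le C[w]_{\mathcal{A}_{p(\cdot),\infty}}^{A}\frac{1}{\|\mathbf{1}_Q\|_{L^{p(\cdot)}}}\|w\mathbf{1}_Q\|_{L^{p(\cdot)}}.$$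
   Context: Everything is on $\mathbb{R}^n$. $\mathcal{P}_0$ is the set of measurable $p:\mathbb{R}^n\to(0,\infty]$ with $p_-:=\operatorname{ess\,inf}_{x\in\mathbb{R}^n}p(x)>0$; $p_+:=\operatorname{ess\,sup}_{x\in\mathbb{R}^n}p(x)$. A measurable real-valued function $r$ on $\mathbb{R}^n$ belongs to $LH$ if there is $C_0>0$ with $|r(x)-r(y)|\le -\frac{C_0}{\log|x-y|}$ whenever $|x-y|<\frac12$, and there are positive constants $r_\infty,C_\infty$ with $|r(x)-r_\infty|\le\frac{C_\infty}{\log(e+|x|)}$ for all $x$. A constant ''depends only on $p(\cdot)$'' if it depends only on $p_-,p_+,p_\infty,C_0,C_\infty$ (the latter three being the constants in the $LH$ condition for $p(\cdot)$); in particular such constants do not depend on $w$. For a measurable function $f$ and exponent $q(\cdot)$, $\|f\|_{L^{q(\cdot)}}:=\inf\{\lambda>0:\int_{\mathbb{R}^n}|f(x)/\lambda|^{q(x)}\,dx\le1\}$ (with $\inf\emptyset=\infty$). Cubes have finite positive edge length and edges parallel to the axes (not necessarily open or closed); $\fint_Q$ denotes the average $\frac1{|Q|}\int_Q$. A scalar weight is a non-negative measurable function on $\mathbb{R}^n$ that is positive almost everywhere; it is in $\mathcal{A}_{p(\cdot),\infty}$ if $$[w]_{\mathcal{A}_{p(\cdot),\infty}}:=\sup_Q\frac{1}{\|\mathbf{1}_Q\|_{L^{p(\cdot)}}}\|w\mathbf{1}_Q\|_{L^{p(\cdot)}}\exp\left(\fint_Q\log(w^{-1}(y))\,dy\right)<\infty,$$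 the supremum being over all cubes and a product $\infty\cdot0$ being understood as $\infty$. *)

(* Defs.v *)
From HB Require Import structures.
From mathcomp Require Import all_boot all_order all_algebra.
From mathcomp Require Import all_classical all_reals all_analysis.
From mathcomp Require Import measurable_realfun ess_sup_inf.

Set Implicit Arguments.
Unset Strict Implicit.
Unset Printing Implicit Defensive.

Import Order.TTheory GRing.Theory Num.Theory.
Import numFieldNormedType.Exports.

Local Open Scope classical_set_scope.
Local Open Scope ring_scope.

Section LebesgueRn.
Context {R : realType} {n : nat}.
Local Notation V := 'rV[R]_n.
Implicit Types (a b : V) (X Y : set V).

Definition box a b : set V :=
  [set x | forall i, a ord0 i <= x ord0 i <= b ord0 i].

(* [box a b] is empty when b i < a i for some i, whence the [Num.max]. *)
Definition box_vol a b : R := \prod_(i < n) Num.max 0 (b ord0 i - a ord0 i).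

(* The family of boxes may be finite or empty: in dimension 0 no box is empty,
   so that sequences would not give set0 the measure 0. *)
Definition lebesgue_outer X : \bar R :=
  ereal_inf [set v : \bar R | exists (D : set nat) (a b : nat -> V),
    X `<=` \bigcup_(k in D) box (a k) (b k) /\
    v = (\esum_(k in D) (box_vol (a k) (b k))%:E)%E].

Lemma box_vol_ge0 a b : 0 <= box_vol a b.
Proof. by apply: prodr_ge0 => i _; rewrite le_max lexx. Qed.

Lemma lebesgue_outer_ge0 X : (0 <= lebesgue_outer X)%E.
Proof.
apply: le_ereal_inf_tmp => _ [D [a [b [_ ->]]]].
by apply: esum_ge0 => k _; rewrite lee_fin box_vol_ge0.
Qed.

Lemma lebesgue_outer0 : lebesgue_outer set0 = 0%E.
Proof.
apply/eqP; rewrite eq_le lebesgue_outer_ge0 andbT.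
apply: ereal_inf_lbound; exists set0, (fun=> 0), (fun=> 0).
by rewrite esum_set0; split => //; exact: sub0set.
Qed.

Lemma le_lebesgue_outer :
  {homo lebesgue_outer : X Y / X `<=` Y >-> (X <= Y)%E}.
Proof.
move=> X Y XY; apply: ereal_inf_le_tmp => v [D [a [b [YD ->]]]].
by exists D, a, b; split => //; exact: subset_trans YD.
Qed.

Lemma lebesgue_outer_sigma_subadditive : sigma_subadditive lebesgue_outer.
Proof.
move=> F; have [[i ioo]|] := pselect (exists i, lebesgue_outer (F i) = +oo%E).
  rewrite (eseries_pinfty _ _ ioo) ?leey// => k _.
  by rewrite -ltNye (lt_le_trans _ (lebesgue_outer_ge0 _)).
rewrite -forallNE => Foo.
apply/lee_addgt0Pr => e e0.
rewrite (le_trans _ (epsilon_trick _ _ (ltW e0)))//; last first.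
  by move=> k; exact: lebesgue_outer_ge0.
pose P k (c : set nat * ((nat -> V) * (nat -> V))) :=
  F k `<=` \bigcup_(j in c.1) box (c.2.1 j) (c.2.2 j) /\
  (\esum_(j in c.1) (box_vol (c.2.1 j) (c.2.2 j))%:E <=
   lebesgue_outer (F k) + (e / (2 ^ k.+1)%:R)%:E)%E.
have [G PG] : {G & forall k, P k (G k)}.
  apply: choice => k; rewrite /P.
  have ek : 0 < e / (2 ^ k.+1)%:R by rewrite divr_gt0// ltr0n expn_gt0.
  have Ffin : lebesgue_outer (F k) \is a fin_num.
    by rewrite ge0_fin_numE ?lebesgue_outer_ge0// ltey; exact/eqP/Foo.
  have [_ [D [a [b [FD ->]]]] Fv] := lb_ereal_inf_adherent ek Ffin.
  by exists (D, (a, b)); split => //=; exact/ltW.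
pose vol k j := (box_vol ((G k).2.1 j) ((G k).2.2 j))%:E.
have vol0 k j : (0 <= vol k j)%E by rewrite lee_fin box_vol_ge0.
apply: (@le_trans _ _ (\sum_(k <oo) \esum_(j in (G k).1) vol k j)%E); last first.
  apply: lee_nneseries => [k _ _|k _]; last exact: (PG k).2.
  by apply: esum_ge0 => j _; exact: vol0.
rewrite nneseries_esumT; last by move=> k; apply: esum_ge0 => j _; exact: vol0.
rewrite esum_esum//.
have /ppcard_eqP[f] := card_nat2.
pose D := f @` ([set: nat] `*`` fun k => (G k).1).
pose a m := (G (f^-1%FUN m).1).2.1 (f^-1%FUN m).2.
pose b m := (G (f^-1%FUN m).1).2.2 (f^-1%FUN m).2.
apply: ereal_inf_lbound; exists D, a, b; split.
  move=> x [k _ /(PG k).1 [j Gkj xj]].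
  exists (f (k, j)); first by exists (k, j).
  by rewrite /a /b funK ?inE.
rewrite /D esum_image; last by move=> x y _ _ fxy; apply: (@inj _ _ setT f); rewrite ?inE.
by apply: eq_esum => -[k j] _; rewrite /a /b funK ?inE.
Qed.

HB.instance Definition _ := isOuterMeasure.Build R V lebesgue_outer
  lebesgue_outer0 lebesgue_outer_ge0 le_lebesgue_outer
  lebesgue_outer_sigma_subadditive.

End LebesgueRn.

(* 'rV[R]_n with the complete sigma-algebra of Lebesgue measurable sets. *)
Notation lebesgueRn R n := (caratheodory_type (@lebesgue_outer R n)).

Section LebesgueMeasureRn.
Context {R : realType} {n : nat}.

Definition lebesgue : set (lebesgueRn R n) -> \bar R := lebesgue_outer.

Let lebesgue0 : lebesgue set0 = 0%E.
Proof. exact: caratheodory_measure0. Qed.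

Let lebesgue_ge0 A : (0 <= lebesgue A)%E.
Proof. exact: caratheodory_measure_ge0. Qed.

Let lebesgue_semi_sigma_additive : semi_sigma_additive lebesgue.
Proof. exact: caratheodory_measure_sigma_additive. Qed.

HB.instance Definition _ := isMeasure.Build _ _ _ lebesgue
  lebesgue0 lebesgue_ge0 lebesgue_semi_sigma_additive.

End LebesgueMeasureRn.

Section VariableExponent.
Context {R : realType} {n : nat}.
Local Notation V := 'rV[R]_n.
Implicit Types (x y : V) (Q : set V) (w : V -> R).

(* The norm of the library on 'rV[R]_n is the maximum norm. *)
Definition enorm x : R := Num.sqrt (\sum_(i < n) x ord0 i ^+ 2).

Definition exponent_inf (p : V -> \bar R) : \bar R := ess_inf (@lebesgue R n) p.
Definition exponent_sup (p : V -> \bar R) : \bar R := ess_sup (@lebesgue R n) p.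

Definition P0 (p : V -> \bar R) : Prop :=
  [/\ measurable_fun [set: lebesgueRn R n] p, (forall x, 0 < p x)%E
    & (0 < exponent_inf p)%E].

(* For x = y the local condition reads 0 <= - (C0 / ln 0), where ln 0 = 0 and
   division by 0 gives 0, so that it holds, as with the convention
   log 0 = -oo. *)
Definition LH_with (p_inf C0 C_inf : R) (p : V -> R) : Prop :=
  [/\ measurable_fun [set: lebesgueRn R n] p,
      0 < C0 /\ (forall x y, enorm (x - y) < 2^-1 ->
                   `|p x - p y| <= - (C0 / ln (enorm (x - y)))),
      0 < p_inf,
      0 < C_inf &
      forall x, `|p x - p_inf| <= C_inf / ln (expR 1 + enorm x)].

Definition Lnorm_var (q : V -> R) (f : V -> R) : \bar R :=
  ereal_inf [set lam%:E | lam in [set lam : R | 0 < lam /\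
    (\int[@lebesgue R n]_x (`|f x / lam| `^ q x)%:E <= 1)%E]].

Definition is_cube Q : Prop :=
  exists (a : V) (l : R) (b c : 'I_n -> bool), 0 < l /\
    Q = [set x | forall i, x ord0 i \in
          Interval (BSide (b i) (a ord0 i)) (BSide (c i) (a ord0 i + l))].

Definition average Q (f : V -> \bar R) : \bar R :=
  ((@lebesgue R n Q)^-1 * \int[@lebesgue R n]_(x in Q) f x)%E.

(* Product of nonnegative extended reals with +oo * 0 = +oo; the product of the
   library has +oo * 0 = 0. *)
Definition mule_oo (u v : \bar R) : \bar R :=
  if (u == +oo%E) || (v == +oo%E) then +oo%E else (u * v)%E.

Definition cube_norm_ratio (q : V -> R) w Q : \bar R :=
  mule_oo (Lnorm_var q \1_Q)^-1%E (Lnorm_var q (fun x => w x * \1_Q x)).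

Definition is_weight w : Prop :=
  [/\ measurable_fun [set: lebesgueRn R n] w, forall x, 0 <= w x
    & {ae (@lebesgue R n), forall x, 0 < w x}].

(* When the positive and the negative part of log (w^-1) both have an infinite
   integral over Q the library's integral is -oo, and expeR of it is 0. If q is
   bounded away from 0, then Lnorm_var q (w 1_Q) = +oo for such a Q, so that the
   term is +oo by the convention of mule_oo. *)
Definition Ainfty_const (q : V -> R) w : \bar R :=
  ereal_sup [set mule_oo (cube_norm_ratio q w Q)
                         (expeR (average Q (fun y => (ln (w y)^-1)%:E)))
            | Q in is_cube].

Definition Ainfty (q : V -> R) w : Prop :=
  is_weight w /\ (Ainfty_const q w < +oo)%E.

End VariableExponent.

(* Main.v *)
Require Import Defs.
From mathcomp Require Import all_boot all_order all_algebra.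
From mathcomp Require Import all_classical all_reals all_analysis.
From mathcomp Require Import measurable_realfun ess_sup_inf.
From mathcomp Require Import lra ring zify.
Import Order.TTheory GRing.Theory Num.Theory.
Import numFieldNormedType.Exports.
Set Implicit Arguments.
Unset Strict Implicit.
Unset Printing Implicit Defensive.
Local Open Scope classical_set_scope.
Local Open Scope ring_scope.

(** The inequality is a reverse Hoelder inequality: up to a constant, the norm of w on
    a cube Q with exponent r * p is what the norm with exponent p predicts. Write N
    for the norm of w on Q and m for the norm of 1, both with exponent p.

    The A_infty condition bounds the mean of ln (w * (m / N)) over Q below, and the
    modular of w bounds its positive part, so that w is at least a fixed proportion
    of N / m on most of Q ([half_set]). This holds on every cube with the same
    constant. Everything else depends on how well m is known.

    Call a cube tame ([tame]) if, on each of its subcubes of side h, the oscillation of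
    p is at most of order 1 / |ln h|. There m is of the order of h ^ (n / p b) for the
    corner b ([tame_norm], [tame_scale]), and raising it to a power p(x) gives h ^ n
    up to a constant. Hence w ^ p, normalized, satisfies on a tame cube the
    hypothesis of the Calderon-Zygmund argument ([tame_half_level]): on a subcube with
    a large mean, it is not much smaller than this mean on half of the subcube. The
    good-lambda inequality ([good_lambda]) and Gehring's absorption argument
    ([reverse_hoelder_good_lambda]) then give the integrability of w ^ (r * p). The
    constants are powers of W = [w], so that r - 1 may be as large as a negative
    power of W, more than what is claimed. The differentiation of integrals is
    replaced by the fact that a set with density at most eta < 1 in each dyadic cell
    of its points is null ([lebesgue_sparse_eq0]).

    Cubes of side at most 2 are tame by the local log-Hoelder condition, and large
    cubes at a distance from the origin comparable to their side are tame by the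
    condition at infinity. There remain large cubes close to the origin; they lie in
    the centered cube [-L, L) ^ n with L twice the side. A centered cube is a
    union of a bounded cube and of annuli of ratio 3, each made of tame cubes
    ([integral_annulus_le]). The norm of w on it decreases geometrically when L is
    divided by 3 ([reverse_doubling]), because w is not small on most of the annulus.
    Since the norm with exponent r * p has to be compared to N * L ^ (- n * kap) with
    kap = (1 - 1 / r) / p_inf, the gain of reverse doubling beats the loss
    3 ^ (n * kap) once r - 1 is small ([center_scale_third]), and the contributions of the
    annuli to the modular with exponent r * p form a geometric series
    ([centered_chain], [center_reverse_hoelder]). A cube Q of side l near the origin
    inherits the estimate, because it contains a set of measure at least l ^ n / 2 that
    is far from the origin and where w is not small ([center_large_set]). *)

(** * The volume of boxes *)

Section BoxVolume.
Context {R : realType}.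

(** Induction on the dimension: the slices at the height t of the last coordinate
    satisfy the inequality in one dimension less, and integrating it in t gives the
    claim. Boxes are given by functions on nat, so that a slice of a box is the
    same function with a smaller number of coordinates. *)
Lemma prod_le_cover (m : nat) (D : set nat) (a b : nat -> nat -> R) (c d : nat -> R) :
  (forall x : nat -> R, (forall i, (i < m)%N -> c i <= x i <= d i) ->
     exists2 k, D k & forall i, (i < m)%N -> a k i <= x i <= b k i) ->
  ((\prod_(i < m) Num.max 0 (d i - c i))%:E <=
   \esum_(k in D) (\prod_(i < m) Num.max 0 (b k i - a k i))%:E)%E.
Proof.
have vol0 (m' : nat) (u v : nat -> R) : 0 <= \prod_(i < m') Num.max 0 (u i - v i).
  by apply: prodr_ge0 => i _; rewrite le_max lexx.
elim: m D c d => [|m IH] D c d cov.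
  have [//|k Dk _] := cov (fun=> 0).
  apply: esum_ge; exists [set k].
    by split => // ? ->.
  by rewrite fsbig_set1 !big_ord0.
pose v k := \prod_(i < m) Num.max 0 (b k i - a k i).
pose g k (t : R) : \bar R :=
  if k \in D then ((v k)%:E * (\1_`[a k m, b k m]%classic t)%:E)%E else 0%E.
have g0 k t : (0 <= g k t)%E.
  by rewrite /g; case: ifP => // _; rewrite mule_ge0// lee_fin ?vol0// indicE.
pose V := \prod_(i < m) Num.max 0 (d i - c i).
have key t : (V%:E * (\1_`[c m, d m]%classic t)%:E <= \sum_(0 <= k <oo) g k t)%E.
  rewrite indicE; case: (boolP (t \in _)) => [|_]; last first.
    by rewrite mule0; apply: nneseries_ge0 => k _ _; exact: g0.
  rewrite inE /= in_itv/= => ct; rewrite mule1.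
  apply: (le_trans (IH (D `&` [set k | a k m <= t <= b k m]) c d _)).
    move=> x xcd.
    have [|k Dk kx] := cov (fun i => if i == m then t else x i).
      move=> i; rewrite ltnS leq_eqVlt; case: eqP => [-> //|_ /= im].
      exact: xcd.
    exists k; first by split => //; have := kx m (ltnSn m); rewrite eqxx.
    move=> i im; have := kx i (ltnW im).
    by rewrite ifF//; apply/negbTE; rewrite neq_ltn im.
  rewrite nneseries_esumT; last by move=> k; exact: g0.
  rewrite esum_mkcond; apply: le_esum => k _.
  rewrite /g; case: ifPn => [|_]; last exact: g0.
  rewrite inE => -[Dk /= kt]; rewrite ifT ?inE//.
  by rewrite indicE mem_set ?mule1//= in_itv.
have mg k : measurable_fun [set: R] (g k).
  rewrite /g; case: (k \in D); last exact: measurable_cst.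
  by apply: measurable_funeM; apply/measurable_EFinP; exact: measurable_indic.
have itvE (u w : R) : (@lebesgue_measure R `[u, w]%classic = (Num.max 0 (w - u))%:E)%E.
  rewrite lebesgue_measure_itv/= lte_fin; case: ltP => uw.
    by rewrite max_r// subr_ge0 ltW.
  by rewrite max_l// subr_le0.
have int (r u w : R) : 0 <= r ->
    (\int[@lebesgue_measure R]_t (r%:E * (\1_`[u, w]%classic t)%:E) =
     (r * Num.max 0 (w - u))%:E)%E.
  move=> r0; rewrite ge0_integralZl//.
  - by rewrite integral_indic// setIT EFinM; congr (_ * _)%E; exact: itvE.
  - by apply/measurable_EFinP; exact: measurable_indic.
rewrite big_ord_recr/= -/V -int ?vol0//.
apply: (@le_trans _ _ (\int[@lebesgue_measure R]_t \sum_(0 <= k <oo) g k t)%E).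
  apply: ge0_le_integral => //.
  - by move=> t _; rewrite mule_ge0// lee_fin ?vol0// indicE.
  - apply: measurable_funeM; apply/measurable_EFinP; exact: measurable_indic.
  - by apply: ge0_emeasurable_sum => *; [exact: g0|exact: mg].
rewrite integral_nneseries//.
rewrite nneseries_esumT; last by move=> k; apply: integral_ge0 => t _.
rewrite [leRHS]esum_mkcond; apply: le_esum => k _.
rewrite /g; case: ifP => // _; last by rewrite integral0.
by rewrite int ?vol0// big_ord_recr.
Qed.

End BoxVolume.

Section BoxMeasure.
Context {R : realType} {n : nat}.
Local Notation V := 'rV[R]_n.
Local Notation mu := (@lebesgue R n).
Implicit Types (a b x : V) (l c : R).

Lemma lebesgueE (X : set (lebesgueRn R n)) : mu X = lebesgue_outer X.
Proof. by []. Qed.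

Lemma lebesgue_box a b : (forall i, a ord0 i <= b ord0 i) ->
  lebesgue_outer (box a b) = (box_vol a b)%:E.
Proof.
move=> ab; apply/eqP; rewrite eq_le; apply/andP; split.
  apply: ereal_inf_lbound; exists [set 0%N], (fun=> a), (fun=> b); split.
    by move=> x abx; exists 0%N.
  by rewrite esum_set1// lee_fin box_vol_ge0.
apply: le_ereal_inf_tmp => _ [D [s [t [cov ->]]]].
pose e (v : V) (i : nat) : R := if insub i is Some j then v ord0 j else 0.
have eE v (i : 'I_n) : e v i = v ord0 i.
  by rewrite /e valK.
have volE u v : box_vol u v = \prod_(i < n) Num.max 0 (e v i - e u i).
  by apply: eq_bigr => i _; rewrite !eE.
rewrite volE; under eq_esum do rewrite volE.
apply: (@prod_le_cover R n D (fun k => e (s k)) (fun k => e (t k))) => x xab.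
have /cov [k Dk kx] : box a b (\row_i x i).
  by move=> i; have := xab i (ltn_ord i); rewrite !eE mxE.
exists k => // i im; have := kx (Ordinal im); rewrite mxE/=.
by rewrite -!eE.
Qed.

Lemma le_lebesgue_box a b : (lebesgue_outer (box a b) <= (box_vol a b)%:E)%E.
Proof.
apply: ereal_inf_lbound; exists [set 0%N], (fun=> a), (fun=> b); split.
  by move=> x abx; exists 0%N.
by rewrite esum_set1// lee_fin box_vol_ge0.
Qed.

End BoxMeasure.

(** * Measurability and measure of cubes *)

Section CubeMeasure.
Context {R : realType} {n : nat}.
Local Notation V := 'rV[R]_n.
Local Notation mu := (@lebesgue R n).
Implicit Types (a b x : V) (l c : R).

(** The boxes of a cover, cut along the hyperplane, cover both parts of a set with
    the same total volume; closed boxes do not see the side on which the hyperplane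
    itself is counted. *)
Lemma measurable_between_halfspaces (i : 'I_n) c (A : set (lebesgueRn R n)) :
  A `<=` [set x : V | x ord0 i <= c] -> ~` A `<=` [set x : V | c <= x ord0 i] ->
  measurable A.
Proof.
move=> Al Ag.
apply: le_caratheodory_measurable => X.
apply: le_ereal_inf_tmp => _ [D [a [b [cov ->]]]].
pose b' k : V := \row_j if j == i then Num.min (b k ord0 j) c else b k ord0 j.
pose a' k : V := \row_j if j == i then Num.max (a k ord0 j) c else a k ord0 j.
apply: (@le_trans _ _ (\esum_(k in D) (box_vol (a k) (b' k))%:E +
                       \esum_(k in D) (box_vol (a' k) (b k))%:E)%E).
  apply: leeD; apply: ereal_inf_lbound.
    exists D, a, b'; split => // x [/cov[k Dk kx] /Al/= xc].
    exists k => // j; rewrite mxE; have := kx j.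
    by case: eqP => // -> /andP[-> ?]; rewrite le_min xc andbT.
  exists D, a', b; split => // x [/cov[k Dk kx] /Ag/= xc].
  exists k => // j; rewrite mxE; have := kx j.
  by case: eqP => // -> /andP[? ->]; rewrite ge_max xc !andbT.
rewrite -esumD; last 2 first.
- by move=> k _; rewrite lee_fin box_vol_ge0.
- by move=> k _; rewrite lee_fin box_vol_ge0.
apply: le_esum => k _; rewrite lee_fin /box_vol.
rewrite (bigD1 i)//= [in X in _ + X <= _](bigD1 i)//= [leRHS](bigD1 i)//=.
rewrite !mxE eqxx.
have -> : \prod_(j < n | j != i) Num.max 0 (b' k ord0 j - a k ord0 j) =
   \prod_(j < n | j != i) Num.max 0 (b k ord0 j - a k ord0 j).
  by apply: eq_bigr => j ji; rewrite mxE (negbTE ji).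
have -> : \prod_(j < n | j != i) Num.max 0 (b k ord0 j - a' k ord0 j) =
   \prod_(j < n | j != i) Num.max 0 (b k ord0 j - a k ord0 j).
  by apply: eq_bigr => j ji; rewrite mxE (negbTE ji).
rewrite -mulrDl; apply: ler_wpM2r.
  by apply: prodr_ge0 => j _; rewrite le_max lexx.
move: (b k ord0 i) (a k ord0 i) => u v.
rewrite /Num.max /Num.min; repeat case: ifPn; rewrite ?subr_gt0 -?leNgt; lra.
Qed.

Lemma measurable_le_coord (i : 'I_n) c :
  measurable ([set x : V | x ord0 i <= c] : set (lebesgueRn R n)).
Proof.
by apply: (@measurable_between_halfspaces i c) => // x /= /negP; rewrite -ltNge => /ltW.
Qed.

Lemma measurable_lt_coord (i : 'I_n) c :
  measurable ([set x : V | x ord0 i < c] : set (lebesgueRn R n)).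
Proof.
apply: (@measurable_between_halfspaces i c) => // x /=.
  by move=> /ltW.
by move/negP; rewrite -leNgt.
Qed.

(** Half-open cubes tile, which makes them the convenient cubes to work with. *)
Definition hcube a l : set (lebesgueRn R n) :=
  [set x : V | forall i, a ord0 i <= x ord0 i < a ord0 i + l].

Lemma measurable_forall_coord (P : 'I_n -> set (lebesgueRn R n)) :
  (forall i, measurable (P i)) -> measurable [set x | forall i, P i x].
Proof.
move=> mP; rewrite (_ : [set x | _] = \bigcap_(i in [set: 'I_n]) P i).
  by apply: fin_bigcap_measurable => //; exact: finite_finset.
by apply/seteqP; split => x /= Px i //; exact: Px.
Qed.

Lemma measurable_itv_coord (i : 'I_n) (J : interval R) :
  measurable ([set x : V | x ord0 i \in J] : set (lebesgueRn R n)).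
Proof.
case: J => u v.
have mL : measurable ([set x : V | Order.le u (BLeft (x ord0 i))] : set (lebesgueRn R n)).
  case: u => [[] u|[]].
  - rewrite (_ : [set x | _] = ~` [set x : V | x ord0 i < u]).
      by apply: measurableC; exact: measurable_lt_coord.
    by apply/seteqP; split => x /=; rewrite bnd_simp leNgt => /negP.
  - rewrite (_ : [set x | _] = ~` [set x : V | x ord0 i <= u]).
      by apply: measurableC; exact: measurable_le_coord.
    by apply/seteqP; split => x /=; rewrite bnd_simp ltNge => /negP.
  - by rewrite (_ : [set x | _] = setT)//; apply/seteqP; split => x /=; rewrite ?bnd_simp.
  - by rewrite (_ : [set x | _] = set0)//; apply/seteqP; split => x /=; rewrite ?bnd_simp.
have mR : measurable ([set x : V | Order.le (BRight (x ord0 i)) v] : set (lebesgueRn R n)).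
  case: v => [[] v|[]].
  - rewrite (_ : [set x | _] = [set x : V | x ord0 i < v]).
      exact: measurable_lt_coord.
    by apply/seteqP; split => x /=; rewrite bnd_simp.
  - rewrite (_ : [set x | _] = [set x : V | x ord0 i <= v]).
      exact: measurable_le_coord.
    by apply/seteqP; split => x /=; rewrite bnd_simp.
  - by rewrite (_ : [set x | _] = set0)//; apply/seteqP; split => x /=; rewrite ?bnd_simp.
  - by rewrite (_ : [set x | _] = setT)//; apply/seteqP; split => x /=; rewrite ?bnd_simp.
rewrite (_ : [set x | _] = [set x : V | Order.le u (BLeft (x ord0 i))] `&`
                           [set x : V | Order.le (BRight (x ord0 i)) v]).
  exact: measurableI.
by apply/seteqP; split => x /=; rewrite itv_boundlr; [move/andP|move=> ?; apply/andP].
Qed.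

Lemma hcubeE a l : hcube a l =
  [set x : V | forall i, x ord0 i \in `[a ord0 i, a ord0 i + l[].
Proof. by apply/seteqP; split => x /= h i; have := h i; rewrite in_itv. Qed.

Lemma measurable_hcube a l : measurable (hcube a l).
Proof.
rewrite hcubeE; apply: (@measurable_forall_coord (fun i => [set x : V | x ord0 i \in _])) => i.
exact: measurable_itv_coord.
Qed.

Lemma box_vol_shift a l : 0 <= l -> box_vol a (\row_i (a ord0 i + l)) = l ^+ n.
Proof.
move=> l0; rewrite /box_vol.
under eq_bigr do rewrite mxE [_ + l]addrC addrK max_r//.
by rewrite prodr_const card_ord.
Qed.

Lemma lebesgue_coord_eq0 a l (i : 'I_n) c :
  mu ([set x : V | forall j, a ord0 j <= x ord0 j <= a ord0 j + l] `&` [set x : V | x ord0 i = c]) = 0%E.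
Proof.
apply/eqP; rewrite eq_le; apply/andP; split; last exact: lebesgue_outer_ge0.
pose a' : V := \row_j if j == i then c else a ord0 j.
pose b' : V := \row_j if j == i then c else a ord0 j + l.
apply: (@le_trans _ _ (lebesgue_outer (box a' b'))).
  apply: le_lebesgue_outer => x [xal /= xc] j; rewrite !mxE.
  by case: eqP => [->|_]; [rewrite xc lexx|exact: xal].
apply: (le_trans (le_lebesgue_box _ _)); rewrite lee_fin /box_vol (bigD1 i)//=.
by rewrite !mxE eqxx subrr maxxx mul0r.
Qed.

(** Two cubes that differ by their faces differ by a subset of finitely many
    degenerate boxes, so that every estimate needs only the half-open cubes. *)
Lemma cube_faces_negligible a l (b c : 'I_n -> bool) :
  exists N : set (lebesgueRn R n), [/\ measurable N, mu N = 0%E &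
    forall x : V, ~ N x ->
      ((forall i, x ord0 i \in
          Interval (BSide (b i) (a ord0 i)) (BSide (c i) (a ord0 i + l))) <->
       hcube a l x)].
Proof.
pose C : set V := [set x : V | forall j, a ord0 j <= x ord0 j <= a ord0 j + l].
pose F (i : 'I_n) : set (lebesgueRn R n) := (C `&` [set x : V | x ord0 i = a ord0 i]) `|`
  (C `&` [set x : V | x ord0 i = a ord0 i + l]).
have mC : measurable (C : set (lebesgueRn R n)).
  rewrite (_ : C = [set x : V | forall i, x ord0 i \in `[a ord0 i, a ord0 i + l]]).
    apply: (@measurable_forall_coord (fun i => [set x : V | x ord0 i \in _])) => i.
    exact: measurable_itv_coord.
  by apply/seteqP; split => x /= h i; have := h i; rewrite in_itv.
have mE i t : measurable ([set x : V | x ord0 i = t] : set (lebesgueRn R n)).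
  rewrite (_ : [set x | _] = [set x : V | x ord0 i \in `[t, t]]).
    exact: measurable_itv_coord.
  by apply/seteqP; split => x /=; rewrite in_itv/= -eq_le eq_sym => /eqP.
have mF i : measurable (F i).
  by apply: measurableU; apply: measurableI.
have F0 i : mu (F i) = 0%E.
  by rewrite measureU0//; [exact: lebesgue_coord_eq0|exact: measurableI
    |exact: measurableI|exact: lebesgue_coord_eq0].
have [mU U0] : measurable (\big[setU/set0]_(i < n) F i) /\ mu (\big[setU/set0]_(i < n) F i) = 0%E.
  apply: (big_ind (fun A : set (lebesgueRn R n) => measurable A /\ mu A = 0%E)) => //.
  by move=> A B [mA A0] [mB B0]; split; [exact: measurableU|rewrite measureU0].
exists (\big[setU/set0]_(i < n) F i); split => //.
have FU i x : F i x -> (\big[setU/set0]_(i < n) F i) x.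
  by move=> Fx; rewrite (bigD1 i)//=; left.
move=> x Nx; split => [h i|h i].
  have xC : C x by move=> j; have := h j; rewrite itv_boundlr /= ?bnd_simp => /andP[]; 
    case: (b j); case: (c j); rewrite ?bnd_simp => *; apply/andP; split => //; exact: ltW.
  have /andP[-> /=] := xC i; rewrite le_eqVlt => /orP[/eqP xe|//].
  by exfalso; apply: Nx; apply: (FU i); right.
have xC : C x by move=> j; have /andP[-> /ltW] := h j.
have /andP[ax xl] := h i.
have ax' : a ord0 i < x ord0 i.
  move: ax; rewrite le_eqVlt => /orP[/eqP xe|//].
  by exfalso; apply: Nx; apply: (FU i); left.
by rewrite itv_boundlr; case: (b i); case: (c i); rewrite !bnd_simp ?ax ?xl ?ax' ?(ltW xl).
Qed.

Lemma lebesgue_hcube a l : 0 < l -> mu (hcube a l) = (l ^+ n)%:E.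
Proof.
move=> l0.
have [N [mN N0 hN]] := cube_faces_negligible a l (fun=> true) (fun=> false).
have boxE : box a (\row_i (a ord0 i + l)) = [set x : V | forall i, x ord0 i \in
          Interval (BSide true (a ord0 i)) (BSide false (a ord0 i + l))].
  by apply/seteqP; split => x /= h i; have := h i; rewrite mxE in_itv.
rewrite -(box_vol_shift a (ltW l0)) -lebesgue_box; last by move=> i; rewrite mxE lerDl ltW.
rewrite boxE; set C := [set x | _].
have mC : measurable (C : set (lebesgueRn R n)).
  apply: (@measurable_forall_coord (fun i => [set x : V | x ord0 i \in _])) => i.
  exact: measurable_itv_coord.
rewrite -[RHS]/(mu C).
have E1 : C `\` N = hcube a l `\` N.
  by apply/seteqP; split => x [xC xN]; split => //; apply/(hN x xN).
have D0 (A : set (lebesgueRn R n)) : measurable A -> mu A = mu (A `\` N).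
  move=> mA; rewrite (measureDI _ mA mN) (subset_measure0 (measurableI _ _ mA mN) mN (@subIsetr _ _ _) N0).
  by rewrite adde0.
by rewrite (D0 _ mC) (D0 _ (measurable_hcube _ _)) E1.
Qed.

End CubeMeasure.

(** * Dyadic cells and sparse sets *)

Section DyadicCells.
Context {R : realType} {n : nat}.
Local Notation V := 'rV[R]_n.
Local Notation mu := (@lebesgue R n).
Variables (a : V) (l : R).
Hypothesis l0 : 0 < l.
Implicit Types (x y : V) (N : nat) (k : 'rV[int]_n).

Definition dyadic_side N : R := l / 2 ^+ N.

Lemma dyadic_side_gt0 N : 0 < dyadic_side N.
Proof. by rewrite divr_gt0// exprn_gt0. Qed.

Lemma dyadic_side0 : dyadic_side 0 = l.
Proof. by rewrite /dyadic_side expr0 divr1. Qed.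

Lemma dyadic_sideS N : dyadic_side N = 2 * dyadic_side N.+1.
Proof. by rewrite /dyadic_side exprS; field; rewrite expf_neq0. Qed.

Definition dyadic_index N x : 'rV[int]_n :=
  \row_i Num.floor ((x ord0 i - a ord0 i) / dyadic_side N).

Definition dyadic_cell N k : set (lebesgueRn R n) := [set x : V | dyadic_index N x = k].

Lemma dyadic_cellE N k : dyadic_cell N k =
  hcube (\row_i (a ord0 i + (k ord0 i)%:~R * dyadic_side N)) (dyadic_side N).
Proof.
have h0 := dyadic_side_gt0 N.
apply/seteqP; split => x.
  move=> <- i; rewrite !mxE.
  have /andP[] := floor_itv ((x ord0 i - a ord0 i) / dyadic_side N).
  rewrite ler_pdivlMr// ltr_pdivrMr//; set f := Num.floor _.
  rewrite intrD mulr1z mulrDl mul1r => ? ?; apply/andP; split; lra.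
move=> h; apply/rowP => i; rewrite mxE; apply: floor_def.
have /andP[] := h i; rewrite !mxE.
rewrite ler_pdivlMr// ltr_pdivrMr// intrD mulr1z mulrDl mul1r; move=> ? ?; apply/andP; split; lra.
Qed.

Lemma measurable_dyadic_cell N k : measurable (dyadic_cell N k).
Proof. by rewrite dyadic_cellE; exact: measurable_hcube. Qed.

Lemma lebesgue_dyadic_cell N k : mu (dyadic_cell N k) = (dyadic_side N ^+ n)%:E.
Proof. by rewrite dyadic_cellE lebesgue_hcube// dyadic_side_gt0. Qed.

Lemma dyadic_cell0 : dyadic_cell 0 0 = hcube a l.
Proof.
rewrite dyadic_cellE dyadic_side0; congr hcube.
by apply/rowP => i; rewrite !mxE mul0r addr0.
Qed.

Lemma dyadic_index_succ N x y :
  dyadic_index N.+1 x = dyadic_index N.+1 y -> dyadic_index N x = dyadic_index N y.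
Proof.
move=> /rowP xy; apply/rowP => i; have := xy i; rewrite !mxE.
have half (t : R) : t / dyadic_side N = t / dyadic_side N.+1 / 2.
  by rewrite dyadic_sideS invfM mulrCA mulrC.
rewrite !half.
have fl (t : R) : 2 * Num.floor (t / 2) <= Num.floor t < 2 * Num.floor (t / 2) + 2.
  have /andP[t1 t2] := floor_itv (t / 2).
  rewrite floor_ge_int floor_lt_int; rewrite !(intrD, intrM) in t1 t2 *.
  by apply/andP; split; lra.
set s := _ / _; set t := (y _ _ - _) / _ => st.
have := fl s; have := fl t; rewrite st; lia.
Qed.

Lemma dyadic_index_le M N x y : (M <= N)%N ->
  dyadic_index N x = dyadic_index N y -> dyadic_index M x = dyadic_index M y.
Proof.
move=> /subnK <-; elim: (N - M)%N => // d IH; rewrite addSn => /dyadic_index_succ.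
exact: IH.
Qed.

Lemma dyadic_cell_sub M N x : (M <= N)%N ->
  dyadic_cell N (dyadic_index N x) `<=` dyadic_cell M (dyadic_index M x).
Proof. by move=> MN y; exact: dyadic_index_le. Qed.

Lemma dyadic_cell_root N x : hcube a l x ->
  dyadic_cell N (dyadic_index N x) `<=` hcube a l.
Proof.
rewrite -dyadic_cell0 => xQ y /(dyadic_index_le (leq0n N)) yx.
by rewrite /dyadic_cell/= yx.
Qed.

(** Dyadic cells of a fixed generation are countable in number and disjoint, so
    that no counting is needed to see that those meeting a box have a total volume
    of at most that of the box enlarged by the side of the cells. *)
Lemma lebesgue_sparse_box (E : set V) (eta : R) (b c : V) N : 0 <= eta ->
  (forall i, b ord0 i <= c ord0 i) ->
  (forall x, E x -> (lebesgue_outer (E `&` dyadic_cell N (dyadic_index N x)) <=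
     (eta * dyadic_side N ^+ n)%:E)%E) ->
  (lebesgue_outer (E `&` box b c) <=
    (eta * \prod_(i < n) ((c ord0 i - b ord0 i) + 2 * dyadic_side N))%:E)%E.
Proof.
move=> eta0 bc sparse; set h := dyadic_side N.
have h0 : 0 < h := dyadic_side_gt0 N.
pose G (m : nat) : set (lebesgueRn R n) :=
  if @pickle_inv 'rV[int]_n m is Some k then
    if `[< exists x, [/\ E x, box b c x & dyadic_index N x = k] >]
    then dyadic_cell N k else set0
  else set0.
have GP m : G m = set0 \/ exists x, [/\ E x, box b c x,
    pickle_inv m = Some (dyadic_index N x) & G m = dyadic_cell N (dyadic_index N x)].
  rewrite /G; case E1 : (pickle_inv m) => [k|]; last by left.
  case: asboolP => [[x [Ex bx xk]]|_]; last by left.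
  by right; exists x; rewrite xk.
have mG m : measurable (G m).
  case: (GP m) => [->|[x [_ _ _ ->]]]; first exact: measurable0.
  exact: measurable_dyadic_cell.
have tG : trivIset setT G.
  move=> i j _ _ [y [yi yj]].
  have Gy m : G m y -> pickle_inv m = Some (dyadic_index N y).
    case: (GP m) => [->//|[x [_ _ mx ->]] yx].
    by rewrite mx; congr Some; rewrite -yx.
  have := Gy _ yi; have := Gy _ yj => e1 e2.
  have := @pickle_invK 'rV[int]_n i; have := @pickle_invK 'rV[int]_n j.
  by rewrite e1 e2 /= => <- <-.
have cov : E `&` box b c `<=` \bigcup_m (E `&` G m).
  move=> x [Ex bx]; exists (pickle (dyadic_index N x)) => //; split => //.
  by rewrite /G pickleK_inv asboolT//; exists x.
apply: (le_trans (le_lebesgue_outer cov)).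
apply: (le_trans (outer_measure_sigma_subadditive _ _)).
apply: (@le_trans _ _ (\sum_(0 <= m <oo) (eta%:E * mu (G m)))%E).
  apply: lee_nneseries => [m _ _|m _]; first exact: lebesgue_outer_ge0.
  case: (GP m) => [->|[x [Ex _ _ ->]]].
    by rewrite setI0 -[leLHS]/(lebesgue_outer set0) lebesgue_outer0 mule_ge0// lee_fin.
  by rewrite lebesgue_dyadic_cell -EFinM; exact: sparse.
rewrite nneseriesZl; last by move=> m _; exact: measure_ge0.
rewrite -measure_semi_bigcup//; last exact: bigcup_measurable.
rewrite EFinM lee_wpmul2l ?lee_fin//.
pose b' : V := \row_i (b ord0 i - h); pose c' : V := \row_i (c ord0 i + h).
have GB : \bigcup_m G m `<=` box b' c'.
  move=> y [m _]; case: (GP m) => [->//|[x [_ bx _ ->]]].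
  rewrite -/(dyadic_cell _ _ _) /dyadic_cell/= => yx i; rewrite !mxE.
  have yc : dyadic_cell N (dyadic_index N x) y by [].
  have xc : dyadic_cell N (dyadic_index N x) x by [].
  move: yc xc; rewrite dyadic_cellE => /(_ i)/andP[y1 y2] /(_ i)/andP[x1 x2].
  have /andP[b1 b2] := bx i; rewrite -/h in y1 y2 x1 x2; apply/andP; split; lra.
apply: (le_trans (le_lebesgue_outer GB)).
apply: (le_trans (le_lebesgue_box _ _)); rewrite lee_fin /box_vol.
apply: ler_prod => i _; rewrite !mxE le_max lexx/= ge_max; have := bc i.
by move=> bci; apply/andP; split; lra.
Qed.

(** A set that fills no dyadic cell beyond a fixed proportion is null: covers by
    boxes can be traded for covers by cells, which improves the volume of every
    cover by a fixed factor. This is the part of the Lebesgue differentiation theorem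
    that a stopping-time argument uses. *)
Lemma lebesgue_sparse_eq0 (E : set V) (eta : R) : 0 <= eta < 1 ->
  E `<=` hcube a l ->
  (forall N x, E x -> (lebesgue_outer (E `&` dyadic_cell N (dyadic_index N x)) <=
     (eta * dyadic_side N ^+ n)%:E)%E) ->
  lebesgue_outer E = 0%E.
Proof.
move=> /andP[eta0 eta1] EQ sparse.
have sparse_box (b c : V) : (lebesgue_outer (E `&` box b c) <= (eta * box_vol b c)%:E)%E.
  have [bc|] := pselect (forall i, b ord0 i <= c ord0 i); last first.
    move=> /existsNP[i /negP bci]; rewrite (_ : E `&` _ = set0).
      by rewrite lebesgue_outer0 lee_fin mulr_ge0// box_vol_ge0.
    apply/seteqP; split => // x [_ /(_ i)/andP[bx xc]].
    by rewrite (le_trans bx xc) in bci.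
  have -> : box_vol b c = \prod_(i < n) (c ord0 i - b ord0 i).
    by apply: eq_bigr => i _; rewrite max_r// subr_ge0.
  have cvg : ((eta * \prod_(i < n) ((c ord0 i - b ord0 i) + 2 * dyadic_side N))%:E @[N --> \oo]
      --> (eta * \prod_(i < n) (c ord0 i - b ord0 i))%:E)%E.
    apply: cvg_EFin; first by apply: nearW.
    apply: cvgMr; apply: cvg_big => [|i _]; first exact: mul_continuous.
    rewrite -[X in _ --> X]addr0; apply: cvgD; first exact: cvg_cst.
    rewrite -(mulr0 2); apply: cvgMr.
    have -> : dyadic_side = geometric l 2^-1.
      by apply/funext => N; rewrite /geometric/= exprVn.
    by apply: cvg_geometric; rewrite ger0_norm ?invf_lt1// ltr1n.
  rewrite -(cvg_lim _ cvg)//; apply: lime_ge; first by apply/cvg_ex; eexists; exact: cvg.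
  apply: nearW => N; apply: lebesgue_sparse_box => // x Ex; exact: sparse.
have Efin : (lebesgue_outer E < +oo)%E.
  apply: (le_lt_trans (le_lebesgue_outer EQ)).
  by rewrite -[lebesgue_outer _]/(mu _) lebesgue_hcube// ltry.
have E0 := lebesgue_outer_ge0 E.
pose t := (eta + 1) / 2.
have t0 : 0 < t by rewrite /t; lra.
have : ((t^-1)%:E * lebesgue_outer E <= lebesgue_outer E)%E.
  apply: le_ereal_inf_tmp => _ [D [u [v [cov ->]]]]; rewrite lee_pdivrMl//.
  pose F (k : nat) := if k \in D then E `&` box (u k) (v k) else set0.
  have EF : E `<=` \bigcup_k F k.
    by move=> x Ex; have [k Dk kx] := cov _ Ex; exists k => //; rewrite /F ifT// inE.
  apply: (le_trans (le_lebesgue_outer EF)).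
  apply: (le_trans (outer_measure_sigma_subadditive _ _)).
  rewrite esum_mkcond -nneseries_esumT; last first.
    by move=> k; case: ifP => // _; rewrite lee_fin box_vol_ge0.
  rewrite -nneseriesZl; last first.
    by move=> k _; case: ifP => // _; rewrite lee_fin box_vol_ge0.
  apply: lee_nneseries => [k _ _|k _]; first exact: lebesgue_outer_ge0.
  rewrite /F; case: ifP => _; last first.
    by rewrite mule0 -[leLHS]/(lebesgue_outer set0) lebesgue_outer0.
  apply: (le_trans (sparse_box _ _)); rewrite -EFinM lee_fin ler_wpM2r ?box_vol_ge0//.
  by rewrite /t; lra.
rewrite lee_pdivrMl//.
have Ef : lebesgue_outer E \is a fin_num by rewrite ge0_fin_numE.
rewrite -(fineK Ef) in E0 *; rewrite -EFinM !lee_fin in E0 * => h.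
congr EFin; apply/eqP; rewrite eq_le E0 andbT.
have : t < 1 by rewrite /t; lra.
move: (fine _) h E0 => s; nra.
Qed.

End DyadicCells.

(** * Integrals of nonnegative functions *)

Section NonnegIntegral.
Context d (T : measurableType d) (R : realType) (mu : {measure set T -> \bar R}).
Implicit Types (A B : set T) (f g : T -> R) (c : R).

Lemma measurable_EFinT f A : measurable_fun setT f -> measurable_fun A (EFin \o f).
Proof. by move=> mf; apply: measurable_funTS; exact/measurable_EFinP. Qed.

Lemma measurable_sublevel f c : measurable_fun setT f -> measurable [set x | (f x <= c)%R].
Proof.
move=> mf; rewrite -[X in measurable X]setTI.
have := mf measurableT _ (measurable_itv `]-oo, c]%R).
by rewrite (_ : f @^-1` _ = [set x | f x <= c])//; apply/seteqP; split => y/=; rewrite in_itv.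
Qed.

Lemma measurable_superlevel f c : measurable_fun setT f -> measurable [set x | (c < f x)%R].
Proof.
move=> mf; rewrite (_ : [set x | _] = ~` [set x | (f x <= c)%R]).
  exact/measurableC/measurable_sublevel.
by apply/seteqP; split => y /=; rewrite ltNge => /negP.
Qed.

Lemma le_integral_on A f g : measurable A ->
  measurable_fun setT f -> measurable_fun setT g ->
  (forall x, A x -> 0 <= f x <= g x) ->
  (\int[mu]_(x in A) (f x)%:E <= \int[mu]_(x in A) (g x)%:E)%E.
Proof.
move=> mA mf mg fg; apply: ge0_le_integral => //.
- by move=> x /fg/andP[f0 _]; rewrite lee_fin.
- exact: measurable_EFinT.
- exact: measurable_EFinT.
- by move=> x /fg/andP[_ ?]; rewrite lee_fin.
Qed.

Lemma integral_le_cst A f c : measurable A -> measurable_fun setT f ->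
  (forall x, A x -> 0 <= f x <= c) ->
  (\int[mu]_(x in A) (f x)%:E <= c%:E * mu A)%E.
Proof.
move=> mA mf fc; rewrite -integral_cst//.
by apply: (@le_integral_on A f (cst c)).
Qed.

Lemma integral_ge_cst A f c : measurable A -> measurable_fun setT f -> 0 <= c ->
  (forall x, A x -> c <= f x) ->
  (c%:E * mu A <= \int[mu]_(x in A) (f x)%:E)%E.
Proof.
move=> mA mf c0 fc; rewrite -integral_cst//.
by apply: (@le_integral_on A (cst c) f) => // x Ax; rewrite c0 fc.
Qed.

Lemma integral_sub_on A B f : measurable A -> measurable B -> measurable_fun setT f ->
  (forall x, B x -> 0 <= f x) -> A `<=` B ->
  (\int[mu]_(x in A) (f x)%:E <= \int[mu]_(x in B) (f x)%:E)%E.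
Proof.
move=> mA mB mf f0 AB; apply: ge0_subset_integral => //; exact: measurable_EFinT.
Qed.

Lemma integralZ_on A f c : measurable A -> measurable_fun setT f -> 0 <= c ->
  (forall x, A x -> 0 <= f x) ->
  (\int[mu]_(x in A) (c * f x)%:E = c%:E * \int[mu]_(x in A) (f x)%:E)%E.
Proof.
move=> mA mf c0 f0; under eq_integral do rewrite EFinM.
by rewrite ge0_integralZl//; exact: measurable_EFinT.
Qed.

Lemma integral_splitI A B f : measurable A -> measurable B -> measurable_fun setT f ->
  (forall x, A x -> 0 <= f x) ->
  (\int[mu]_(x in A) (f x)%:E =
   \int[mu]_(x in A `&` B) (f x)%:E + \int[mu]_(x in A `\` B) (f x)%:E)%E.
Proof.
move=> mA mB mf f0; rewrite -ge0_integral_setU//.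
- by rewrite setUIDK.
- exact: measurableI.
- exact: measurableD.
- exact: measurable_EFinT.
- by move=> x; rewrite setUIDK => /f0.
- by apply/disj_setPS => x [[_ Bx] [_ /(_ Bx)]].
Qed.

Lemma integral_setU_le A B f : measurable A -> measurable B -> measurable_fun setT f ->
  (forall x, 0 <= f x) ->
  (\int[mu]_(x in A `|` B) (f x)%:E <=
   \int[mu]_(x in A) (f x)%:E + \int[mu]_(x in B) (f x)%:E)%E.
Proof.
move=> mA mB mf f0; rewrite (@integral_splitI (A `|` B) A)//; last exact: measurableU.
apply: leeD; apply: integral_sub_on => //.
- by apply: measurableI => //; exact: measurableU.
- by apply: measurableD => //; exact: measurableU.
- by move=> x [[]].
Qed.

End NonnegIntegral.

(** * The Calderon-Zygmund decomposition *)

Section CalderonZygmund.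
Context {R : realType} {n : nat}.
Local Notation V := 'rV[R]_n.
Local Notation mu := (@lebesgue R n).
Variables (a : V) (l : R).
Hypothesis l0 : 0 < l.
Variables (u : V -> R) (beta : R).
Hypothesis mu_u : measurable_fun [set: lebesgueRn R n] u.
Hypothesis u0 : forall x, 0 <= u x.
Hypothesis beta0 : 0 < beta <= 1.
Local Notation Q := (hcube a l).
Local Notation side := (dyadic_side l).
Local Notation cell N x := (dyadic_cell a l N (dyadic_index a l N x)).
Hypothesis uQ : (\int[mu]_(x in Q) (u x)%:E <= (l ^+ n)%:E)%E.
Hypothesis half : forall N (x : V) lam, Q x -> 1 <= lam ->
  ((lam * side N ^+ n)%:E < \int[mu]_(y in cell N x) (u y)%:E)%E ->
  (mu (cell N x `&` [set y : V | (u y <= beta * lam)%R]) <= (side N ^+ n / 2)%:E)%E.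

Let msuper c : measurable ([set y : V | c < u y] : set (lebesgueRn R n)).
Proof. exact: measurable_superlevel. Qed.

(* The Calderon-Zygmund stopping time at the level lam. *)
Let stop lam N x := ((lam * side N ^+ n)%:E < \int[mu]_(y in cell N x) (u y)%:E)%E /\
  forall M, (M < N)%N -> (\int[mu]_(y in cell M x) (u y)%:E <= (lam * side M ^+ n)%:E)%E.

Let stop_uniq lam N M x : stop lam N x -> stop lam M x -> N = M.
Proof.
move=> [N1 N2] [M1 M2]; apply/eqP; rewrite eqn_leq; apply/andP; split; rewrite leqNgt; apply/negP.
- by move=> /N2; rewrite leNgt M1.
- by move=> /M2; rewrite leNgt N1.
Qed.

Let stop_cell lam N x y : cell N x y -> stop lam N x -> stop lam N y.
Proof.
move=> yx [N1 N2]; split; first by rewrite [dyadic_index _ _ N y]yx.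
by move=> M MN; rewrite (dyadic_index_le l0 (ltnW MN) yx); exact: N2.
Qed.

Let stop_exists lam N x : ((lam * side N ^+ n)%:E < \int[mu]_(y in cell N x) (u y)%:E)%E ->
  exists M, stop lam M x.
Proof.
move=> h.
pose P M := `[< ((lam * side M ^+ n)%:E < \int[mu]_(y in cell M x) (u y)%:E)%E >].
have exP : exists M, P M by exists N; exact/asboolP.
exists (ex_minn exP); case: ex_minnP => M /asboolP PM minM; split => // K KM.
by rewrite leNgt; apply/negP => PK; have := minM K (asboolT PK); rewrite leqNgt KM.
Qed.

(* The stopping cells, enumerated through a code of their generation and index, so
   that countable unions and sums over nat apply. *)
Let stop_family lam (m : nat) : set (lebesgueRn R n) :=
  if @pickle_inv (nat * 'rV[int]_n)%type m is Some (N, k) then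
    [set x | Q x /\ dyadic_index a l N x = k /\ stop lam N x]
  else set0.

Let stop_familyP lam m : stop_family lam m = set0 \/
  exists N x, [/\ Q x, stop lam N x, pickle_inv m = Some (N, dyadic_index a l N x)
    & stop_family lam m = cell N x].
Proof.
have [|/set0P[x]] := eqVneq (stop_family lam m) set0; first by left.
rewrite {1}/stop_family; case E : (pickle_inv m) => [[N k]|//] [Qx [xk sx]].
right; exists N, x; split => //; first by rewrite xk.
rewrite /stop_family E; apply/seteqP; split => [y [_ [yk _]]|y yx].
  by rewrite /dyadic_cell/= yk xk.
split; first exact: dyadic_cell_root Qx _ yx.
by split; [rewrite -xk|exact: stop_cell sx].
Qed.

Let mstop_family lam m : measurable (stop_family lam m).
Proof.
case: (stop_familyP lam m) => [->|[N [x [_ _ _ ->]]]]; first exact: measurable0.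
exact: measurable_dyadic_cell.
Qed.

Let stop_family_triv lam : trivIset setT (stop_family lam).
Proof.
move=> i j _ _ [y [yi yj]].
have Gy m : stop_family lam m y -> exists N, stop lam N y /\
    pickle_inv m = Some (N, dyadic_index a l N y).
  case: (stop_familyP lam m) => [->//|[N [x [Qx sx mx ->]]] yx].
  by exists N; split; [exact: stop_cell sx|rewrite mx yx].
have [N [sN e1]] := Gy _ yi; have [M [sM e2]] := Gy _ yj.
move: e2; rewrite -(stop_uniq sN sM) => e2.
have := @pickle_invK (nat * 'rV[int]_n)%type i; have := @pickle_invK (nat * 'rV[int]_n)%type j.
by rewrite e1 e2 /= => <- <-.
Qed.

(* The parent of a stopping cell has an average of at most lam, so that the integral
   over the cell is at most 2 ^ n * lam times its measure, half of which is counted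
   on the right-hand side. *)
Let stop_family_le lam m : 1 <= lam ->
  (\int[mu]_(x in stop_family lam m) (u x)%:E <=
   (2 ^+ n.+1 * lam)%:E * mu (stop_family lam m `&` [set y : V | (beta * lam < u y)%R]))%E.
Proof.
move=> lam1; have lam0 : 0 < lam by rewrite (lt_le_trans _ lam1).
case: (stop_familyP lam m) => [->|[N [x [Qx [sN sM] _ ->]]]].
  rewrite integral_set0 mule_ge0// lee_fin mulr_ge0 ?exprn_ge0// ltW//.
have mc := measurable_dyadic_cell a l0.
case: N sN sM => [|N] sN sM.
  exfalso; move: sN; rewrite (_ : cell 0 x = Q).
    rewrite dyadic_side0 ltNge (le_trans uQ)// lee_fin ler_peMl// exprn_ge0// ltW//.
  by rewrite -(dyadic_cell0 a l0); move: Qx; rewrite -(dyadic_cell0 a l0) /dyadic_cell/= => ->.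
have side1 := dyadic_side_gt0 l0 N.+1.
have halfN := half Qx lam1 sN.
have big : ((side N.+1 ^+ n / 2)%:E <= mu (cell N.+1 x `&` [set y : V | (beta * lam < u y)%R]))%E.
  set U := [set y : V | (beta * lam < u y)%R].
  have : mu (cell N.+1 x) = (mu (cell N.+1 x `\` U) + mu (cell N.+1 x `&` U))%E.
    by apply: measureDI; [exact: mc|exact: msuper].
  rewrite lebesgue_dyadic_cell// setDE (_ : ~` U = [set y | u y <= beta * lam]); last first.
    by apply/seteqP; split => y /=; rewrite leNgt => /negP.
  set X := mu _; set Y := mu _ => XY.
  have {}halfN : (X <= (side N.+1 ^+ n / 2)%:E)%E := halfN.
  have : (X + Y)%E \is a fin_num by rewrite -XY.
  rewrite fin_numD => /andP[Xf Yf]; move: XY halfN.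
  rewrite -(fineK Xf) -(fineK Yf) -EFinD !lee_fin => -[XY]; lra.
apply: (@le_trans _ _ (2 ^+ n.+1 * lam * (side N.+1 ^+ n / 2))%:E); last first.
  by rewrite EFinM lee_wpmul2l// lee_fin mulr_ge0 ?exprn_ge0// ltW.
apply: (@le_trans _ _ (\int[mu]_(y in cell N x) (u y)%:E)%E).
  by apply: integral_sub_on => //; exact: dyadic_cell_sub.
apply: (le_trans (sM N (ltnSn N))); rewrite lee_fin dyadic_sideS exprMn exprS.
by rewrite le_eqVlt; apply/orP; left; apply/eqP; field.
Qed.

(** The stopping cells at the level lam cover the set where u exceeds lam, up to a
    null set: a point where u is larger than lam * (1 + q) and that lies in no
    stopping cell sees this set with density at most (1 + q)^-1 in every cell. *)
Lemma good_lambda lam : 1 <= lam ->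
  (\int[mu]_(x in Q `&` [set y : V | (lam < u y)%R]) (u x)%:E <=
   (2 ^+ n.+1 * lam)%:E * mu (Q `&` [set y : V | (beta * lam < u y)%R]))%E.
Proof.
move=> lam1; have lam0 : 0 < lam by rewrite (lt_le_trans _ lam1).
set A := Q `&` _.
have mQ : measurable Q := measurable_hcube a l.
have mA : measurable A by exact: measurableI.
pose Om := \bigcup_m stop_family lam m.
have mOm : measurable Om by exact: bigcup_measurable.
have OmQ : Om `<=` Q.
  move=> x [m _]; case: (stop_familyP lam m) => [->//|[N [y [Qy _ _ ->]]]].
  exact: dyadic_cell_root.
have mE : measurable (A `\` Om) by exact: measurableD.
have E0 : mu (A `\` Om) = 0%E.
  (* Strict excess over lam has to be quantified for the density bound. *)
  pose E j := (A `\` Om) `&` [set y : V | lam * (1 + j.+1%:R^-1) < u y].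
  have Ej j : lebesgue_outer (E j) = 0%E.
    have j0 : 0 < j.+1%:R^-1 :> R by rewrite invr_gt0.
    rewrite /E; move: (j.+1%:R^-1) j0 => q j0 {E}.
    set E := _ `&` _.
    pose eta : R := (1 + q)^-1.
    have eta0 : 0 < eta by rewrite invr_gt0; lra.
    apply: (@lebesgue_sparse_eq0 _ _ a l l0 E eta).
    - by rewrite (ltW eta0)/= /eta invf_lt1; lra.
    - by move=> x [[[]]].
    move=> N x Ex; rewrite leNgt; apply/negP => big.
    have Qx : Q x by case: Ex => [[[]]].
    case: (Ex) => [[_ nOm] _]; apply: nOm.
    have [|M sM] := @stop_exists lam N x.
      have mE' : measurable (E : set (lebesgueRn R n)) by apply: measurableI => //; exact: msuper.
      have mc := measurable_dyadic_cell a l0 N (dyadic_index a l N x).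
      apply: (@lt_le_trans _ _ (\int[mu]_(y in E `&` cell N x) (u y)%:E)%E); last first.
        by apply: integral_sub_on => //; exact: measurableI.
      apply: (@lt_le_trans _ _ ((lam / eta)%:E * mu (E `&` cell N x))%E); last first.
        apply: integral_ge_cst => //; first exact: measurableI.
        - by rewrite ltW// divr_gt0.
        - by move=> y [[_ /= uy] _]; rewrite /eta invrK ltW.
      rewrite (_ : lam * side N ^+ n = lam / eta * (eta * side N ^+ n)); last first.
        by rewrite mulrA divfK ?gt_eqF.
      by rewrite EFinM lte_pmul2l// lte_fin divr_gt0.
    exists (pickle (M, dyadic_index a l M x)) => //.
    by rewrite /stop_family pickleK_inv.
  apply/eqP; rewrite eq_le measure_ge0 andbT.
  have AE : A `\` Om `<=` \bigcup_j E j.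
    move=> x [[Qx /= ux] nOm].
    have [j jx] : exists j : nat, (u x / lam - 1)^-1 < j.+1%:R.
      exists (Num.truncn (u x / lam - 1)^-1); exact: truncnS_gt.
    exists j => //; split => //=.
    have ul : 0 < u x / lam - 1 by rewrite subr_gt0 ltr_pdivlMr// mul1r.
    have : j.+1%:R^-1 < u x / lam - 1 by rewrite invf_plt// posrE.
    by move=> h; rewrite mulrC -ltr_pdivlMr//; move: (j.+1%:R^-1) h => q h; lra.
  apply: (le_trans (le_lebesgue_outer AE)).
  apply: (le_trans (outer_measure_sigma_subadditive _ _)).
  by rewrite eseries0// => j _ _; exact: Ej.
have muE : measurable_fun A (EFin \o u) by exact: measurable_EFinT.
rewrite (ge0_negligible_integral mE mA muE _ E0); last by move=> x _; rewrite lee_fin.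
apply: (@le_trans _ _ (\int[mu]_(x in Om) (u x)%:E)%E).
  apply: integral_sub_on => //; first exact: measurableD.
  by move=> x [Ax nAO]; apply: contrapT => nOm; apply: nAO.
rewrite ge0_integral_bigcup//; last 2 first.
- exact: measurable_EFinT.
- by move=> x _; rewrite lee_fin.
apply: (@le_trans _ _ (\sum_(0 <= m <oo) ((2 ^+ n.+1 * lam)%:E *
    mu (stop_family lam m `&` [set y : V | (beta * lam < u y)%R])))%E).
  apply: lee_nneseries => [m _ _|m _]; last exact: stop_family_le.
  by apply: integral_ge0 => x _; rewrite lee_fin.
rewrite nneseriesZl; last by move=> *; exact: measure_ge0.
apply: lee_wpmul2l; first by rewrite lee_fin mulr_ge0 ?exprn_ge0// ltW.
have mI m : measurable (stop_family lam m `&` [set y : V | (beta * lam < u y)%R]).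
  by apply: measurableI => //; exact: msuper.
rewrite -measure_semi_bigcup//; last 2 first.
- move=> i j _ _ [y [[yi _] [yj _]]]; apply: (stop_family_triv (lam := lam)) => //.
  by exists y.
- exact: bigcup_measurable.
apply: le_measure; rewrite ?inE.
- exact: bigcup_measurable.
- by apply: measurableI => //; exact: msuper.
- by move=> x [m _ [Fx ux]]; split => //; apply: OmQ; exists m.
Qed.

End CalderonZygmund.

(** * From the good-lambda inequality to higher integrability *)

Section ReverseHoelder.
Context {R : realType}.

Lemma powR2_sub1_le (e : R) : 0 <= e <= 2^-1 -> 2 `^ e - 1 <= 2 * e.
Proof.
move=> /andP[e0 e2].
have ln2 : ln (2 : R) <= 1 by have := @le_ln1Dx R 1; rewrite (_ : 1 + 1 = 2)//; apply; lra.
have le : 2 `^ e <= expR e by rewrite /powR ifF ?gt_eqF// ler_expR; nra.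
have := @expR_ge1Dx R (- e); rewrite expRN => h.
have : expR e <= (1 - e)^-1.
  rewrite -[leLHS]invrK lef_pV2 ?posrE ?invr_gt0 ?expR_gt0//; lra.
have : (1 - e)^-1 <= 1 + 2 * e.
  by rewrite -[leRHS]mulr1 -[(1 - e)^-1]mul1r ler_pdivrMr; nra.
lra.
Qed.

(** The truncated power as a finite layer cake over the levels 2 ^ k: finite sums
    take the place of an integral over the levels. *)
Definition layer_power (e : R) (M : nat) (t : R) : R :=
  1 + \sum_(k < M) ((2 `^ e) ^+ k.+1 - (2 `^ e) ^+ k) * (2 ^+ k < t)%R%:R.

Lemma powR2_ge1 (e : R) : 0 <= e -> 1 <= 2 `^ e.
Proof. by move=> e0; rewrite -[leLHS](powRr0 2) ler_powR// ler1n. Qed.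

Lemma layer_power_ge1 (e : R) M (t : R) : 0 <= e -> 1 <= layer_power e M t.
Proof.
move=> e0; rewrite lerDl; apply: sumr_ge0 => k _; rewrite mulr_ge0//.
by rewrite subr_ge0 exprS ler_peMl ?exprn_ge0 ?powR_ge0 ?powR2_ge1.
Qed.

Lemma layer_power_full (e : R) M (t : R) : (forall k, (k < M)%N -> 2 ^+ k < t) ->
  layer_power e M t = (2 `^ e) ^+ M.
Proof.
elim: M => [|M IH] h; first by rewrite /layer_power big_ord0 addr0 expr0.
rewrite /layer_power big_ord_recr/= h// mulr1 addrA -/(layer_power e M t) IH.
  by rewrite addrC subrK.
by move=> k kM; apply: h; rewrite ltnW.
Qed.

Lemma layer_power_le (e : R) M (t : R) : 0 <= e -> layer_power e M t <= (2 `^ e) ^+ M.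
Proof.
move=> e0; rewrite -(@layer_power_full e M (2 ^+ M + 1)); last first.
  by move=> k kM; rewrite ltr_pwDr// ler_weXn2l// ?ler1n// ltnW.
rewrite lerD2l; apply: ler_sum => k _; rewrite [in leRHS]ltr_pwDr//; last first.
  by rewrite ler_weXn2l ?ler1n// ltnW.
rewrite mulr1 ler_piMr ?lern1 ?leq_b1//.
by rewrite subr_ge0 exprS ler_peMl ?exprn_ge0 ?powR_ge0 ?powR2_ge1.
Qed.

Lemma min_powR_le_layer (e : R) M (t : R) : 0 <= e -> 0 <= t ->
  Num.min t (2 ^+ M) `^ e <= layer_power e M t.
Proof.
move=> e0 t0; elim: M => [|M IH].
  rewrite /layer_power big_ord0 addr0 expr0 [leRHS](_ : 1 = 1 `^ e); last by rewrite powR1.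
  by apply: ge0_ler_powR => //; rewrite ?nnegrE ?le_min ?t0//= ge_min lexx orbT.
have mono : layer_power e M t <= layer_power e M.+1 t.
  rewrite /layer_power big_ord_recr/= addrA lerDl mulr_ge0//.
  by rewrite subr_ge0 exprS ler_peMl ?exprn_ge0 ?powR_ge0 ?powR2_ge1.
have [tM|tM] := leP t (2 ^+ M).
  rewrite min_l in IH => //; apply: le_trans mono; rewrite min_l//.
  by rewrite (le_trans tM)// ler_weXn2l// ler1n.
rewrite layer_power_full; last first.
  by move=> k; rewrite ltnS => kM; rewrite (le_lt_trans _ tM)// ler_weXn2l// ler1n.
rewrite -[leRHS]powR_mulrn ?powR_ge0// -powRrM mulrC powRrM powR_mulrn//.
by apply: ge0_ler_powR => //; rewrite ?nnegrE ?le_min ?t0 ?exprn_ge0//= ge_min lexx orbT.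
Qed.

(** The sum is geometric, hence comparable to its last term. *)
Lemma sum_layer_le (e : R) M (t : R) : 0 <= e -> 0 <= t ->
  \sum_(k < M) (2 * 2 `^ e) ^+ k * (2 ^+ k < t)%R%:R <=
  2 * (Num.min t (2 ^+ M) * Num.min t (2 ^+ M) `^ e).
Proof.
move=> e0 t0; elim: M => [|M IH].
  by rewrite big_ord0 mulr_ge0// mulr_ge0 ?powR_ge0// le_min t0 exprn_ge0.
have b1 := powR2_ge1 e0.
have geo m : \sum_(k < m.+1) (2 * 2 `^ e) ^+ k <= 2 * (2 * 2 `^ e) ^+ m.
  elim: m => [|m IHm]; first by rewrite big_ord1 !expr0; lra.
  rewrite big_ord_recr/= (_ : 2 * (2 * 2 `^ e) ^+ m.+1 = (2 * 2 `^ e) ^+ m.+1 + (2 * 2 `^ e) ^+ m.+1); last by ring.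
  rewrite lerD2r (le_trans IHm)// [leRHS]exprS ler_wpM2r ?exprn_ge0//; lra.
have [tM|tM] := leP t (2 ^+ M).
  have tM1 : t <= 2 ^+ M.+1 by rewrite (le_trans tM)// ler_weXn2l// ler1n.
  rewrite big_ord_recr/= [(_ < t)%R]ltNge tM/= mulr0 addr0 (min_l tM1).
  by rewrite (min_l tM) in IH.
apply: (@le_trans _ _ (2 * (2 * 2 `^ e) ^+ M)).
  apply: le_trans (geo M); apply: ler_sum => k _.
  by rewrite ler_piMr ?exprn_ge0 ?mulr_ge0 ?powR_ge0// lern1 leq_b1.
rewrite ler_pM2l// exprMn.
have m1 : 2 ^+ M <= Num.min t (2 ^+ M.+1).
  by rewrite le_min ltW//= ler_weXn2l// ler1n.
apply: ler_pM => //; rewrite ?exprn_ge0 ?powR_ge0//.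
rewrite -[leLHS]powR_mulrn ?powR_ge0// -powRrM mulrC powRrM powR_mulrn//.
by apply: ge0_ler_powR => //; rewrite nnegrE ?exprn_ge0// (le_trans _ m1) ?exprn_ge0.
Qed.

Lemma sum_layer_div_le (e : R) M (t beta : R) : 0 <= e <= 1 -> 0 <= t -> 0 < beta <= 1 ->
  \sum_(k < M) (2 * 2 `^ e) ^+ k * (beta * 2 ^+ k < t)%R%:R <=
  2 * beta ^- 2 * (t * layer_power e M t).
Proof.
move=> /andP[e0 e1] t0 /andP[b0 b1].
have bV1 : 1 <= beta^-1 by rewrite invf_ge1.
have bV0 : 0 < beta^-1 by rewrite invr_gt0.
have tb0 : 0 <= t / beta by rewrite divr_ge0// ltW.
have scale k : (beta * 2 ^+ k < t) = (2 ^+ k < t / beta) by rewrite ltr_pdivlMr// mulrC.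
under eq_bigr do rewrite scale.
apply: (le_trans (sum_layer_le M e0 tb0)).
rewrite -mulrA ler_pM2l//.
have minM : Num.min (t / beta) (2 ^+ M) <= beta^-1 * Num.min t (2 ^+ M).
  rewrite [leRHS]mulrC ler_pdivlMr// le_min -ler_pdivlMr// ge_min lexx/=.
  apply: (@le_trans _ _ (Num.min (t / beta) (2 ^+ M))); last by rewrite ge_min lexx orbT.
  by rewrite ler_piMr// le_min tb0 exprn_ge0.
have m0 : 0 <= Num.min t (2 ^+ M) by rewrite le_min t0 exprn_ge0.
have m0' : 0 <= Num.min (t / beta) (2 ^+ M) by rewrite le_min tb0 exprn_ge0.
apply: (@le_trans _ _ (t / beta * (beta^-1 * layer_power e M t))); last first.
  by rewrite le_eqVlt; apply/orP; left; apply/eqP; field; rewrite gt_eqF.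
apply: ler_pM => //; first exact: powR_ge0.
  by rewrite ge_min lexx.
apply: (@le_trans _ _ ((beta^-1 * Num.min t (2 ^+ M)) `^ e)).
  by apply: ge0_ler_powR; rewrite ?nnegrE// mulr_ge0// ltW.
rewrite powRM ?(ltW bV0)//; apply: ler_pM; rewrite ?powR_ge0//.
  exact: ler1_powR.
exact: min_powR_le_layer.
Qed.

Context d (T : measurableType d) (mu : {measure set T -> \bar R}).

(** Gehring's absorption argument: summing the good-lambda inequality over the
    levels bounds the truncated integral by itself, with a factor at most 1/2 once
    the gain e in the exponent is small with respect to beta. *)
Lemma reverse_hoelder_good_lambda (A : set T) (u : T -> R) (c K beta e : R) :
  measurable A -> measurable_fun setT u -> (forall x, 0 <= u x) ->
  0 <= c -> 1 <= K -> 0 < beta <= 1 -> 0 < e -> 8 * K * e <= beta ^+ 2 ->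
  (\int[mu]_(x in A) (u x)%:E <= c%:E)%E ->
  (forall lam, 1 <= lam ->
    (\int[mu]_(x in A `&` [set y | (lam < u y)%R]) (u x)%:E <=
     (K * lam)%:E * mu (A `&` [set y | (beta * lam < u y)%R]))%E) ->
  (\int[mu]_(x in A) (u x `^ (1 + e))%:E <= (2 * c)%:E)%E.
Proof.
move=> mA mu_u u0 c0 K1 /[dup] b01 /andP[b0 b1] e0 small intu good.
have e2 : e <= 2^-1.
  have : beta ^+ 2 <= 1 by rewrite expr_le1// ltW.
  nra.
have e01 : 0 <= e <= 1 by lra.
have K0 : 0 <= K by lra.
have mlt (s : R) : measurable [set y | (s < u y)%R] by exact: measurable_superlevel.
have mind (s : R) : measurable_fun setT (fun x => (s < u x)%R%:R : R).
  rewrite (_ : (fun x => _) = \1_[set y | (s < u y)%R]); first exact: measurable_indic.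
  by apply/funext => x; rewrite indicE; congr (_%:R); congr nat_of_bool; apply/idP/idP; rewrite inE.
have int_ind (s : R) : (\int[mu]_(x in A) ((s < u x)%R%:R)%:E = mu (A `&` [set y | (s < u y)%R]))%E.
  rewrite setIC -integral_indic//; apply: eq_integral => x _; rewrite indicE.
  by congr ((_%:R)%:E); congr nat_of_bool; apply/idP/idP; rewrite inE.
have int_uind (s : R) : (\int[mu]_(x in A) (u x * (s < u x)%R%:R)%:E =
    \int[mu]_(x in A `&` [set y | (s < u y)%R]) (u x)%:E)%E.
  rewrite integral_mkcondr; apply: eq_integral => x _; rewrite patchE.
  case: ifPn => [|]; first by rewrite inE /= => ->; rewrite mulr1.
  by move=> /negP; rewrite inE/= => /negP/negbTE ->; rewrite mulr0.
pose b : R := 2 `^ e.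
have bge1 : 1 <= b by rewrite powR2_ge1// ltW.
have db k : 0 <= b ^+ k.+1 - b ^+ k.
  by rewrite subr_ge0 exprS ler_peMl// exprn_ge0// (le_trans _ bge1).
have b0e : 0 <= b by rewrite (le_trans _ bge1).
pose L M x := layer_power e M (u x).
have mL M : measurable_fun setT (L M).
  apply: measurable_funD => //.
  by apply: measurable_sum => k; apply: measurable_funM.
have mphi M : measurable_fun setT (fun x => u x * L M x) by apply: measurable_funM.
have L1 M x : 1 <= L M x by rewrite layer_power_ge1// ltW.
have L0 M x : 0 <= L M x by rewrite (le_trans _ (L1 M x)).
have key M : (\int[mu]_(x in A) (u x * L M x)%:E <= (2 * c)%:E)%E.
  set X := (X in (X <= _)%E).
  (* The truncation makes X finite, which allows the absorption of X / 2. *)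
  have Xub : (X <= (b ^+ M * c)%:E)%E.
    apply: (@le_trans _ _ (\int[mu]_(x in A) (b ^+ M * u x)%:E)%E).
      apply: le_integral_on => //; first exact: measurable_funM.
      move=> x _; rewrite mulr_ge0//= mulrC ler_wpM2r//.
      exact: layer_power_le (ltW e0).
    by rewrite integralZ_on ?exprn_ge0// EFinM lee_wpmul2l// lee_fin exprn_ge0.
  have X0 : (0 <= X)%E.
    by apply: integral_ge0 => x _; rewrite lee_fin mulr_ge0.
  have Xfin : X \is a fin_num by rewrite ge0_fin_numE// (le_lt_trans Xub)// ltry.
  have : (X <= c%:E + (2^-1)%:E * X)%E.
    pose dk (k : nat) := b ^+ k.+1 - b ^+ k.
    have dk0 k : 0 <= dk k by exact: db.
    have XE : X = (\int[mu]_(x in A) ((u x)%:E +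
        \sum_(k < M) (dk k * (u x * (2 ^+ k < u x)%R%:R))%:E))%E.
      apply: eq_integral => x _; rewrite sumEFin -EFinD; congr EFin.
      rewrite /L /layer_power mulrDr mulr1; congr (_ + _).
      by rewrite mulr_sumr; apply: eq_bigr => k _; rewrite mulrCA.
    have mu1 s : measurable_fun setT (fun x => u x * (s < u x)%R%:R).
      by apply: measurable_funM.
    rewrite [leLHS]XE ge0_integralD//; last 4 first.
    - by move=> x _; rewrite lee_fin.
    - exact: measurable_EFinT.
    - by move=> x _; apply: sume_ge0 => k _; rewrite lee_fin mulr_ge0// mulr_ge0.
    - apply: emeasurable_sum => k.
      by apply: measurable_EFinT; apply: measurable_funM.
    apply: leeD => //.
    rewrite ge0_integral_sum//; last 2 first.
    - by move=> k; apply: measurable_EFinT; apply: measurable_funM.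
    - by move=> k x _; rewrite lee_fin mulr_ge0// mulr_ge0.
    apply: (@le_trans _ _ (\sum_(k < M) \int[mu]_(x in A)
        ((dk k * (K * 2 ^+ k)) * (beta * 2 ^+ k < u x)%R%:R)%:E)%E).
      apply: lee_sum => k _.
      have K2 : 0 <= K * 2 ^+ k by rewrite mulr_ge0 ?exprn_ge0.
      rewrite !integralZ_on ?mulr_ge0//; last by move=> x _; rewrite mulr_ge0.
      rewrite int_uind int_ind EFinM -muleA lee_wpmul2l ?lee_fin//.
      by apply: good; rewrite exprn_ege1// ler1n.
    rewrite -(@ge0_integral_sum _ _ _ mu A mA _ (fun (k : 'I_M) x =>
        ((dk k * (K * 2 ^+ k)) * (beta * 2 ^+ k < u x)%R%:R)%:E))//; last 2 first.
    - by move=> k; apply: measurable_EFinT; apply: measurable_funM.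
    - by move=> k x _; rewrite lee_fin mulr_ge0// mulr_ge0// mulr_ge0 ?exprn_ge0// (le_trans _ K1).
    rewrite /X -integralZ_on//; last by move=> x _; rewrite mulr_ge0.
    under eq_integral do rewrite sumEFin.
    apply: le_integral_on => //.
    - apply: measurable_sum => k; exact: measurable_funM.
    - exact: measurable_funM.
    move=> x _; apply/andP; split.
      by apply: sumr_ge0 => k _; rewrite mulr_ge0// mulr_ge0// mulr_ge0 ?exprn_ge0.
    under eq_bigr => k _.
      rewrite (_ : dk k * _ * _ = (b - 1) * K * ((2 * b) ^+ k * (beta * 2 ^+ k < u x)%R%:R)).
      over.
      rewrite /dk exprS exprMn; ring.
    rewrite -mulr_sumr.
    have bK : 0 <= (b - 1) * K by rewrite mulr_ge0 ?subr_ge0.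
    apply: (@le_trans _ _ ((b - 1) * K * (2 * beta ^- 2 * (u x * L M x)))).
      by rewrite ler_wpM2l// sum_layer_div_le.
    rewrite [leLHS]mulrA; apply: ler_wpM2r; first exact: mulr_ge0.
    rewrite [leLHS]mulrA ler_pdivrMr ?exprn_gt0//.
    have : b - 1 <= 2 * e by apply: powR2_sub1_le; rewrite ltW.
    move: (b - 1) bge1 bK => s _ _ se.
    have : s * K <= 2 * e * K by rewrite ler_wpM2r.
    lra.
  rewrite -(fineK Xfin) -EFinM -EFinD !lee_fin; lra.
pose g M x := u x * Num.min (u x) (2 ^+ M) `^ e.
have mg M : measurable_fun setT (g M).
  apply: measurable_funM => //.
  apply: (@measurableT_comp _ _ _ _ _ _ (fun t : R => t `^ e)); first exact: measurable_powR.
  exact: measurable_minr.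
have g0 M x : 0 <= g M x by rewrite mulr_ge0// powR_ge0.
have min0 M x : 0 <= Num.min (u x) (2 ^+ M) by rewrite le_min u0 exprn_ge0.
have gnd x : {homo (fun M => (g M x)%:E) : M N / (M <= N)%N >-> (M <= N)%E}.
  move=> M N MN; rewrite lee_fin ler_wpM2l// ge0_ler_powR ?nnegrE ?(ltW e0)//.
  by rewrite le_min ge_min lexx/= ge_min ler_weXn2l ?orbT// ler1n.
have glim x : (limn (fun M => (g M x)%:E) = (u x `^ (1 + e))%:E)%E.
  apply/cvg_lim => //; apply: cvg_near_cst.
  exists (Num.truncn (u x)).+1 => // M /= uM; congr EFin; rewrite /g min_l.
    by rewrite -(@mulr_powRB1 _ (u x) (1 + e))// ?[1 + e]addrC ?addrK// ltr_wpDr.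
  apply: ltW; apply: (lt_le_trans (truncnS_gt _)).
  rewrite -natrX ler_nat (leq_trans uM)//.
  exact: (ltnW (ltn_expl _ _)).
under eq_integral do rewrite -glim.
rewrite monotone_convergence//; last 2 first.
- by move=> M; exact: measurable_EFinT.
- by move=> M x _; rewrite lee_fin.
apply: lime_le.
  apply: ereal_nondecreasing_is_cvgn => M N MN.
  apply: ge0_le_integral => //; try by exact: measurable_EFinT.
  - by move=> x _; rewrite lee_fin.
  - by move=> x _; exact: gnd.
apply: nearW => M; apply: le_trans (key M).
apply: le_integral_on => // x _; rewrite g0/= ler_wpM2l//.
by apply: min_powR_le_layer => //; exact: ltW.
Qed.

End ReverseHoelder.

(** * The norm of a function restricted to a set *)

Section VariableNorm.
Context {R : realType} {n : nat}.
Local Notation V := 'rV[R]_n.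
Local Notation mu := (@lebesgue R n).
Implicit Types (A B : set (lebesgueRn R n)) (q w : V -> R).

Lemma measurable_powR_fun d (T : measurableType d) (f q : T -> R) :
  measurable_fun setT f -> measurable_fun setT q ->
  measurable_fun setT (fun x => f x `^ q x).
Proof.
move=> mf mq; rewrite /powR; apply: measurable_fun_ifT => //.
- exact: measurable_fun_eqr.
- apply: measurableT_comp => //; apply: measurable_fun_eqr => //.
- apply: measurableT_comp => //; apply: measurable_funM => //.
  exact: measurableT_comp.
Qed.

Definition norm_on q A w : \bar R := Lnorm_var q (fun x => w x * \1_A x).

Lemma norm_onE q A w : (forall x, 0 < q x) -> (forall x, 0 <= w x) ->
  norm_on q A w = ereal_inf [set lam%:E | lam in [set lam : R | 0 < lam /\
    (\int[mu]_(x in A) ((w x / lam) `^ q x)%:E <= 1)%E]].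
Proof.
move=> q0 w0; rewrite /norm_on /Lnorm_var.
have E lam : 0 < lam -> (\int[mu]_x (`|w x * \1_A x / lam| `^ q x)%:E =
    \int[mu]_(x in A) ((w x / lam) `^ q x)%:E)%E.
  move=> l0; rewrite [RHS]integral_mkcond; apply: eq_integral => x _.
  rewrite patchE indicE; case: ifP => _; rewrite ?mulr1 ?mulr0 ?mul0r.
    by rewrite ger0_norm// divr_ge0// ltW.
  by rewrite normr0 powR0// gt_eqF.
apply: (f_equal (fun S : set R => ereal_inf [set lam%:E | lam in S])).
apply/funext => lam; apply/propext.
split => -[l0 h]; (split; first exact: l0).
  by rewrite -E.
by rewrite E.
Qed.

Lemma indic_norm_on q A : Lnorm_var q \1_A = norm_on q A (fun=> 1).
Proof. by rewrite /norm_on; congr Lnorm_var; apply/funext => x; rewrite mul1r. Qed.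

Variable q : V -> R.
Hypothesis q0 : forall x, 0 < q x.
Hypothesis mq : measurable_fun [set: lebesgueRn R n] q.
Variable w : V -> R.
Hypothesis w0 : forall x, 0 <= w x.
Hypothesis mw : measurable_fun [set: lebesgueRn R n] w.

Lemma measurable_modular c : measurable_fun [set: lebesgueRn R n] (fun x => (w x / c) `^ q x).
Proof.
apply: measurable_powR_fun mq; apply: measurable_funM mw _; exact: measurable_cst.
Qed.

Lemma norm_on_ge0 A : (0 <= norm_on q A w)%E.
Proof.
by rewrite norm_onE//; apply: le_ereal_inf_tmp => _ [lam [l0 _] <-]; rewrite lee_fin ltW.
Qed.

Lemma norm_on_le A lam : 0 < lam ->
  (\int[mu]_(x in A) ((w x / lam) `^ q x)%:E <= 1)%E -> (norm_on q A w <= lam%:E)%E.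
Proof. by move=> l0 h; rewrite norm_onE//; apply: ereal_inf_lbound; exists lam. Qed.

Lemma modular_anti A lam nu : measurable A -> 0 < lam -> lam <= nu ->
  (\int[mu]_(x in A) ((w x / nu) `^ q x)%:E <= \int[mu]_(x in A) ((w x / lam) `^ q x)%:E)%E.
Proof.
move=> mA l0 lm; have m0 : 0 < nu by rewrite (lt_le_trans l0).
apply: (le_integral_on mu mA (measurable_modular nu) (measurable_modular lam)) => x _.
rewrite powR_ge0/= ge0_ler_powR ?nnegrE ?divr_ge0 ?(ltW l0) ?(ltW m0) ?(ltW (q0 x))//.
by rewrite ler_wpM2l// lef_pV2.
Qed.

Lemma norm_on_modular_le1 A lam : measurable A -> (norm_on q A w < lam%:E)%E ->
  (\int[mu]_(x in A) ((w x / lam) `^ q x)%:E <= 1)%E.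
Proof.
move=> mA; rewrite norm_onE// => /ereal_inf_lt[_ [nu [nu0 h] <-]]; rewrite lte_fin => nl.
by apply: le_trans h; apply: modular_anti => //; exact: ltW.
Qed.

Lemma norm_on_ge A (c : R) :
  (forall lam, 0 < lam -> lam < c -> (1 < \int[mu]_(x in A) ((w x / lam) `^ q x)%:E)%E) ->
  (c%:E <= norm_on q A w)%E.
Proof.
move=> h; rewrite norm_onE//; apply: le_ereal_inf_tmp => _ [lam [l0 hl] <-].
rewrite lee_fin leNgt; apply/negP => lc; have := h _ l0 lc.
by rewrite ltNge hl.
Qed.

Lemma norm_on_sub A B : measurable A -> measurable B -> A `<=` B ->
  (norm_on q A w <= norm_on q B w)%E.
Proof.
move=> mA mB AB; rewrite !norm_onE//; apply: ereal_inf_le_tmp => _ [lam [l0 h] <-].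
exists lam => //; split => //; apply: le_trans h.
by apply: (integral_sub_on mu mA mB (measurable_modular lam) _ AB) => x _; exact: powR_ge0.
Qed.

Lemma norm_on_null A B N : measurable A -> measurable B -> measurable N -> mu N = 0%E ->
  (forall x, ~ N x -> (A x <-> B x)) -> norm_on q A w = norm_on q B w.
Proof.
move=> mA mB mN N0 AB; rewrite !norm_onE//; congr ereal_inf.
have E lam : (\int[mu]_(x in A) ((w x / lam) `^ q x)%:E =
    \int[mu]_(x in B) ((w x / lam) `^ q x)%:E)%E.
  pose f : lebesgueRn R n -> \bar R := fun x => ((w x / lam) `^ q x)%:E.
  have mf C : measurable_fun C f by apply: measurable_EFinT; exact: measurable_modular.
  have f0 C (x : lebesgueRn R n) : C x -> (0 <= f x)%E by rewrite lee_fin powR_ge0.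
  rewrite (ge0_negligible_integral mN mA (mf A) (@f0 A) N0).
  rewrite (ge0_negligible_integral mN mB (mf B) (@f0 B) N0).
  by congr integral; apply/seteqP; split => x [h Nx]; split => //; apply/(AB x Nx).
by apply/seteqP; split => _ [lam [l0 h] <-]; exists lam => //; split => //; rewrite ?E// -E.
Qed.

End VariableNorm.

(** * Exponents satisfying the log-Hoelder conditions *)

Section Exponent.
Context {R : realType} {n : nat}.
Local Notation V := 'rV[R]_n.
Local Notation mu := (@lebesgue R n).
Implicit Types (x y a b : V) (l h L c : R).

Lemma le_enorm_coord x (i : 'I_n) : `|x ord0 i| <= enorm x.
Proof.
rewrite /enorm -sqrtr_sqr ler_sqrt; last by apply: sumr_ge0 => j _; exact: sqr_ge0.
rewrite (bigD1 i)//= lerDl; apply: sumr_ge0 => j _; exact: sqr_ge0.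
Qed.

Lemma enorm_le x h : 0 <= h -> (forall i, `|x ord0 i| <= h) -> enorm x <= n%:R * h.
Proof.
move=> h0 xh; rewrite /enorm.
have nh : 0 <= n%:R * h by rewrite mulr_ge0.
rewrite -[leRHS]ger0_norm// -sqrtr_sqr ler_sqrt ?sqr_ge0//.
apply: (@le_trans _ _ (\sum_(i < n) h ^+ 2)).
  by apply: ler_sum => i _; rewrite -real_normK ?num_real// lerXn2r ?nnegrE.
rewrite sumr_const card_ord -[leLHS]mulr_natl exprMn ler_wpM2r ?sqr_ge0//.
by rewrite -natrX ler_nat; case: (n) => // m; rewrite expnS leq_pmulr// expn_gt0.
Qed.

Lemma hcube_coord_dist b h x y : hcube b h x -> hcube b h y ->
  forall i, `|(x - y) ord0 i| <= h.
Proof.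
move=> xb yb i; have /andP[x1 x2] := xb i; have /andP[y1 y2] := yb i.
by rewrite !mxE ler_norml; apply/andP; split; lra.
Qed.

Variables (p : V -> R) (pm p_inf C0 C_inf : R).
Hypothesis n0 : (0 < n)%N.
Hypothesis LH : LH_with p_inf C0 C_inf p.

Lemma le_side_of_hcube_sub a b l h : 0 < h -> 0 < l ->
  hcube b h `<=` hcube a l -> h <= l.
Proof.
move=> h0 l0 /le_lebesgue_outer; rewrite -!lebesgueE !lebesgue_hcube// lee_fin.
by rewrite ler_pXn2r ?nnegrE ?(ltW h0) ?(ltW l0).
Qed.

Let C0_gt0 : 0 < C0. Proof. by case: LH => _ [? _]. Qed.
Let p_inf_gt0 : 0 < p_inf. Proof. by case: LH. Qed.
Let C_inf_gt0 : 0 < C_inf. Proof. by case: LH. Qed.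

Lemma ln_eD_ge1 x : 1 <= ln (expR 1 + enorm x).
Proof.
rewrite -[leLHS](@expRK R) ler_ln ?posrE ?expR_gt0// ?lerDl ?sqrtr_ge0//.
by rewrite ltr_pwDl ?expR_gt0// sqrtr_ge0.
Qed.

Lemma exponent_dist_inf x : `|p x - p_inf| <= C_inf.
Proof.
case: LH => _ _ _ _ /(_ x) h; apply: (le_trans h).
by rewrite ler_pdivrMr ?(lt_le_trans _ (ln_eD_ge1 x))// ler_peMr ?ln_eD_ge1// ltW.
Qed.

Lemma exponent_le x : p x <= p_inf + C_inf.
Proof. have := exponent_dist_inf x; rewrite ler_norml; lra. Qed.

Lemma exponent_dist x y : `|p x - p y| <= 2 * C_inf.
Proof.
have := exponent_dist_inf x; have := exponent_dist_inf y.
by rewrite !ler_norml; lra.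
Qed.

(** Points of a cube of side h are at a distance of at most the square root of h
    when h is small, so that the logarithm of the distance controls half of
    ln h. *)
Lemma exponent_osc_local x y h : 0 < h -> (n%:R * h) ^+ 2 <= h -> n%:R * h < 2^-1 ->
  (forall i, `|(x - y) ord0 i| <= h) -> `|p x - p y| * - ln h <= 2 * C0.
Proof.
move=> h0 nh2 nh xyh.
case: LH => _ [_ /(_ x y) loc] _ _ _.
have exy := enorm_le (ltW h0) xyh.
have {}loc := loc (le_lt_trans exy nh).
have e0 : 0 <= enorm (x - y) by exact: sqrtr_ge0.
have lnh : ln h <= 0.
  apply: ln_le0; have n1 : 1 <= n%:R :> R by rewrite ler1n.
  nra.
have [e_eq0|e_neq0] := eqVneq (enorm (x - y)) 0.
  rewrite e_eq0 ln0// invr0 mulr0 oppr0 in loc.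
  have -> : `|p x - p y| = 0 by apply/eqP; rewrite eq_le loc normr_ge0.
  by rewrite mul0r mulr_ge0// ltW.
have {e0 e_neq0}e0 : 0 < enorm (x - y) by rewrite lt_neqAle eq_sym e_neq0.
have nh0 : 0 < n%:R * h by rewrite mulr_gt0 ?ltr0n.
have lne : 2 * ln (enorm (x - y)) <= ln h.
  have : 2 * ln (n%:R * h) <= ln h.
    by rewrite mulr_natl -lnXn// ler_ln ?posrE// exprn_gt0.
  have : ln (enorm (x - y)) <= ln (n%:R * h) by rewrite ler_ln ?posrE.
  lra.
have [lnh0|lnh0] := eqVneq (ln h) 0; first by rewrite lnh0 oppr0 mulr0 mulr_ge0// ltW.
have {lnh lnh0}lnh : ln h < 0 by rewrite lt_neqAle lnh0.
have le0 : ln (enorm (x - y)) < 0 by lra.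
rewrite -mulrN -invrN in loc.
apply: (@le_trans _ _ (C0 * (- ln (enorm (x - y)))^-1 * - ln h)).
  by rewrite ler_wpM2r// oppr_ge0 ltW.
rewrite -mulrA [2 * _]mulrC ler_wpM2l ?(ltW C0_gt0)//.
by rewrite ler_pdivrMl ?oppr_gt0//; lra.
Qed.

Definition osc_const : R := 2 * C0 + 2 * C_inf * ln (4 * n%:R ^+ 2) + 6 * C_inf.

Let n1 : 1 <= n%:R :> R. Proof. by rewrite ler1n. Qed.

Let n2 : 1 <= n%:R ^+ 2 :> R. Proof. by rewrite exprn_ege1. Qed.

Let ln4n : 0 <= ln (4 * n%:R ^+ 2 : R).
Proof. by apply: ln_ge0; have := n2; lra. Qed.

Lemma exponent_osc_small b h x y : 0 < h <= 2 -> hcube b h x -> hcube b h y ->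
  `|p x - p y| * `|ln h| <= 2 * C0 + 2 * C_inf * ln (4 * n%:R ^+ 2).
Proof.
move=> /andP[h0 h2] xb yb; have xyh := hcube_coord_dist xb yb.
have c4 : 0 < 4 * n%:R ^+ 2 :> R by have := n2; lra.
have [hs|hb] := leP h (4 * n%:R ^+ 2)^-1.
  have hs' : 4 * n%:R ^+ 2 * h <= 1 by rewrite -ler_pdivlMl// mulr1.
  have nn2 : n%:R <= n%:R ^+ 2 :> R by rewrite expr2 ler_peMr.
  have hn2 : h <= n%:R ^+ 2 * h by rewrite ler_peMl// ltW.
  have nhn2 : n%:R * h <= n%:R ^+ 2 * h by rewrite ler_wpM2r// ltW.
  rewrite [`|ln h|]ler0_norm; last by apply: ln_le0; lra.
  apply: le_trans (exponent_osc_local h0 _ _ xyh) _.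
  - rewrite exprMn expr2 mulrA -[leRHS]mul1r ler_wpM2r ?(ltW h0)//; lra.
  - lra.
  by rewrite lerDl mulr_ge0// mulr_ge0// ltW.
have ln_h : `|ln h| <= ln (4 * n%:R ^+ 2 : R).
  rewrite ler_norml -lnV ?posrE// !ler_ln ?posrE ?invr_gt0// (ltW hb)/=; have := n2; lra.
apply: (@le_trans _ _ (2 * C_inf * ln (4 * n%:R ^+ 2))).
  by apply: ler_pM => //; exact: exponent_dist.
by rewrite lerDr mulr_ge0// ltW.
Qed.

(** Far from the origin, at the scale L, the decay at infinity is of order 1 / ln L. *)
Lemma exponent_dist_far L c x : 1 <= L -> 1 <= c -> (exists i, L / c <= `|x ord0 i|) ->
  `|p x - p_inf| * ln L <= C_inf * (1 + c).
Proof.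
move=> L1 c1 [i xi].
case: LH => _ _ _ _ /(_ x) h.
have c0 : 0 < c by rewrite (lt_le_trans _ c1).
have L0 : 0 < L by rewrite (lt_le_trans _ L1).
have e1 : 1 <= expR 1 :> R by rewrite -[leLHS](@expR0 R) ler_expR.
have xe : L / c <= enorm x := le_trans xi (le_enorm_coord x i).
have A0 : 0 < expR 1 + enorm x by have := sqrtr_ge0 (\sum_(i < n) x ord0 i ^+ 2); rewrite -/(enorm x); lra.
have D1 := ln_eD_ge1 x.
have lnL : ln L <= (1 + c) * ln (expR 1 + enorm x).
  have -> : L = c * (L / c) by rewrite mulrC divfK// gt_eqF.
  rewrite lnM ?posrE ?divr_gt0//.
  have : ln c <= c by rewrite ltW// ln_sublinear.
  have : ln (L / c) <= ln (expR 1 + enorm x) by rewrite ler_ln ?posrE ?divr_gt0//; lra.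
  nra.
have D0 : 0 < ln (expR 1 + enorm x) by rewrite (lt_le_trans _ D1).
apply: (@le_trans _ _ (C_inf / ln (expR 1 + enorm x) * ((1 + c) * ln (expR 1 + enorm x)))).
  by apply: ler_pM => //; rewrite ln_ge0.
by rewrite le_eqVlt; apply/orP; left; apply/eqP; field; rewrite gt_eqF.
Qed.

(** The cubes on which p oscillates so little, at every scale, that a power of the
    side length may be raised to p(x) or to p(y) alike. *)
Definition tame a l := forall b h, 0 < h -> hcube b h `<=` hcube a l ->
  forall x y, hcube b h x -> hcube b h y -> `|p x - p y| * `|ln h| <= osc_const.

Lemma tame_sub a l b h : hcube b h `<=` hcube a l -> tame a l -> tame b h.
Proof. by move=> sub t b' h' h'0 sub'; apply: t => //; exact: subset_trans sub. Qed.

Lemma tame_small a l : 0 < l <= 2 -> tame a l.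
Proof.
move=> /andP[l0 l2] b h h0 sub x y xb yb.
have hl := le_side_of_hcube_sub h0 l0 sub.
apply: le_trans (exponent_osc_small _ xb yb) _; first by rewrite h0 (le_trans hl).
by rewrite lerDl mulr_ge0// ltW.
Qed.

(** Subcubes of side at most one obey the local condition; the others are within
    the region where the decay at infinity compensates the logarithm of their
    side. *)
Lemma tame_far a l : 1 <= l ->
  (forall x, hcube a l x -> exists i, l / 2 <= `|x ord0 i|) -> tame a l.
Proof.
move=> l1 far b h h0 sub x y xb yb.
have l0 : 0 < l by rewrite (lt_le_trans _ l1).
have hl := le_side_of_hcube_sub h0 l0 sub.
have [h1|h1] := leP h 1.
  apply: le_trans (exponent_osc_small _ xb yb) _; first by rewrite h0 (le_trans h1)// ler1n.
  by rewrite lerDl mulr_ge0// ltW.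
have lnhl : ln h <= ln l by rewrite ler_ln ?posrE.
have lnh0 : 0 <= ln h by rewrite ln_ge0// ltW.
rewrite (ger0_norm lnh0).
have fx := exponent_dist_far l1 (ler1n _ 2) (far _ (sub _ xb)).
have fy := exponent_dist_far l1 (ler1n _ 2) (far _ (sub _ yb)).
have tri : `|p x - p y| <= `|p x - p_inf| + `|p y - p_inf|.
  by rewrite (_ : p x - p y = (p x - p_inf) - (p y - p_inf)) ?ler_normB//; ring.
have : `|p x - p y| * ln h <= (`|p x - p_inf| + `|p y - p_inf|) * ln l.
  by apply: ler_pM.
have : 0 <= C_inf * ln (4 * n%:R ^+ 2) by rewrite mulr_ge0// ltW.
rewrite /osc_const; have := C0_gt0; nra.
Qed.

(** The local condition makes p continuous, so that a value below the essential
    infimum would be approached on a small cube. *)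
Lemma exponent_ge (mp : P0 (EFin \o p)) : exponent_inf (EFin \o p) = pm%:E ->
  forall x, pm <= p x.
Proof.
move=> infp x0; rewrite leNgt; apply/negP => px0.
pose d := pm - p x0; have d0 : 0 < d by rewrite subr_gt0.
pose h : R := Num.min (4^-1) (expR (- (C0 / d) - 1)) / n%:R.
have nh : n%:R * h = Num.min (4^-1) (expR (- (C0 / d) - 1)).
  by rewrite /h mulrC divfK// gt_eqF// (lt_le_trans _ n1).
have nh0 : 0 < n%:R * h by rewrite nh lt_min expR_gt0 andbT; lra.
have h0 : 0 < h by rewrite divr_gt0 ?ltr0n// lt_min expR_gt0 andbT; lra.
have lt_pm x : hcube x0 h x -> p x < pm.
  move=> xh.
  have x0h : hcube x0 h x0 by move=> i; rewrite lexx/= ltrDl.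
  have xyh := hcube_coord_dist xh x0h.
  have exy := enorm_le (ltW h0) xyh.
  case: LH => _ [_ /(_ x x0) loc] _ _ _.
  have {}loc := loc (le_lt_trans exy _).
  have {}loc : `|p x - p x0| <= - (C0 / ln (enorm (x - x0))).
    by apply: loc; rewrite nh gt_min; apply/orP; left; lra.
  have e0 : 0 <= enorm (x - x0) by exact: sqrtr_ge0.
  suff : `|p x - p x0| < d by rewrite ltr_norml /d; lra.
  have [e_eq0|e_neq0] := eqVneq (enorm (x - x0)) 0.
    by rewrite (le_lt_trans loc)// e_eq0 ln0// invr0 mulr0 oppr0.
  have {e0 e_neq0}e0 : 0 < enorm (x - x0) by rewrite lt_neqAle eq_sym e_neq0.
  have lnle : ln (enorm (x - x0)) <= - (C0 / d) - 1.
    rewrite -[leRHS]expRK ler_ln ?posrE ?expR_gt0// (le_trans exy)// nh.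
    by rewrite ge_min lexx orbT.
  have Cd : 0 < C0 / d by rewrite divr_gt0.
  apply: (le_lt_trans loc); rewrite -mulrN -invrN.
  rewrite ltr_pdivrMr; last by lra.
  have : C0 = d * (C0 / d) by rewrite mulrC divfK// gt_eqF.
  move: (C0 / d) lnle Cd => t; nra.
have : mu (hcube x0 h) = 0%E.
  have := @ess_inf_le _ _ _ mu (EFin \o p).
  rewrite -/(exponent_inf _) infp => -[N [mN N0 hN]].
  apply: (subset_measure0 (measurable_hcube _ _) mN _ N0) => x xh; apply: hN => /=.
  by rewrite lee_fin leNgt lt_pm.
rewrite lebesgue_hcube// => -[] /eqP; rewrite gt_eqF// exprn_gt0//.
Qed.

End Exponent.

(** * Powers of scales and logarithmic averages *)

Section Scales.
Context {R : realType}.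

Lemma powR_expR (h s : R) : 0 < h -> h `^ s = expR (s * ln h).
Proof. by move=> h0; rewrite /powR gt_eqF. Qed.

(** The power h ^ n is recovered from the normalization h ^ (n / s) by raising it
    to an exponent q close to s at the scale h. *)
Lemma powR_scale (n : nat) (h s q K s0 : R) : 0 < h -> 0 < s0 -> s0 <= s ->
  `|q - s| * `|ln h| <= K ->
  (expR (n%:R * K / s0))^-1 * h ^+ n <= (h `^ (n%:R / s)) `^ q <= expR (n%:R * K / s0) * h ^+ n.
Proof.
move=> h0 s00 s0s osc.
have s1 : 0 < s by rewrite (lt_le_trans s00).
have K0 : 0 <= K by apply: le_trans osc; rewrite mulr_ge0.
have -> : h ^+ n = expR (n%:R * ln h) by rewrite expRM_natl lnK// posrE.
rewrite -expRN -!expRD powR_expR ?powR_gt0// ln_powR !ler_expR.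
have -> : q * (n%:R / s * ln h) = n%:R * ln h + n%:R * (((q - s) * ln h) / s).
  by field; rewrite gt_eqF.
have : `|((q - s) * ln h) / s| <= K / s0.
  rewrite normrM normfV (gtr0_norm s1) ler_pM//.
  - by rewrite invr_ge0 ltW.
  - by rewrite normrM.
  - by rewrite lef_pV2.
rewrite ler_norml => /andP[lo hi].
have n0 : 0 <= n%:R :> R by [].
by apply/andP; split; rewrite -?mulrA; nra.
Qed.

End Scales.

Section LogAverage.
Context d (T : measurableType d) (R : realType) (mu : {measure set T -> \bar R}).

Lemma le_integral_ae (P : set T) (f g : T -> R) : measurable P ->
  measurable_fun setT f -> measurable_fun setT g ->
  (forall x, 0 <= f x) -> (forall x, 0 <= g x) ->
  {ae mu, forall x, P x -> f x <= g x} ->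
  (\int[mu]_(x in P) (f x)%:E <= \int[mu]_(x in P) (g x)%:E)%E.
Proof.
move=> mP mf mg f0 g0 [N [mN N0 hN]].
rewrite (ge0_negligible_integral mN mP (measurable_EFinT (A := P) mf) _ N0); last first.
  by move=> x _; rewrite lee_fin.
rewrite (ge0_negligible_integral mN mP (measurable_EFinT (A := P) mg) _ N0); last first.
  by move=> x _; rewrite lee_fin.
apply: (le_integral_on mu (measurableD mP mN) mf mg) => x [Px Nx].
rewrite f0/=; apply: contrapT => nfg; apply: Nx; apply: hN => /= fg.
exact/nfg/fg.
Qed.

Lemma integralD_on (P : set T) (f g : T -> R) : measurable P ->
  measurable_fun setT f -> measurable_fun setT g ->
  (forall x, 0 <= f x) -> (forall x, 0 <= g x) ->
  (\int[mu]_(x in P) (f x + g x)%:E =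
   \int[mu]_(x in P) (f x)%:E + \int[mu]_(x in P) (g x)%:E)%E.
Proof.
move=> mP mf mg f0 g0; under eq_integral do rewrite EFinD.
rewrite ge0_integralD//; first by move=> x _; rewrite lee_fin.
- exact: measurable_EFinT.
- by move=> x _; rewrite lee_fin.
- exact: measurable_EFinT.
Qed.

(** A bound of the positive part of ln (w * c) and of the mean of - ln w controls the
    negative part of ln (w * c), and Chebyshev's inequality turns this into a bound
    of the set where w is small. The integral of ln w^-1 is shown to be finite on
    the way, from the bound of this positive part. *)
Lemma log_chebyshev (P : set T) (v c B : R) (w : T -> R) :
  measurable P -> mu P = v%:E -> measurable_fun setT w -> (forall x, 0 <= w x) ->
  {ae mu, forall x, 0 < w x} -> 0 < c ->
  (\int[mu]_(x in P) (ln (w x)^-1)%:E < +oo)%E ->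
  (\int[mu]_(x in P) (Num.max 0 (ln (w x * c)))%:E <= B%:E)%E ->
  exists2 F, (\int[mu]_(x in P) (ln (w x)^-1)%:E = F%:E)%E & forall t, 0 <= t ->
  (t%:E * mu (P `&` [set x | (w x <= expR (- t) / c)%R]) <= (B + F - v * ln c)%:E)%E.
Proof.
move=> mP muP mw w0 aew c0 intw intB.
have v0 : 0 <= v by rewrite -lee_fin -muP measure_ge0.
pose g x := ln (w x)^-1.
pose gp x := Num.max (g x) 0; pose gn x := Num.max (- g x) 0.
have mlnw : measurable_fun setT (fun x => ln (w x)) by exact: measurableT_comp.
have gE x : g x = - ln (w x).
  rewrite /g; have [w1|w1] := ltP 0 (w x); first by rewrite lnV.
  have -> : w x = 0 by apply/eqP; rewrite eq_le w1 w0.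
  by rewrite invr0 ln0// oppr0.
have mg : measurable_fun setT g.
  rewrite (_ : g = (fun x => - ln (w x))); first exact: measurableT_comp.
  by apply/funext => x; exact: gE.
have mgp : measurable_fun setT gp by apply: measurable_maxr => //.
have mgn : measurable_fun setT gn by apply: measurable_maxr => //; exact: measurableT_comp.
have gp0 x : 0 <= gp x by rewrite le_max lexx orbT.
have gn0 x : 0 <= gn x by rewrite le_max lexx orbT.
pose h x := Num.max 0 (ln (w x * c)).
have mh : measurable_fun setT h.
  apply: measurable_maxr => //; apply: measurableT_comp => //.
  by apply: measurable_funM.
have h0 x : 0 <= h x by rewrite le_max lexx.
have hE x : 0 < w x -> ln (w x * c) = ln c - g x.
  by move=> wx; rewrite lnM ?posrE// gE opprK addrC.
pose cp := Num.max (ln c) 0; pose cn := Num.max (- ln c) 0.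
have cp0 : 0 <= cp by rewrite le_max lexx orbT.
have cn0 : 0 <= cn by rewrite le_max lexx orbT.
have cE : ln c = cp - cn.
  by rewrite /cp /cn; case: (leP (ln c) 0) => lc; [rewrite max_l ?oppr_ge0//|rewrite max_r ?oppr_le0 1?ltW//]; lra.
have FE : (\int[mu]_(x in P) (g x)%:E = \int[mu]_(x in P) (gp x)%:E - \int[mu]_(x in P) (gn x)%:E)%E.
  by rewrite integralE; congr (_ - _)%E; apply: eq_integral => x _; rewrite ?funeposE ?funenegE/= -?EFinN EFin_max.
have intcst k : 0 <= k -> (\int[mu]_(x in P) k%:E = (k * v)%:E)%E.
  by move=> k0; rewrite integral_cst// muP.
have gn_fin : (\int[mu]_(x in P) (gn x)%:E <= (B + cn * v)%:E)%E.
  apply: (@le_trans _ _ (\int[mu]_(x in P) (h x + cn)%:E)%E).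
    apply: le_integral_ae => //; first exact: measurable_funD.
      by move=> x; rewrite addr_ge0.
    apply: filterS aew => x wx _; rewrite ge_max addr_ge0// andbT.
    rewrite /h hE// cE maxEle; case: ifP; lra.
  by rewrite integralD_on// intcst// EFinD leeD2r.
have [gnf gpf] : (\int[mu]_(x in P) (gn x)%:E \is a fin_num)%E /\
    (\int[mu]_(x in P) (gp x)%:E \is a fin_num)%E.
  have gnf : (\int[mu]_(x in P) (gn x)%:E \is a fin_num)%E.
    rewrite ge0_fin_numE; first by rewrite (le_lt_trans gn_fin)// ltry.
    by apply: integral_ge0 => x _; rewrite lee_fin.
  split => //; rewrite ge0_fin_numE; last by apply: integral_ge0 => x _; rewrite lee_fin.
  move: intw; rewrite FE -(fineK gnf).
  by case: (\int[mu]_(x in P) (gp x)%:E)%E => [r _|//|//]; exact: ltry.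
exists (fine (\int[mu]_(x in P) (gp x)%:E) - fine (\int[mu]_(x in P) (gn x)%:E)).
  by rewrite EFinB !fineK.
move=> t t0; set E := [set x | _].
have mE : measurable E by exact: measurable_sublevel.
have m1 : measurable_fun setT (\1_E : T -> R) by exact: measurable_indic.
have ind0 x : 0 <= \1_E x :> R by rewrite indicE.
have mt1 : measurable_fun setT (fun x => t * \1_E x).
  by apply: measurable_funM m1; exact: measurable_cst.
have mcst k : measurable_fun setT (fun _ : T => k : R) by exact: measurable_cst.
have mnc : measurable_fun setT (fun x => gn x + cp) by exact: measurable_funD.
have mpc : measurable_fun setT (fun x => gp x + cn) by exact: measurable_funD.
have t10 x : 0 <= t * \1_E x by rewrite mulr_ge0.
have nc0 x : 0 <= gn x + cp by rewrite addr_ge0.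
have pc0 x : 0 <= gp x + cn by rewrite addr_ge0.
have : (\int[mu]_(x in P) ((t * \1_E x) + (gn x + cp))%:E <=
        \int[mu]_(x in P) (h x + (gp x + cn))%:E)%E.
  apply: le_integral_ae => //.
  - exact: measurable_funD.
  - exact: measurable_funD.
  - by move=> x; rewrite addr_ge0.
  - by move=> x; rewrite addr_ge0.
  apply: filterS aew => x wx _.
  have gg : g x = gp x - gn x.
    by rewrite /gp /gn; case: (leP (g x) 0) => lc; [rewrite max_l ?oppr_ge0//|rewrite max_r ?oppr_le0 1?ltW//]; lra.
  have hh := hE x wx; rewrite /h hh.
  have := h0 x; rewrite /h hh indicE; case: (boolP (x \in E)) => xE.
    have : ln c - g x <= - t.
      rewrite -hh -[leRHS]expRK ler_ln ?posrE ?mulr_gt0 ?expR_gt0//.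
      by rewrite -ler_pdivlMr//; move: xE; rewrite inE.
    by rewrite gg cE mulr1; rewrite maxEle; case: ifP; lra.
  by rewrite gg cE mulr0 maxEle; case: ifP; lra.
rewrite (integralD_on mP mt1 mnc t10 nc0) (integralD_on mP mh mpc h0 pc0).
rewrite (integralD_on mP mgn (mcst _) gn0) // (integralD_on mP mgp (mcst _) gp0) //.
rewrite !intcst// integralZ_on// integral_indic// setIC.
move: intB; rewrite -/(h _).
move: gnf gpf; set X := (\int[mu]_(x in P) (gn x)%:E)%E; set Y := (\int[mu]_(x in P) (gp x)%:E)%E.
have : (0 <= \int[mu]_(x in P) (h x)%:E)%E by apply: integral_ge0 => x _; rewrite lee_fin.
set Z := (\int[mu]_(x in P) (h x)%:E)%E => Z0 Xf Yf ZB.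
have Zf : Z \is a fin_num by rewrite ge0_fin_numE// (le_lt_trans ZB)// ltry.
set U := (t%:E * _)%E => main.
have U0 : (0 <= U)%E by rewrite mule_ge0// lee_fin.
have X0 : (0 <= X)%E by apply: integral_ge0 => x _; rewrite lee_fin.
have Uf : U \is a fin_num.
  rewrite ge0_fin_numE//; apply: (@le_lt_trans _ _ (U + (X + (cp * v)%:E)))%E.
    by rewrite leeDl// adde_ge0// lee_fin mulr_ge0.
  by apply: (le_lt_trans main); rewrite -(fineK Yf) -(fineK Zf) -!EFinD ltry.
move: main ZB; rewrite -(fineK Xf) -(fineK Yf) -(fineK Zf).
rewrite -(fineK Uf) -!EFinD !lee_fin/= cE; lra.
Qed.

End LogAverage.

(** * Norms, modulars and sets where the weight is small *)

Section NormModular.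
Context {R : realType} {n : nat}.
Local Notation V := 'rV[R]_n.
Local Notation mu := (@lebesgue R n).
Variables (q : V -> R) (qm qp : R).
Hypothesis qm0 : 0 < qm.
Hypothesis q_ge : forall x, qm <= q x.
Hypothesis q_le : forall x, q x <= qp.
Hypothesis mq : measurable_fun [set: lebesgueRn R n] q.
Variable w : V -> R.
Hypothesis w0 : forall x, 0 <= w x.
Hypothesis mw : measurable_fun [set: lebesgueRn R n] w.
Implicit Types (A : set (lebesgueRn R n)).

Let q0 x : 0 < q x. Proof. exact: lt_le_trans (q_ge x). Qed.

Lemma norm_on_gt0 A : measurable A -> (0 < mu A)%E ->
  {ae mu, forall x, 0 < w x} -> (0 < norm_on q A w)%E.
Proof.
move=> mA muA aew; rewrite lt_neqAle norm_on_ge0// andbT eq_sym; apply/eqP => norm0.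
pose I := (\int[mu]_(x in A) ((w x / 1) `^ q x)%:E)%E.
have m1 lam := measurable_modular mq mw lam.
have I0 : (0 <= I)%E by apply: integral_ge0 => x _; rewrite lee_fin powR_ge0.
have Ile lam : 0 < lam <= 1 -> (I <= (lam `^ qm)%:E)%E.
  move=> /andP[l0 l1].
  have h : (\int[mu]_(x in A) ((w x / lam) `^ q x)%:E <= 1)%E.
    by apply: norm_on_modular_le1 => //; rewrite norm0 lte_fin.
  have lq : 0 < lam `^ qm by rewrite powR_gt0.
  have lqV : 0 <= (lam `^ qm)^-1 by rewrite invr_ge0 ltW.
  have f0 x : A x -> 0 <= (w x / 1) `^ q x by move=> _; exact: powR_ge0.
  rewrite -[leRHS]mule1 -lee_pdivrMl// -(integralZ_on mu mA (m1 1) lqV f0).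
  apply: le_trans h; apply: (le_integral_on mu mA _ (m1 lam)).
    by apply: measurable_funM (m1 1); exact: measurable_cst.
  move=> x _; rewrite mulr_ge0 ?invr_ge0 ?powR_ge0//= divr1.
  rewrite powRM// ?invr_ge0 ?(ltW l0)// mulrC ler_wpM2l ?powR_ge0//.
  rewrite -[lam^-1]powR_inv1 ?(ltW l0)// -powRrM mulN1r powRN.
  by rewrite lef_pV2 ?posrE ?powR_gt0// ger_powR ?l0.
have I_eq0 : I = 0%E.
  apply/eqP; rewrite eq_le I0 andbT; apply/lee_addgt0Pr => e e0; rewrite add0e.
  pose lam := Num.min 1 (e `^ qm^-1).
  have l0 : 0 < lam by rewrite lt_min ltr01 powR_gt0.
  apply: (le_trans (Ile lam _)); first by rewrite l0 ge_min lexx.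
  rewrite lee_fin (_ : e = (e `^ qm^-1) `^ qm); last first.
    by rewrite -powRrM mulVf ?gt_eqF// powRr1// ltW.
  by rewrite ge0_ler_powR ?nnegrE ?(ltW qm0) ?(ltW l0) ?powR_ge0// ge_min lexx orbT.
have [N1 [mN1 N10 hN1]] : ae_eq mu A (fun x => ((w x / 1) `^ q x)%:E) (cst 0%E).
  apply/(ae_eq_integral_abs mu mA (measurable_EFinT (m1 1))).
  rewrite -[RHS]I_eq0; apply: eq_integral => x _.
  by rewrite /= ger0_norm ?powR_ge0.
have [N2 [mN2 N20 hN2]] := aew.
have : mu A = 0%E.
  apply: (subset_measure0 mA (measurableU _ _ mN1 mN2) _ (eq_trans (measureU0 mN1 mN2 N20) N10)).
  move=> x Ax; have [wx|wx] := pselect (0 < w x); last by right; exact: hN2.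
  left; apply: hN1 => /= /(_ Ax) -[] /eqP; rewrite divr1 gt_eqF//.
  by rewrite powR_gt0.
by move=> E0; rewrite E0 ltxx in muA.
Qed.

(** The modular at the norm is reached from the modular at twice the norm, where it is
    at most 1 whether or not the infimum is attained; hence the constant 2 ^ qp. *)
Lemma norm_on_modular_le A N : measurable A -> 0 < N -> norm_on q A w = N%:E ->
  (\int[mu]_(x in A) ((w x / N) `^ q x)%:E <= (2 `^ qp)%:E)%E.
Proof.
move=> mA N0 normN; have m1 lam := measurable_modular mq mw lam.
have h : (\int[mu]_(x in A) ((w x / (2 * N)) `^ q x)%:E <= 1)%E.
  by apply: norm_on_modular_le1 => //; rewrite normN lte_fin ltr_pMl// ltr1n.
rewrite -[leRHS]mule1; apply: le_trans (lee_wpmul2l _ h); last by rewrite lee_fin powR_ge0.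
have f0 x : A x -> 0 <= (w x / (2 * N)) `^ q x by move=> _; exact: powR_ge0.
rewrite -(integralZ_on mu mA (m1 _) (powR_ge0 _ _) f0).
apply: (le_integral_on mu mA (m1 N)).
  by apply: measurable_funM (m1 _); exact: measurable_cst.
move=> x _; rewrite powR_ge0/=.
rewrite (_ : w x / N = 2 * (w x / (2 * N))); last by field; rewrite gt_eqF.
by rewrite powRM ?divr_ge0 ?mulr_ge0 ?(ltW N0)// ler_wpM2r ?powR_ge0// ler_powR ?ler1n.
Qed.

End NormModular.

Section HalfSet.
Context {R : realType} {n : nat}.
Local Notation V := 'rV[R]_n.
Local Notation mu := (@lebesgue R n).
Variables (p : V -> R) (pm pp : R).
Hypothesis pm0 : 0 < pm.
Hypothesis p_ge : forall x, pm <= p x.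
Hypothesis p_le : forall x, p x <= pp.
Hypothesis mp : measurable_fun [set: lebesgueRn R n] p.
Variables (w : V -> R) (W : R).
Hypothesis wP : is_weight w.
Hypothesis AW : (Ainfty_const p w <= W%:E)%E.

Let w0 x : 0 <= w x. Proof. by case: wP. Qed.
Let mw : measurable_fun [set: lebesgueRn R n] w. Proof. by case: wP. Qed.
Let aew : {ae mu, forall x, 0 < w x}. Proof. by case: wP. Qed.

Lemma is_cube_hcube (a : V) (l : R) : 0 < l -> is_cube (hcube a l).
Proof.
by move=> l0; exists a, l, (fun=> true), (fun=> true); split => //; exact: hcubeE.
Qed.

(** The A_infty condition enters here, and only here: on a cube with norm N of w and
    norm of 1 of order m, it bounds the mean of the logarithm of w * (m / N) below,
    while the modular bounds its positive part. *)
Lemma half_set (b : V) (h m g B : R) : 0 < h -> 0 < m -> 0 < g ->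
  (norm_on p (hcube b h) (fun=> 1%R) <= (g * m)%:E)%E ->
  (forall N, 0 < N -> norm_on p (hcube b h) w = N%:E ->
    (\int[mu]_(x in hcube b h) (Num.max 0 (ln (w x * (m / N))))%:E <= (B * h ^+ n)%:E)%E) ->
  exists N, [/\ 0 < N, norm_on p (hcube b h) w = N%:E, 0 < W, 0 <= B + ln (g * W) &
    forall t, 0 <= t ->
      (t%:E * mu (hcube b h `&` [set x : V | (w x <= expR (- t) / (m / N))%R]) <=
       ((B + ln (g * W)) * h ^+ n)%:E)%E].
Proof.
move=> h0 m0 g0 norm1 logB; set P := hcube b h.
have mP : measurable P := measurable_hcube b h.
have muP : mu P = (h ^+ n)%:E by exact: lebesgue_hcube.
have hn0 : 0 < h ^+ n by rewrite exprn_gt0.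
have muP0 : (0 < mu P)%E by rewrite muP lte_fin.
have normw0 := norm_on_gt0 pm0 p_ge mp w0 mw mP muP0 aew.
have norm10 : (0 < norm_on p P (fun=> 1%R))%E.
  by apply: (norm_on_gt0 pm0 p_ge mp) => //; exact: aeW.
have : (mule_oo (cube_norm_ratio p w P)
    (expeR (average P (fun y => (ln (w y)^-1)%:E))) <= W%:E)%E.
  apply: le_trans AW; apply: ereal_sup_ubound; exists P => //.
  exact: is_cube_hcube.
rewrite /cube_norm_ratio indic_norm_on -/(norm_on p P w).
have [M M0 ME] : exists2 M, 0 < M & norm_on p P (fun=> 1%R) = M%:E.
  move: norm10 norm1; case: (norm_on p P (fun=> 1%R)) => // M M0 _.
  by exists M.
have Mg : M <= g * m by rewrite -lee_fin -ME.
rewrite {1}/mule_oo; case: ifPn => [_|]; first by rewrite leye_eq.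
rewrite negb_or => /andP[u1 u2].
move: u1; rewrite {1}/mule_oo; case: ifPn => [//|].
rewrite negb_or => /andP[_ u3] _.
have [N N0 NE] : exists2 N, 0 < N & norm_on p P w = N%:E.
  move: normw0 u3; case: (norm_on p P w) => // N N0 _.
  by exists N.
rewrite {1}/mule_oo NE ME inver (gt_eqF M0)/= -EFinM => prodW.
have intw : (\int[mu]_(x in P) (ln (w x)^-1)%:E < +oo)%E.
  move: u2; rewrite /average muP inver (gt_eqF hn0).
  case: (\int[mu]_(x in P) _)%E => [r _|/negP[]|_ //]; first exact: ltry.
  by rewrite gt0_muley// lte_fin invr_gt0.
have [F FE cheb] := log_chebyshev mP muP mw w0 aew (divr_gt0 m0 N0) intw (logB N N0 NE).
have avgE : average P (fun y => (ln (w y)^-1)%:E) = ((h ^+ n)^-1 * F)%:E.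
  by rewrite /average muP inver (gt_eqF hn0) FE.
move: prodW; rewrite avgE /= -EFinM lee_fin => prodW.
have MN0 : 0 < M^-1 * N by rewrite mulr_gt0 ?invr_gt0.
have W0 : 0 < W by rewrite (lt_le_trans _ prodW)// mulr_gt0// expR_gt0.
have lnW : ln N - ln M + (h ^+ n)^-1 * F <= ln W.
  rewrite -[X in X + _]ln_div ?posrE// -{1}(expRK ((h ^+ n)^-1 * F)) -lnM ?posrE ?divr_gt0 ?expR_gt0//.
  rewrite [M^-1 * N]mulrC in prodW MN0.
  have E0 : 0 < N / M * expR ((h ^+ n)^-1 * F) by rewrite pmulr_lgt0// expR_gt0.
  by rewrite ler_ln ?posrE.
have lnM_le : ln M <= ln g + ln m by rewrite -lnM ?posrE// ler_ln ?posrE ?mulr_gt0.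
have FW : F <= h ^+ n * (ln W - ln N + ln g + ln m).
  rewrite -ler_pdivrMl//; lra.
have fin t : 0 <= t ->
      (t%:E * mu (P `&` [set x : V | (w x <= expR (- t) / (m / N))%R]) <=
       ((B + ln (g * W)) * h ^+ n)%:E)%E.
  move=> t0; apply: (le_trans (cheb t t0)); rewrite lee_fin ln_div ?posrE// lnM ?posrE//.
  nra.
exists N; split => //.
have : (0 <= ((B + ln (g * W)) * h ^+ n)%:E)%E.
  by apply: le_trans (fin 0 (lexx 0)); rewrite mul0e.
by rewrite lee_fin pmulr_lge0.
Qed.

End HalfSet.

(** * Tame cubes *)

Section TameCubes.
Context {R : realType} {n : nat}.
Local Notation V := 'rV[R]_n.
Local Notation mu := (@lebesgue R n).
Variables (p : V -> R) (pm p_inf C0 C_inf : R).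
Hypothesis n0 : (0 < n)%N.
Hypothesis LH : LH_with p_inf C0 C_inf p.
Hypothesis pm0 : 0 < pm.
Hypothesis p_ge : forall x, pm <= p x.
Implicit Types (a b x : V) (l h L t N : R).

Local Notation pp := (p_inf + C_inf).
Local Notation tame := (@tame R n p C0 C_inf).

Let p_le x : p x <= pp. Proof. exact: exponent_le LH x. Qed.
Let mp : measurable_fun [set: lebesgueRn R n] p. Proof. by case: LH. Qed.
Let p0 x : 0 < p x. Proof. exact: lt_le_trans (p_ge x). Qed.
Let pp0 : 0 < pp. Proof. exact: lt_le_trans (p0 0) (p_le 0). Qed.
Let C0_gt0 : 0 < C0. Proof. by case: LH => _ [? _]. Qed.
Let p_inf_gt0 : 0 < p_inf. Proof. by case: LH. Qed.
Let C_inf_gt0 : 0 < C_inf. Proof. by case: LH. Qed.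

(** It bounds the factor by which h ^ n and powers of the normalizations of norms
    differ, on tame cubes and, with 17 = 1 + 16, far from the origin. *)
Definition scale_const : R :=
  expR (n%:R * (@osc_const R n C0 C_inf + 17 * C_inf) / Num.min pm p_inf).

Local Notation G := scale_const.

Let osc0 : 0 <= @osc_const R n C0 C_inf.
Proof.
have ln4 : 0 <= ln (4 * n%:R ^+ 2 : R).
  have : 1 <= n%:R ^+ 2 :> R by rewrite exprn_ege1// ler1n.
  by move=> ?; apply: ln_ge0; lra.
by rewrite /osc_const !addr_ge0 ?mulr_ge0 ?(ltW C0_gt0) ?(ltW C_inf_gt0).
Qed.

Let minp0 : 0 < Num.min pm p_inf. Proof. by rewrite lt_min pm0. Qed.

Lemma scale_const_ge1 : 1 <= G.
Proof.
rewrite /scale_const -[leLHS](@expR0 R) ler_expR divr_ge0 ?(ltW minp0)// mulr_ge0//.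
by rewrite addr_ge0// mulr_ge0// ltW.
Qed.

Let G1 := scale_const_ge1.
Let G0 : 0 < G. Proof. exact: lt_le_trans G1. Qed.

Lemma tame_scale a l b h x : tame a l -> 0 < h -> hcube b h `<=` hcube a l ->
  hcube b h x -> G^-1 * h ^+ n <= (h `^ (n%:R / p b)) `^ p x <= G * h ^+ n.
Proof.
move=> tm h0 sub xb; apply: powR_scale => //; first by rewrite ge_min p_ge.
have bb : hcube b h b by move=> i; rewrite lexx ltrDl.
by apply: le_trans (tm _ _ h0 sub _ _ xb bb) _; rewrite lerDl mulr_ge0// ltW.
Qed.

Lemma far_scale L x : 1 <= L -> (exists i, L / 16 <= `|x ord0 i|) ->
  G^-1 * L ^+ n <= (L `^ (n%:R / p_inf)) `^ p x <= G * L ^+ n.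
Proof.
move=> L1 far; apply: powR_scale => //.
- exact: lt_le_trans L1.
- by rewrite ge_min lexx orbT.
rewrite (ger0_norm (ln_ge0 L1)).
apply: le_trans (exponent_dist_far LH L1 _ far) _; first by rewrite ler1n.
rewrite (_ : 1 + 16 = 17); last by ring.
by rewrite mulrC lerDr.
Qed.

(** The norm of the indicator of a tame cube of corner b and side h, up to a
    bounded factor. *)
Definition tame_norm b h : R := h `^ (n%:R / p b).

Lemma tame_norm_gt0 b h : 0 < h -> 0 < tame_norm b h.
Proof. exact: powR_gt0. Qed.

Lemma one_modular_le (P : set (lebesgueRn R n)) (q : V -> R) (qm v c m g : R) :
  measurable P -> mu P = v%:E -> 0 < v -> 0 < m -> 1 <= g -> 0 < qm -> 1 <= c ->
  (forall x, P x -> qm <= q x) -> measurable_fun [set: lebesgueRn R n] q ->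
  c <= g `^ qm -> (forall x, P x -> c^-1 * v <= m `^ q x) ->
  (\int[mu]_(x in P) ((1 / (g * m)) `^ q x)%:E <= 1)%E.
Proof.
move=> mP muP v0 m0 g1 qm0 c1 qge mq gc ms.
have g0 : 0 < g by rewrite (lt_le_trans _ g1).
have c0 : 0 < c by rewrite (lt_le_trans _ c1).
apply: (@le_trans _ _ (v^-1%:E * mu P)%E); last by rewrite muP -EFinM mulVf// gt_eqF.
have mone : measurable_fun [set: lebesgueRn R n] (fun x => (1 / (g * m)) `^ q x).
  by apply: measurable_powR_fun mq; exact: measurable_cst.
apply: (integral_le_cst mu mP mone) => x Px.
rewrite powR_ge0/= div1r.
rewrite -powR_inv1 ?mulr_ge0 ?(ltW g0) ?(ltW m0)// -powRrM mulN1r powRN.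
rewrite lef_pV2 ?posrE ?powR_gt0 ?mulr_gt0// powRM ?(ltW g0) ?(ltW m0)//.
have cv : c * (c^-1 * v) = v by rewrite mulrA mulfV ?mul1r// gt_eqF.
rewrite -[leLHS]cv; apply: ler_pM; rewrite ?(ltW c0) ?mulr_ge0 ?invr_ge0 ?(ltW c0) ?(ltW v0) ?ms//.
by apply: le_trans gc _; rewrite ler_powR ?qge.
Qed.

Lemma norm_on_tame_le a l : 0 < l -> tame a l ->
  (norm_on p (hcube a l) (fun=> 1%R) <= (G `^ pm^-1 * tame_norm a l)%:E)%E.
Proof.
move=> l0 tm.
have g1 : 1 <= G `^ pm^-1.
  by rewrite -[leLHS](powRr0 G) ler_powR ?scale_const_ge1// invr_ge0 ltW.
have g0 : 0 < G `^ pm^-1 by rewrite powR_gt0.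
apply: norm_on_le => //; first by rewrite mulr_gt0// tame_norm_gt0.
apply: (@one_modular_le _ p pm (l ^+ n) G _ _ (measurable_hcube a l)) => //.
- exact: lebesgue_hcube.
- by rewrite exprn_gt0.
- exact: tame_norm_gt0.
- by rewrite -powRrM mulVf ?gt_eqF// powRr1// ltW.
- by move=> x xa; have /andP[] := tame_scale tm l0 (@subset_refl _ _) xa.
Qed.

Lemma max_ln_le (y s : R) : 0 <= y -> pm <= s -> Num.max 0 (ln y) <= pm^-1 * y `^ s.
Proof.
move=> y0 ps; have s0 : 0 < s by rewrite (lt_le_trans pm0).
rewrite ge_max mulr_ge0 ?invr_ge0 ?(ltW pm0) ?powR_ge0//=.
have [->|yn0] := eqVneq y 0; first by rewrite ln0// mulr_ge0 ?invr_ge0 ?(ltW pm0) ?powR_ge0.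
have {}y0 : 0 < y by rewrite lt_neqAle eq_sym yn0.
have ys0 : 0 < y `^ s by rewrite powR_gt0.
have : s * ln y <= y `^ s by rewrite -ln_powR ltW// ln_sublinear.
rewrite ler_pdivlMl// => h.
have [ln0|ln0] := leP (ln y) 0; last by nra.
by apply: (@le_trans _ _ 0); [rewrite pmulr_rle0|exact: ltW].
Qed.

Variables (w : V -> R) (W : R).
Hypothesis wP : is_weight w.
Hypothesis AW : (Ainfty_const p w <= W%:E)%E.

Let w0 x : 0 <= w x. Proof. by case: wP. Qed.
Let mw : measurable_fun [set: lebesgueRn R n] w. Proof. by case: wP. Qed.

Lemma measurable_wpow c q : measurable_fun [set: lebesgueRn R n] q ->
  measurable_fun [set: lebesgueRn R n] (fun x => (w x * c) `^ q x).
Proof.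
move=> mq; apply: measurable_powR_fun mq.
by apply: measurable_funM mw _; exact: measurable_cst.
Qed.

Lemma tame_modular a l N : 0 < l -> tame a l -> 0 < N ->
  norm_on p (hcube a l) w = N%:E ->
  (\int[mu]_(x in hcube a l) ((w x * (tame_norm a l / N)) `^ p x)%:E <=
     (2 `^ pp * G * l ^+ n)%:E)%E.
Proof.
move=> l0 tm N0 NE.
have mod := norm_on_modular_le pm0 p_ge p_le mp w0 mw (measurable_hcube a l) N0 NE.
have Gl : 0 <= G * l ^+ n by rewrite mulr_ge0 ?exprn_ge0 ?ltW.
have f0 x : hcube a l x -> 0 <= (w x / N) `^ p x by move=> _; exact: powR_ge0.
rewrite (_ : 2 `^ pp * G * l ^+ n = G * l ^+ n * 2 `^ pp); last by ring.
rewrite EFinM; apply: le_trans (lee_wpmul2l _ mod); last by rewrite lee_fin.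
rewrite -(integralZ_on mu (measurable_hcube a l) (measurable_wpow N^-1 mp) Gl f0).
apply: (le_integral_on mu (measurable_hcube a l) (measurable_wpow _ mp)).
  by apply: measurable_funM (measurable_wpow _ mp); exact: measurable_cst.
move=> x xa; rewrite powR_ge0/=.
rewrite (_ : w x * (tame_norm a l / N) = tame_norm a l * (w x / N)); last by ring.
rewrite powRM ?divr_ge0 ?(ltW N0) ?(ltW (tame_norm_gt0 _ l0))// ler_wpM2r ?powR_ge0//.
by have /andP[] := tame_scale tm l0 (@subset_refl _ _) xa.
Qed.

Lemma tame_half a l : 0 < l -> tame a l ->
  exists N, [/\ 0 < N, norm_on p (hcube a l) w = N%:E, 0 < W,
    0 <= pm^-1 * (2 `^ pp * G) + ln (G `^ pm^-1 * W) &
    forall t, 0 <= t ->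
      (t%:E * mu (hcube a l `&` [set x : V | (w x <= expR (- t) / (tame_norm a l / N))%R]) <=
       ((pm^-1 * (2 `^ pp * G) + ln (G `^ pm^-1 * W)) * l ^+ n)%:E)%E].
Proof.
move=> l0 tm; apply: (half_set pm0 p_ge mp wP AW l0 (tame_norm_gt0 a l0)).
- by rewrite powR_gt0.
- exact: norm_on_tame_le.
move=> N N0 NE; have mod := tame_modular l0 tm N0 NE.
have pmV : 0 <= pm^-1 by rewrite invr_ge0 ltW.
have f0 x : hcube a l x -> 0 <= (w x * (tame_norm a l / N)) `^ p x by move=> _; exact: powR_ge0.
rewrite -[pm^-1 * _ * _]mulrA EFinM; apply: le_trans (lee_wpmul2l _ mod); last by rewrite lee_fin.
rewrite -(integralZ_on mu (measurable_hcube a l) (measurable_wpow _ mp) pmV f0).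
apply: (le_integral_on mu (measurable_hcube a l)).
- apply: measurable_maxr; first exact: measurable_cst.
  apply: measurableT_comp; first exact: measurable_ln.
  by apply: measurable_funM mw _; exact: measurable_cst.
- by apply: measurable_funM (measurable_wpow _ mp); exact: measurable_cst.
move=> x xa; rewrite le_max lexx/= max_ln_le//.
by rewrite mulr_ge0// divr_ge0 ?(ltW N0) ?(ltW (tame_norm_gt0 _ l0)).
Qed.

(** * The reverse Hoelder inequality on tame cubes *)

Variable H : R.
Hypothesis H0 : 0 < H.
Hypothesis HW : 1 + (pm^-1 * (2 `^ pp * G) + ln (G `^ pm^-1 * W)) <= ln H.

(** H is so large that its logarithm absorbs the constants of the logarithmic
    estimates; the smallness is then polynomial in H. *)
Lemma small_set_of_log (P : set (lebesgueRn R n)) (S c v k : R) : 0 < k -> 0 <= v -> 1 + S <= ln H -> 0 <= S ->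
  (forall t, 0 <= t ->
    (t%:E * mu (P `&` [set x : V | (w x <= expR (- t) / c)%R]) <= (S * v)%:E)%E) ->
  (mu (P `&` [set x : V | (w x <= H `^ (- k) / c)%R]) <= (k^-1 * v)%:E)%E.
Proof.
move=> k0 v0 SH S0 cheb.
have lnH : 0 < ln H by lra.
have t0 : 0 < k * ln H by rewrite mulr_gt0.
have := cheb _ (ltW t0); rewrite -mulNr -powR_expR// => h.
rewrite -(@lee_pmul2l _ (k * ln H)%:E)//; apply: (le_trans h).
rewrite -EFinM lee_fin (_ : k * ln H * (k^-1 * v) = ln H * v); last by field; rewrite gt_eqF.
by rewrite ler_wpM2r//; lra.
Qed.

Definition doubling_excess : R := 2 `^ pp * G.
Local Notation Lam := doubling_excess.

Definition tame_beta : R := H `^ (- (2 * pp)) / (Lam * G ^+ 2).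

Lemma doubling_excess_ge1 : 1 <= Lam.
Proof.
by rewrite -[leLHS]mulr1 ler_pM// -[leLHS](powRr0 2) ler_powR ?ler1n// ltW.
Qed.

Let Lam1 := doubling_excess_ge1.
Let Lam0 : 0 < Lam. Proof. exact: lt_le_trans Lam1. Qed.

Lemma tame_beta_bounds : 1 <= H -> 0 < tame_beta <= 1.
Proof.
move=> H1; have D1 : 1 <= Lam * G ^+ 2 by rewrite -[leLHS]mulr1 ler_pM// exprn_ege1.
have D0 : 0 < Lam * G ^+ 2 by rewrite (lt_le_trans _ D1).
rewrite /tame_beta divr_gt0 ?powR_gt0//= ler_pdivrMr// mul1r (le_trans _ D1)//.
by rewrite -[leRHS](powRr0 H) ler_powR// oppr_le0 mulr_ge0// ltW.
Qed.

Let H1 : 1 <= 1 + (pm^-1 * (2 `^ pp * G) + ln (G `^ pm^-1 * W)) -> 1 <= H.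
Proof.
move=> h; rewrite -[H]lnK ?posrE// -[leLHS](@expR0 R) ler_expR.
exact: le_trans ler01 (le_trans h HW).
Qed.

(** A ratio of scales is a power of the sides of the two cubes, on whose logarithms
    the oscillation of p is controlled. *)
Lemma tame_scale_ratio a l b h x y N M : 0 < l -> tame a l -> 0 < h ->
  hcube b h `<=` hcube a l -> hcube b h x -> hcube b h y ->
  0 < M -> M <= N -> 1 <= (tame_norm a l / N) / (tame_norm b h / M) ->
  ((tame_norm a l / N) / (tame_norm b h / M)) `^ p x <=
  G ^+ 2 * ((tame_norm a l / N) / (tame_norm b h / M)) `^ p y.
Proof.
move=> l0 tm h0 sub xb yb M0 MN s1.
have N0 : 0 < N by rewrite (lt_le_trans M0).
have ma := tame_norm_gt0 a l0; have mb := tame_norm_gt0 b h0.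
set s := _ / _ / (_ / _) in s1 *; have s0 : 0 < s by rewrite (lt_le_trans _ s1).
have lns : ln s <= n%:R / pm * (`|ln l| + `|ln h|).
  have sE : s = (tame_norm a l / tame_norm b h) * (M / N).
    by rewrite /s; field; rewrite !gt_eqF.
  apply: (@le_trans _ _ (ln (tame_norm a l / tame_norm b h))).
    rewrite ler_ln ?posrE// ?divr_gt0// sE ler_piMr ?divr_ge0 ?(ltW ma) ?(ltW mb)//.
    by rewrite ler_pdivrMr// mul1r.
  rewrite ln_div ?posrE// /tame_norm !ln_powR mulrDr.
  have bd (q u : R) : pm <= q -> n%:R / q * u <= n%:R / pm * `|u|.
    move=> pq; apply: (@le_trans _ _ (n%:R / q * `|u|)).
      by rewrite ler_wpM2l ?ler_norm// divr_ge0// (le_trans _ pq)// ltW.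
    by rewrite ler_wpM2r// ler_wpM2l// lef_pV2 ?posrE// (lt_le_trans _ pq).
  apply: lerD; first exact: bd.
  by rewrite -mulrN -(normrN (ln h)); exact: bd.
have lns0 : 0 <= ln s by rewrite ln_ge0.
have dist : (p x - p y) * ln s <= 2 * (n%:R * (@osc_const R n C0 C_inf + 17 * C_inf) / Num.min pm p_inf).
  have oh := tm _ _ h0 sub _ _ xb yb.
  have ol := tm _ _ l0 (@subset_refl _ _) _ _ (sub _ xb) (sub _ yb).
  apply: (@le_trans _ _ (`|p x - p y| * (n%:R / pm * (`|ln l| + `|ln h|)))).
    apply: (@le_trans _ _ (`|p x - p y| * ln s)); first by rewrite ler_wpM2r// ler_norm.
    by rewrite ler_wpM2l.
  have Ci0 : 0 < C_inf by case: LH.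
  have pi0 : 0 < p_inf by case: LH.
  apply: (@le_trans _ _ (n%:R / pm * (2 * (@osc_const R n C0 C_inf + 17 * C_inf)))).
    rewrite mulrCA ler_wpM2l ?divr_ge0 ?(ltW pm0)// mulrDr; lra.
  have mn0 : 0 < Num.min pm p_inf by rewrite lt_min pm0.
  have K0 : 0 <= @osc_const R n C0 C_inf + 17 * C_inf.
    have : 0 <= `|p x - p y| * `|ln h| by rewrite mulr_ge0.
    lra.
  rewrite [leRHS](_ : _ = n%:R / Num.min pm p_inf * (2 * (@osc_const R n C0 C_inf + 17 * C_inf))); last first.
    by field; rewrite gt_eqF.
  rewrite ler_wpM2r ?mulr_ge0// ler_wpM2l// lef_pV2 ?posrE//.
  by rewrite ge_min lexx.
rewrite (powR_expR _ s0) (powR_expR _ s0) /scale_const -expRM_natl -expRD ler_expR.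
rewrite -lerBlDr -mulrBl; apply: le_trans dist _.
by rewrite mulr_natl.
Qed.

(** The hypothesis of the Calderon-Zygmund argument for the weight (w * m / N) ^ p.
    Where its mean over a subcube P exceeds lam, the ratio s of the normalizations of
    w on Q and on P is at least 1; as the norm increases from P to Q, s is then at
    most a ratio of scales, and its powers s ^ p(x) for x in P are comparable.
    Hence lam is at most of the order of s ^ p(x), and it suffices that w is not
    small, for its normalization on P, on half of P. *)
Lemma tame_half_level a l N (c : V) (M : nat) lam : 0 < l -> tame a l -> 0 < N ->
  norm_on p (hcube a l) w = N%:E -> hcube a l c -> 1 <= lam ->
  ((lam * dyadic_side l M ^+ n)%:E <
    \int[mu]_(x in dyadic_cell a l M (dyadic_index a l M c))
       ((w x * (tame_norm a l / N)) `^ p x / Lam)%:E)%E ->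
  (mu (dyadic_cell a l M (dyadic_index a l M c) `&`
     [set x : V | ((w x * (tame_norm a l / N)) `^ p x / Lam <= tame_beta * lam)%R]) <=
   (dyadic_side l M ^+ n / 2)%:E)%E.
Proof.
move=> l0 tm N0 NE cQ lam1.
have sub := @dyadic_cell_root R n a l l0 M c cQ.
move: sub; rewrite dyadic_cellE//; set b := \row_i _; set h := dyadic_side l M => sub.
have h0 : 0 < h := dyadic_side_gt0 l0 M.
have hn0 : 0 < h ^+ n by rewrite exprn_gt0.
have tmb : tame b h := tame_sub sub tm.
have [M' [M0 ME W0 S0 cheb]] := tame_half h0 tmb.
have mP := measurable_hcube b h.
have small := small_set_of_log (ltr0n R 2) (ltW hn0) HW S0 cheb.
have MN : M' <= N.
  rewrite -lee_fin -ME -NE.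
  by apply: (norm_on_sub p0 mp w0 mw) => //; exact: measurable_hcube.
have ma := tame_norm_gt0 a l0; have mb := tame_norm_gt0 b h0.
pose s := (tame_norm a l / N) / (tame_norm b h / M').
have d0 : 0 < tame_norm b h / M' by rewrite divr_gt0.
have s0 : 0 < s by rewrite divr_gt0// divr_gt0.
have wE x : w x * (tame_norm a l / N) = w x * (tame_norm b h / M') * s.
  by rewrite -mulrA; congr (_ * _); rewrite /s [RHS]mulrC divfK ?(gt_eqF d0).
have powE x : (w x * (tame_norm a l / N)) `^ p x = (w x * (tame_norm b h / M')) `^ p x * s `^ p x.
  by rewrite wE powRM// ?(ltW s0)//; apply: mulr_ge0 => //; exact: ltW.
have mod := tame_modular h0 tmb M0 ME.
have LamV0 : 0 <= Lam^-1 by rewrite invr_ge0 ltW.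
(* A bound of s ^ p on P bounds the mean of the rescaled weight over P. *)
have mean (k : R) : 0 <= k -> (forall x, hcube b h x -> s `^ p x <= k) ->
    (\int[mu]_(x in hcube b h) ((w x * (tame_norm a l / N)) `^ p x / Lam)%:E <= (k * h ^+ n)%:E)%E.
  move=> k0 sk.
  have kL : 0 <= k / Lam by rewrite divr_ge0// ltW.
  have f0 x : hcube b h x -> 0 <= (w x * (tame_norm b h / M')) `^ p x by move=> _; exact: powR_ge0.
  rewrite (_ : k * h ^+ n = k / Lam * (2 `^ pp * G * h ^+ n)); last first.
    by rewrite -/Lam mulrA divfK ?gt_eqF.
  rewrite EFinM; apply: le_trans (lee_wpmul2l _ mod); last by rewrite lee_fin.
  rewrite -(integralZ_on mu mP (measurable_wpow (tame_norm b h / M') mp) kL f0).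
  apply: (le_integral_on mu mP).
  - by apply: measurable_funM (measurable_wpow _ mp) _; exact: measurable_cst.
  - by apply: measurable_funM _ (measurable_wpow _ mp); exact: measurable_cst.
  move=> x xb; rewrite mulr_ge0 ?powR_ge0//= powE.
  set A := (w x * _) `^ p x; have A0 : 0 <= A by exact: powR_ge0.
  rewrite [leRHS](_ : _ = A * k / Lam); last by ring.
  by rewrite ler_wpM2r// ler_wpM2l// sk.
move=> big.
have s1 : 1 <= s.
  rewrite leNgt; apply/negP => s1; move: big; rewrite ltNge; apply/negP/negPn.
  apply: le_trans (mean 1 ler01 _) _.
    move=> x _; rewrite -[leRHS](powRr0 s) ger_powR ?s0 ?(ltW s1)// ltW//.
  by rewrite lee_fin ler_wpM2r// ltW.
have H1' : 1 <= H by apply: H1; rewrite lerDl.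
rewrite (_ : h ^+ n / 2 = 2^-1 * h ^+ n); last by rewrite mulrC.
apply: le_trans small; apply: le_measure; rewrite ?inE.
- apply: measurableI => //.
  have mu' : measurable_fun [set: lebesgueRn R n] (fun x => (w x * (tame_norm a l / N)) `^ p x / Lam).
    by apply: measurable_funM (measurable_wpow _ mp) _; exact: measurable_cst.
  exact: measurable_sublevel mu'.
- by apply: measurableI => //; exact: measurable_sublevel mw.
move=> y [yb /= ule]; split => //=; rewrite leNgt; apply/negP => wy.
have lam_lt : lam < G ^+ 2 * s `^ p y.
  have k0 : 0 <= G ^+ 2 * s `^ p y by rewrite mulr_ge0 ?powR_ge0// exprn_ge0// ltW.
  have : ((lam * h ^+ n)%:E < (G ^+ 2 * s `^ p y * h ^+ n)%:E)%E.
    apply: lt_le_trans big _; apply: mean => // x xb.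
    exact: tame_scale_ratio sub xb yb _ MN s1.
  by rewrite lte_fin ltr_pM2r.
move: ule; rewrite leNgt => /negP; apply.
rewrite powE /tame_beta.
have wy' : H `^ (- 2) <= w y * (tame_norm b h / M') by rewrite ltW// -ltr_pdivrMr.
have Hp : H `^ (- (2 * pp)) <= (w y * (tame_norm b h / M')) `^ p y.
  apply: (@le_trans _ _ ((H `^ (- 2)) `^ p y)).
    by rewrite -powRrM ler_powR// mulNr lerN2 ler_pM2l.
  by rewrite ge0_ler_powR ?nnegrE ?powR_ge0 ?(ltW (p0 y))// mulr_ge0// ltW.
have Hp0 : 0 < H `^ (- (2 * pp)) by rewrite powR_gt0.
have GG : 0 < G ^+ 2 by rewrite exprn_gt0.
rewrite (_ : H `^ (- (2 * pp)) / (Lam * G ^+ 2) * lam = H `^ (- (2 * pp)) * (lam / G ^+ 2) / Lam); last first.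
  by field; rewrite !gt_eqF.
rewrite ltr_pM2r ?invr_gt0//.
apply: (@lt_le_trans _ _ (H `^ (- (2 * pp)) * s `^ p y)).
  by rewrite ltr_pM2l// ltr_pdivrMr// mulrC.
by rewrite ler_wpM2r ?powR_ge0.
Qed.

(** A_infty on every subcube, with a constant that does not depend on the subcube,
    is a good-lambda inequality for w ^ p normalized. *)
Lemma tame_reverse_hoelder a l r : 0 < l -> tame a l -> 1 < r <= 2 ->
  8 * 2 ^+ n.+1 * (r - 1) <= tame_beta ^+ 2 ->
  exists N, [/\ 0 < N, norm_on p (hcube a l) w = N%:E &
    (\int[mu]_(x in hcube a l) ((w x * (tame_norm a l / N)) `^ (r * p x))%:E <=
      (2 * Lam ^+ 2 * l ^+ n)%:E)%E].
Proof.
move=> l0 tm /andP[r1 r2] small.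
have [N [N0 NE W0 S0 _]] := tame_half l0 tm.
exists N; split => //.
have H1' : 1 <= H by apply: H1; rewrite lerDl.
have mQ := measurable_hcube a l.
have ln0 : 0 <= l ^+ n by rewrite exprn_ge0// ltW.
pose u x := (w x * (tame_norm a l / N)) `^ p x / Lam.
have u0 x : 0 <= u x by rewrite mulr_ge0 ?powR_ge0// invr_ge0 ltW.
have mu_u : measurable_fun [set: lebesgueRn R n] u.
  by apply: measurable_funM (measurable_wpow _ mp) _; exact: measurable_cst.
have mod := tame_modular l0 tm N0 NE.
have uQ : (\int[mu]_(x in hcube a l) (u x)%:E <= (l ^+ n)%:E)%E.
  have LV : 0 <= Lam^-1 by rewrite invr_ge0 ltW.
  have f0 x : hcube a l x -> 0 <= (w x * (tame_norm a l / N)) `^ p x by move=> _; exact: powR_ge0.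
  have -> : (\int[mu]_(x in hcube a l) (u x)%:E =
    \int[mu]_(x in hcube a l) (Lam^-1 * (w x * (tame_norm a l / N)) `^ p x)%:E)%E.
    by apply: eq_integral => x _; rewrite mulrC.
  rewrite (integralZ_on mu mQ (measurable_wpow _ mp) LV f0).
  apply: (le_trans (lee_wpmul2l _ mod)); first by rewrite lee_fin.
  by rewrite -EFinM lee_fin -/Lam mulrA mulVf ?mul1r// gt_eqF.
have bb := tame_beta_bounds H1'.
have level M (c : V) lam (cQ : hcube a l c) (lam1 : 1 <= lam) :=
  @tame_half_level a l N c M lam l0 tm N0 NE cQ lam1.
have good := good_lambda l0 mu_u u0 uQ level.
have K1 : 1 <= 2 ^+ n.+1 :> R by rewrite exprn_ege1// ler1n.
have e0 : 0 < r - 1 by rewrite subr_gt0.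
have := reverse_hoelder_good_lambda mQ mu_u u0 ln0 K1 bb e0 small uQ good.
have -> : 1 + (r - 1) = r by ring.
have Lr : 0 <= Lam `^ r by rewrite powR_ge0.
have ur0 x : hcube a l x -> 0 <= u x `^ r by move=> _; exact: powR_ge0.
have mur : measurable_fun [set: lebesgueRn R n] (fun x => u x `^ r).
  by apply: measurable_powR_fun mu_u _; exact: measurable_cst.
move=> main.
have -> : (\int[mu]_(x in hcube a l) ((w x * (tame_norm a l / N)) `^ (r * p x))%:E =
    (Lam `^ r)%:E * \int[mu]_(x in hcube a l) (u x `^ r)%:E)%E.
  rewrite -(integralZ_on mu mQ mur Lr ur0); apply: eq_integral => x _; congr EFin.
  rewrite -powRM ?(ltW Lam0)//.
  have -> : Lam * u x = (w x * (tame_norm a l / N)) `^ p x.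
    by rewrite mulrC divfK// gt_eqF.
  by rewrite [r * _]mulrC powRrM.
apply: (le_trans (lee_wpmul2l _ main)); first by rewrite lee_fin.
rewrite -EFinM lee_fin mulrCA mulrA ler_wpM2r// ler_pM2l//.
by rewrite -powR_mulrn ?(ltW Lam0)// ler_powR.
Qed.

End TameCubes.

(** * Centered cubes *)

Section CenteredCubes.
Context {R : realType} {n : nat}.
Local Notation V := 'rV[R]_n.
Local Notation mu := (@lebesgue R n).
Implicit Types (x b : V) (L l c : R).

Definition qcube L : set (lebesgueRn R n) := hcube (const_mx (- L) : V) (2 * L).

Lemma qcubeP L x : qcube L x <-> forall i, - L <= x ord0 i < L.
Proof. by split => h i; have := h i; rewrite mxE (_ : - L + 2 * L = L)//; ring. Qed.

Lemma measurable_qcube L : measurable (qcube L). Proof. exact: measurable_hcube. Qed.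

Lemma lebesgue_qcube L : 0 < L -> mu (qcube L) = ((2 * L) ^+ n)%:E.
Proof. by move=> L0; rewrite lebesgue_hcube// mulr_gt0. Qed.

Lemma qcube_sub L l : l <= L -> qcube l `<=` qcube L.
Proof.
move=> lL x /qcubeP xl; apply/qcubeP => i; have /andP[x1 x2] := xl i.
by apply/andP; split; lra.
Qed.

Lemma notin_qcube L x : ~ qcube L x -> exists i, L <= `|x ord0 i|.
Proof.
move=> nx; apply: contrapT => h; apply: nx; apply/qcubeP => i.
have xi : `|x ord0 i| < L by rewrite ltNge; apply/negP => Lx; apply: h; exists i.
by move: xi; rewrite ltr_norml => /andP[x1 x2]; rewrite (ltW x1) x2.
Qed.

(** An annulus of ratio three is made of 3 ^ n - 1 cubes of a third of the side,
    each of them at a distance from 0 comparable to its side. *)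
Lemma integral_annulus_le L (f : V -> R) c : 0 < L -> 0 <= c ->
  measurable_fun [set: lebesgueRn R n] f -> (forall x, 0 <= f x) ->
  (forall b, hcube b (2 * L / 3) `<=` qcube L ->
     (forall x, hcube b (2 * L / 3) x -> exists i, L / 3 <= `|x ord0 i|) ->
     (\int[mu]_(x in hcube b (2 * L / 3)) (f x)%:E <= c%:E)%E) ->
  (\int[mu]_(x in qcube L `\` qcube (L / 3)) (f x)%:E <= (3 ^+ n * c)%:E)%E.
Proof.
move=> L0 c0 mf f0 piece; set h := 2 * L / 3.
have h0 : 0 < h by rewrite /h; lra.
pose corner (k : {ffun 'I_n -> 'I_3}) : V := \row_i (- L + (k i)%:R * h).
pose k1 : {ffun 'I_n -> 'I_3} := [ffun=> inord 1].
pose P k := if k == k1 then set0 else hcube (corner k) h.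
have mP k : measurable (P k).
  by rewrite /P; case: ifP => _; [exact: measurable0|exact: measurable_hcube].
have pieceP k : (\int[mu]_(x in P k) (f x)%:E <= c%:E)%E.
  rewrite /P; case: eqP => [_|/eqP kk1]; first by rewrite integral_set0 lee_fin.
  apply: piece => [x xk|x xk].
    apply/qcubeP => i; have := xk i; rewrite mxE.
    have k2 : (k i)%:R <= 2 :> R by rewrite ler_nat -ltnS.
    have k0 : 0 <= (k i)%:R :> R by [].
    rewrite /h => /andP[x1 x2]; apply/andP; split; nra.
  have [i ki] : exists i, k i != inord 1.
    apply: contrapT => nk; move/eqP: kk1; apply; apply/ffunP => i; rewrite ffunE.
    by apply: contrapT => /eqP ki; apply: nk; exists i.
  exists i; have := xk i; rewrite mxE ler_normr.
  have : (k i : nat) = 0%N \/ (k i : nat) = 2%N.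
    have := ltn_ord (k i); move: ki; rewrite -val_eqE/= inordK//.
    by case: (nat_of_ord (k i)) => [|[|[|]]]//; [left|right].
  rewrite /h => -[->|->] /andP[x1 x2]; apply/orP; [right|left]; lra.
have cov : qcube L `\` qcube (L / 3) `<=` \big[setU/set0]_(k : {ffun 'I_n -> 'I_3}) P k.
  move=> x [xL xL3].
  pose k : {ffun 'I_n -> 'I_3} := [ffun i =>
    if x ord0 i < - L / 3 then inord 0 else if x ord0 i < L / 3 then inord 1 else inord 2].
  have xk : hcube (corner k) h x.
    move=> i; rewrite mxE /k ffunE; have /qcubeP/(_ i)/andP[x1 x2] := xL.
    by case: ltP => x3; [|case: ltP => x4]; rewrite inordK//; rewrite /h; apply/andP; split; lra.
  rewrite (bigD1 k)//=; left; rewrite /P ifF//; apply/negP => /eqP kk1.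
  apply: xL3; apply/qcubeP => i; have := xk i.
  by rewrite kk1 mxE ffunE inordK// /h => /andP[x1 x2]; apply/andP; split; lra.
have [mU IU] : measurable (\big[setU/set0]_(k : {ffun 'I_n -> 'I_3}) P k) /\
    (\int[mu]_(x in \big[setU/set0]_(k : {ffun 'I_n -> 'I_3}) P k) (f x)%:E <=
      \sum_(k : {ffun 'I_n -> 'I_3}) c%:E)%E.
  apply: (big_ind2 (fun (A : set (lebesgueRn R n)) v => measurable A /\
    (\int[mu]_(x in A) (f x)%:E <= v)%E)).
  - by split; [exact: measurable0|rewrite integral_set0].
  - move=> A1 v1 A2 v2 [m1 h1] [m2 h2]; split; first exact: measurableU.
    by apply: le_trans (integral_setU_le mu m1 m2 mf f0) _; exact: leeD.
  - by move=> k _; split.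
apply: (@le_trans _ _ (\sum_(k : {ffun 'I_n -> 'I_3}) c%:E)%E).
  apply: le_trans IU; apply: (integral_sub_on mu _ mU mf) => //.
  exact: measurableD (measurable_qcube _) (measurable_qcube _).
rewrite sumEFin sumr_const card_ffun !card_ord lee_fin -[leLHS]mulr_natl natrX.
exact: lexx.
Qed.

Variables (q : V -> R) (qm : R).
Hypothesis qm0 : 0 < qm.
Hypothesis q_ge : forall x, qm <= q x.
Hypothesis mq : measurable_fun [set: lebesgueRn R n] q.
Variable f : V -> R.
Hypothesis f0 : forall x, 0 <= f x.
Hypothesis mf : measurable_fun [set: lebesgueRn R n] f.

Let q0 x : 0 < q x. Proof. exact: lt_le_trans (q_ge x). Qed.

Lemma modular_scale_le (A : set (lebesgueRn R n)) (lam t D : R) : measurable A ->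
  0 < lam -> 0 < t <= 1 -> (\int[mu]_(x in A) ((f x / lam) `^ q x)%:E <= D%:E)%E ->
  (\int[mu]_(x in A) ((f x / lam * t) `^ q x)%:E <= (t `^ qm * D)%:E)%E.
Proof.
move=> mA l0 /andP[t0 t1] intf.
have tq0 : 0 <= t `^ qm by exact: powR_ge0.
have g0 x : A x -> 0 <= (f x / lam) `^ q x by move=> _; exact: powR_ge0.
rewrite EFinM; apply: le_trans (lee_wpmul2l _ intf); last by rewrite lee_fin.
rewrite -(integralZ_on mu mA (measurable_modular mq mf lam) tq0 g0).
apply: (le_integral_on mu mA).
- apply: measurable_powR_fun mq; apply: measurable_funM (measurable_cst _).
  by apply: measurable_funM mf _; exact: measurable_cst.
- by apply: measurable_funM _ (measurable_modular mq mf lam); exact: measurable_cst.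
move=> x _; rewrite powR_ge0/= powRM ?divr_ge0 ?(ltW l0) ?(ltW t0)//.
by rewrite mulrC ler_wpM2r ?powR_ge0// ger_powR ?t0.
Qed.

Lemma norm_on_le_modular (A : set (lebesgueRn R n)) (lam D : R) : measurable A ->
  0 < lam -> 1 <= D -> (\int[mu]_(x in A) ((f x / lam) `^ q x)%:E <= D%:E)%E ->
  (norm_on q A f <= (D `^ qm^-1 * lam)%:E)%E.
Proof.
move=> mA l0 D1 intf; have D0 : 0 < D by rewrite (lt_le_trans _ D1).
have g1 : 1 <= D `^ qm^-1 by rewrite -[leLHS](powRr0 D) ler_powR// invr_ge0 ltW.
have g0 : 0 < D `^ qm^-1 by rewrite powR_gt0.
apply: (norm_on_le q0 f0); first by rewrite mulr_gt0.
have t01 : 0 < (D `^ qm^-1)^-1 <= 1 by rewrite invr_gt0 g0 invf_le1.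
have := modular_scale_le mA l0 t01 intf.
have -> : (D `^ qm^-1)^-1 `^ qm * D = 1.
  rewrite -[(D `^ _)^-1]powR_inv1 ?(ltW g0)// -!powRrM mulrCA mulVf ?gt_eqF// mulr1.
  by rewrite powR_inv1 ?(ltW D0)// mulVf// gt_eqF.
have -> : (\int[mu]_(x in A) ((f x / (D `^ qm^-1 * lam)) `^ q x)%:E =
  \int[mu]_(x in A) ((f x / lam * (D `^ qm^-1)^-1) `^ q x)%:E)%E.
  by apply: eq_integral => x _; rewrite invfM mulrA mulrAC.
exact: id.
Qed.

(** If the scales phi(L) decrease geometrically when L is divided by three, the
    contributions of the successive annuli form a geometric series. *)
Lemma centered_chain (phi : R -> R) (tau B : R) : 0 < tau < 1 -> 0 <= B ->
  (forall L, 3^-1 < L -> 0 < phi L) ->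
  (forall L, 3^-1 < L -> L <= 1 -> (\int[mu]_(x in qcube L) ((f x / phi L) `^ q x)%:E <= B%:E)%E) ->
  (forall L, 1 < L ->
     (\int[mu]_(x in qcube L `\` qcube (L / 3)) ((f x / phi L) `^ q x)%:E <= B%:E)%E) ->
  (forall L, 1 < L -> phi (L / 3) <= tau * phi L) ->
  forall L, 3^-1 < L ->
    (\int[mu]_(x in qcube L) ((f x / phi L) `^ q x)%:E <= (B / (1 - tau `^ qm))%:E)%E.
Proof.
move=> /andP[tau0 tau1] B0 phi0 base annulus geom.
have tq1 : tau `^ qm < 1.
  by rewrite -[ltRHS](powRr0 tau) /powR gt_eqF// ltr_expR mul0r nmulr_llt0// ln_lt0// tau0.
have tq0 : 0 < 1 - tau `^ qm by rewrite subr_gt0.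
have tq_le : 1 - tau `^ qm <= 1 by rewrite lerBlDr lerDl powR_ge0.
have BD : B <= B / (1 - tau `^ qm) by rewrite ler_pdivlMr// ler_piMr.
have D0 : 0 <= B / (1 - tau `^ qm) by rewrite divr_ge0// ltW.
suff main k : forall L, 3^-1 < L -> L <= 3 ^+ k ->
    (\int[mu]_(x in qcube L) ((f x / phi L) `^ q x)%:E <= (B / (1 - tau `^ qm))%:E)%E.
  move=> L L3; apply: (main (Num.truncn L).+1) => //.
  apply: ltW; apply: (lt_le_trans (truncnS_gt _)).
  by rewrite -natrX ler_nat ltnW// ltn_expl.
elim: k => [|k IH] L L3 Lk.
  by apply: (le_trans (base L L3 _)); [rewrite -(expr0 3)|rewrite lee_fin].
have [L1|L1] := leP L 1; first by apply: (le_trans (base L L3 L1)); rewrite lee_fin.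
have mL := measurable_qcube L; have mL3 := measurable_qcube (L / 3).
have L33 : 3^-1 < L / 3 by lra.
have sub : qcube (L / 3) `<=` qcube L by apply: qcube_sub; lra.
have g0 x : qcube L x -> 0 <= (f x / phi L) `^ q x by move=> _; exact: powR_ge0.
rewrite (integral_splitI mu mL mL3 (measurable_modular mq mf _) g0).
rewrite (setIidr sub).
have phiL := phi0 L L3; have phiL3 := phi0 _ L33.
have t01 : 0 < phi (L / 3) / phi L <= 1.
  rewrite divr_gt0//= ler_pdivrMr// mul1r (le_trans (geom L L1))//.
  by rewrite ler_piMl ?ltW.
have := modular_scale_le mL3 phiL3 t01 (IH _ L33 _).
have Lk3 : L / 3 <= 3 ^+ k by rewrite ler_pdivrMr// mulrC -exprS.
move=> /(_ Lk3) small.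
have -> : B / (1 - tau `^ qm) = tau `^ qm * (B / (1 - tau `^ qm)) + B.
  by field; rewrite gt_eqF.
rewrite EFinD; apply: leeD; last exact: annulus.
have -> : (\int[mu]_(x in qcube (L / 3)) ((f x / phi L) `^ q x)%:E =
  \int[mu]_(x in qcube (L / 3)) ((f x / phi (L / 3) * (phi (L / 3) / phi L)) `^ q x)%:E)%E.
  apply: eq_integral => x _; congr ((_ `^ _)%:E).
  by rewrite mulrA divfK// gt_eqF.
apply: (le_trans small); rewrite lee_fin ler_wpM2r//.
rewrite ge0_ler_powR ?nnegrE ?(ltW qm0) ?(ltW tau0) ?divr_ge0 ?(ltW phiL) ?(ltW phiL3)//.
by rewrite ler_pdivrMr// geom.
Qed.

End CenteredCubes.

(** * Ratios of norms *)

Section NormRatio.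
Context {R : realType} {n : nat}.
Local Notation V := 'rV[R]_n.
Local Notation mu := (@lebesgue R n).
Implicit Types (A P Q : set (lebesgueRn R n)) (q f w : V -> R).

Lemma cube_norm_ratioE q w A : cube_norm_ratio q w A =
  mule_oo (norm_on q A (fun=> 1%R))^-1%E (norm_on q A w).
Proof. by rewrite /cube_norm_ratio indic_norm_on. Qed.

Lemma cube_norm_ratio_ge0 q w A : (forall x, 0 < q x) -> (forall x, 0 <= w x) ->
  (0 <= cube_norm_ratio q w A)%E.
Proof.
move=> q0 w0; rewrite cube_norm_ratioE /mule_oo; case: ifP => // _.
by rewrite mule_ge0 ?inve_ge0 ?norm_on_ge0.
Qed.

Lemma cube_norm_ratio_le q w A (X c : R) : (forall x, 0 < q x) ->
  (forall x, 0 <= w x) -> 0 < c -> (c%:E <= norm_on q A (fun=> 1%R))%E ->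
  (norm_on q A w <= X%:E)%E -> (cube_norm_ratio q w A <= (X / c)%:E)%E.
Proof.
move=> q0 w0 c0; rewrite cube_norm_ratioE.
have := norm_on_ge0 q0 w0 A.
case: (norm_on q A w) => [N||//]; last by move=> _ _; rewrite leye_eq.
rewrite lee_fin => N0; case: (norm_on q A _) => [M|_|//]; last first.
  by move=> NX; rewrite invey /mule_oo/= mul0e lee_fin divr_ge0 ?(ltW c0)// (le_trans N0).
rewrite !lee_fin => cM NX; have M0 : 0 < M by rewrite (lt_le_trans c0).
rewrite inver (gt_eqF M0) /mule_oo/= -EFinM lee_fin mulrC.
by apply: ler_pM => //; rewrite ?invr_ge0 ?(ltW M0)// lef_pV2 ?posrE.
Qed.

Lemma cube_norm_ratio_ge q w A (M N : R) : (forall x, 0 < q x) -> 0 <= N ->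
  (norm_on q A (fun=> 1%R) <= M%:E)%E -> norm_on q A w = N%:E ->
  ((N / M)%:E <= cube_norm_ratio q w A)%E.
Proof.
move=> q0 N0 normM normN; rewrite cube_norm_ratioE normN.
have := norm_on_ge0 q0 (fun=> ler01) A.
move: normM; case: (norm_on q A _) => [M'| |//]; last by rewrite leye_eq.
rewrite !lee_fin => MM M'0; have [->|M'n0] := eqVneq M' 0.
  by rewrite inver eqxx /mule_oo eqxx leey.
rewrite inver (negbTE M'n0) /mule_oo.
have {M'0 M'n0}M'0 : 0 < M' by rewrite lt_neqAle eq_sym M'n0.
rewrite /= -EFinM lee_fin mulrC; apply: ler_pM => //.
  by rewrite invr_ge0 (le_trans (ltW M'0)).
by rewrite lef_pV2 ?posrE// (lt_le_trans M'0).
Qed.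

(** A function that is at least t / m on a set P is large in norm as soon as
    m ^ q is of the order of the measure of P. *)
Lemma norm_on_ge_of_large q f P Q (qm m v K e t : R) : 0 < qm ->
  (forall x, qm <= q x) -> measurable_fun [set: lebesgueRn R n] q ->
  (forall x, 0 <= f x) -> measurable_fun [set: lebesgueRn R n] f ->
  measurable P -> measurable Q -> P `<=` Q ->
  0 < m -> 0 < v -> 1 <= K -> 1 <= e -> 0 < t ->
  (forall x, P x -> t / m <= f x) -> (forall x, P x -> m `^ q x <= K * v) ->
  ((v / e)%:E <= mu P)%E ->
  ((((2 * K * e) `^ qm^-1)^-1 * t)%:E <= norm_on q Q f)%E.
Proof.
move=> qm0 q_ge mq f0 mf mP mQ PQ m0 v0 K1 e1 t0 fP mK muP.
have q0 x : 0 < q x by exact: lt_le_trans (q_ge x).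
have K0 : 0 < K by exact: lt_le_trans K1.
have e0 : 0 < e by exact: lt_le_trans e1.
have E1 : 1 <= 2 * K * e.
  have K2 : 1 <= 2 * K by lra.
  by rewrite -[leLHS]mulr1; exact: (ler_pM ler01 ler01 K2 e1).
have E0 : 0 < 2 * K * e by exact: lt_le_trans E1.
set d := (2 * K * e) `^ qm^-1.
have d1 : 1 <= d by rewrite -[leLHS](powRr0 (2 * K * e)) ler_powR// invr_ge0 ltW.
have d0 : 0 < d by exact: lt_le_trans d1.
have dq x : 2 * K * e <= d `^ q x.
  rewrite -[leLHS](@powRr1 _ (2 * K * e)) ?(ltW E0)// /d -powRrM ler_powR//.
  by rewrite ler_pdivlMl// mulr1.
apply: (norm_on_ge q0 f0) => lam l0 lt_lam.
have mod lam' := measurable_modular mq mf lam'.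
apply: (@lt_le_trans _ _ ((2 * e / v)%:E * mu P)%E).
  apply: (@lt_le_trans _ _ ((2 * e / v)%:E * (v / e)%:E)%E).
    rewrite -EFinM lte_fin (_ : 2 * e / v * (v / e) = 2) ?ltr1n//.
    by field; rewrite !gt_eqF.
  by apply: lee_wpmul2l muP; rewrite lee_fin divr_ge0 ?mulr_ge0 ?(ltW e0) ?(ltW v0).
apply: (@le_trans _ _ (\int[mu]_(x in P) ((f x / lam) `^ q x)%:E)%E); last first.
  by apply: (integral_sub_on mu mP mQ (mod lam) _ PQ) => x _; exact: powR_ge0.
apply: (integral_ge_cst mu mP (mod lam)).
  by rewrite divr_ge0 ?mulr_ge0 ?(ltW e0) ?(ltW v0).
move=> x Px.
have mq0 : 0 < m `^ q x by rewrite powR_gt0.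
apply: (@le_trans _ _ ((d / m) `^ q x)); last first.
  rewrite ge0_ler_powR ?nnegrE ?(ltW (q0 x)) ?divr_ge0 ?(ltW d0) ?(ltW m0) ?(ltW l0)//.
  rewrite ler_pdivlMr//; apply: le_trans (fP x Px).
  rewrite [leLHS](_ : _ = (lam * d) / m); last by ring.
  rewrite ler_pM2r ?invr_gt0// -ler_pdivlMr// mulrC.
  exact: ltW.
rewrite powRM ?invr_ge0 ?(ltW d0) ?(ltW m0)//.
rewrite -[m^-1]powR_inv1 ?(ltW m0)// -powRrM mulN1r powRN.
rewrite ler_pdivlMr//; apply: le_trans (dq x).
apply: (@le_trans _ _ (2 * e / v * (K * v))).
  by rewrite ler_wpM2l ?mK// divr_ge0 ?mulr_ge0 ?(ltW e0) ?(ltW v0).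
by rewrite le_eqVlt; apply/orP; left; apply/eqP; field; rewrite gt_eqF.
Qed.

(** The faces of a cube are negligible, so that only half-open cubes matter. *)
Lemma cube_norm_ratio_hcube q w (a : V) (l : R) (b c : 'I_n -> bool) :
  (forall x, 0 < q x) -> measurable_fun [set: lebesgueRn R n] q ->
  (forall x, 0 <= w x) -> measurable_fun [set: lebesgueRn R n] w ->
  cube_norm_ratio q w [set x : V | forall i, x ord0 i \in
    Interval (BSide (b i) (a ord0 i)) (BSide (c i) (a ord0 i + l))] =
  cube_norm_ratio q w (hcube a l).
Proof.
move=> q0 mq w0 mw; rewrite !cube_norm_ratioE.
have [N [mN N0 hN]] := cube_faces_negligible a l b c.
set C := [set x : V | _] in hN *.
have mC : measurable (C : set (lebesgueRn R n)).
  apply: (@measurable_forall_coord _ _ (fun i => [set x : V | x ord0 i \in _])) => i.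
  exact: measurable_itv_coord.
have mh : measurable (hcube a l) := measurable_hcube a l.
have m1 : measurable_fun [set: lebesgueRn R n] (fun=> 1%R : R) by exact: measurable_cst.
rewrite (norm_on_null q0 mq w0 mw mC mh mN N0 hN).
by rewrite (norm_on_null q0 mq (fun=> ler01) m1 mC mh mN N0 hN).
Qed.

End NormRatio.

(** In the application y and z are of the order of X, so that the quotient of
    y ^ (r - 1) by z ^ r is of the order of X^-1. *)
Lemma scale_quotient_le (R : realType) (G X c y z r : R) : 0 < X -> 1 <= G -> 1 <= c ->
  1 <= r <= 2 -> 0 <= y -> y <= G * (c * X) -> G^-1 * X <= z ->
  y `^ (r - 1) * (z `^ r)^-1 <= c * G ^+ 3 / X.
Proof.
move=> X0 G1 c1 /andP[r1 r2] y0 yle zge.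
have G0 : 0 < G by rewrite (lt_le_trans _ G1).
have c0 : 0 < c by rewrite (lt_le_trans _ c1).
have GX : 0 < G^-1 * X by rewrite mulr_gt0// invr_gt0.
have z0 : 0 < z by rewrite (lt_le_trans GX).
have e1 : 0 <= r - 1 by rewrite subr_ge0.
have e2 : r - 1 <= 1 by rewrite lerBlDr.
have r0 : 0 <= r by rewrite (le_trans ler01).
have num : y `^ (r - 1) <= G * c * X `^ (r - 1).
  apply: (@le_trans _ _ ((G * (c * X)) `^ (r - 1))).
    by rewrite ge0_ler_powR ?nnegrE// (le_trans y0 yle).
  rewrite mulrA powRM ?mulr_ge0 ?(ltW G0) ?(ltW c0) ?(ltW X0)// ler_wpM2r ?powR_ge0//.
  by apply: ler1_powR => //; rewrite -[leLHS]mulr1 ler_pM.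
have den : (z `^ r)^-1 <= G ^+ 2 * (X `^ r)^-1.
  have -> : G ^+ 2 * (X `^ r)^-1 = ((G ^+ 2)^-1 * X `^ r)^-1 by rewrite invfM invrK.
  rewrite lef_pV2 ?posrE ?mulr_gt0 ?powR_gt0 ?invr_gt0 ?exprn_gt0//.
  apply: (@le_trans _ _ ((G^-1 * X) `^ r)); last first.
    by rewrite ge0_ler_powR ?nnegrE ?(ltW GX) ?(ltW z0).
  rewrite powRM ?invr_ge0 ?(ltW G0) ?(ltW X0)// ler_wpM2r ?powR_ge0//.
  rewrite -[G^-1]powR_inv1 ?(ltW G0)// -powRrM mulN1r powRN.
  rewrite lef_pV2 ?posrE ?powR_gt0 ?exprn_gt0// -powR_mulrn ?(ltW G0)//.
  by rewrite ler_powR.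
apply: (le_trans (ler_pM _ _ num den)); rewrite ?invr_ge0 ?powR_ge0//.
have -> : X `^ r = X `^ (r - 1) * X.
  have Xn : X != 0 by rewrite gt_eqF.
  by rewrite -[X in _ = _ * X]powRr1 ?(ltW X0)// -powRD ?Xn ?implybT// subrK.
have Y0 : 0 < X `^ (r - 1) by rewrite powR_gt0.
rewrite le_eqVlt; apply/orP; left; apply/eqP; field.
by rewrite !gt_eqF.
Qed.

(** * The weight on centered cubes *)

Section CenteredCubesOfWeight.
Context {R : realType} {n : nat}.
Local Notation V := 'rV[R]_n.
Local Notation mu := (@lebesgue R n).
Variables (p : V -> R) (pm p_inf C0 C_inf : R).
Hypothesis n0 : (0 < n)%N.
Hypothesis LH : LH_with p_inf C0 C_inf p.
Hypothesis pm0 : 0 < pm.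
Hypothesis p_ge : forall x, pm <= p x.
Implicit Types (a b x : V) (l h L t N k : R).

Local Notation pp := (p_inf + C_inf).
Local Notation G := (@scale_const R n pm p_inf C0 C_inf).
Local Notation Lam := (@doubling_excess R n pm p_inf C0 C_inf).
Local Notation tame := (@tame R n p C0 C_inf).
Local Notation tame_norm := (@tame_norm R n p).

Let p_le x : p x <= pp. Proof. exact: exponent_le LH x. Qed.
Let mp : measurable_fun [set: lebesgueRn R n] p. Proof. by case: LH. Qed.
Let p0 x : 0 < p x. Proof. exact: lt_le_trans (p_ge x). Qed.
Let pp0 : 0 < pp. Proof. exact: lt_le_trans (p0 0) (p_le 0). Qed.
Let G1 : 1 <= G. Proof. exact: scale_const_ge1 n0 LH pm0. Qed.
Let G0 : 0 < G. Proof. exact: lt_le_trans G1. Qed.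
Let Lam1 : 1 <= Lam. Proof. exact: doubling_excess_ge1 n0 LH pm0 p_ge. Qed.
Let Lam0 : 0 < Lam. Proof. exact: lt_le_trans Lam1. Qed.
Let pmV0 : 0 <= pm^-1. Proof. by rewrite invr_ge0 ltW. Qed.
Let p_inf_gt0 : 0 < p_inf. Proof. by case: LH. Qed.
Let C_inf_gt0 : 0 < C_inf. Proof. by case: LH. Qed.
Let m1 : measurable_fun [set: lebesgueRn R n] (fun=> 1%R : R).
Proof. exact: measurable_cst. Qed.
Let nR0 : 0 < n%:R :> R. Proof. by rewrite ltr0n. Qed.

Definition center_norm L : R := L `^ (n%:R / p_inf).

Lemma center_norm_gt0 L : 0 < L -> 0 < center_norm L.
Proof. exact: powR_gt0. Qed.

Definition center_ratio : R := 3 `^ (- (n%:R / p_inf)).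

Definition center_mass : R :=
  (2 ^+ n * G + 2 ^+ n * (3 `^ (n%:R / p_inf)) `^ pp) / (1 - center_ratio `^ pm).

Lemma center_ratio_bounds : 0 < center_ratio < 1.
Proof.
rewrite /center_ratio powR_gt0//= powRN invf_lt1 ?powR_gt0//.
rewrite -[ltLHS](powRr0 3) /powR gt_eqF// ltr_expR mul0r.
by rewrite mulr_gt0 ?divr_gt0// ln_gt0// ltr1n.
Qed.

Lemma center_mass_ge1 : 1 <= center_mass.
Proof.
have /andP[c0 c1] := center_ratio_bounds.
have cq1 : center_ratio `^ pm < 1.
  by rewrite -[ltRHS](powRr0 center_ratio) /powR gt_eqF// ltr_expR mul0r nmulr_llt0// ln_lt0// c0.
rewrite /center_mass ler_pdivlMr ?subr_gt0// mul1r.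
apply: (@le_trans _ _ 1); first by rewrite lerBlDr lerDl powR_ge0.
have t1 : 1 <= 2 ^+ n :> R by rewrite exprn_ege1// ler1n.
have h1 : 1 <= 2 ^+ n * G by rewrite -[leLHS]mulr1 ler_pM.
by rewrite (le_trans h1)// lerDl mulr_ge0 ?powR_ge0// exprn_ge0.
Qed.

Lemma far_center_scale L x : 1 <= L -> (exists i, L / 16 <= `|x ord0 i|) ->
  G^-1 * L ^+ n <= center_norm L `^ p x <= G * L ^+ n.
Proof. by move=> L1 far; exact: (far_scale n0 LH pm0 L1 far). Qed.

Lemma annulus_far L x : 0 < L -> (qcube L `\` qcube (L / 3)) x ->
  exists i, L / 16 <= `|x ord0 i|.
Proof.
by move=> L0 [_ /notin_qcube[i xi]]; exists i; apply: le_trans xi; lra.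
Qed.

(** The scales L ^ (n / p_inf) decrease geometrically, and each annulus is far from
    the origin, where p is close to p_inf. *)
Lemma le_norm_on_center L : 1 <= L ->
  (norm_on p (qcube L) (fun=> 1%R) <= (center_mass `^ pm^-1 * center_norm L)%:E)%E.
Proof.
move=> L1; have L0 : 0 < L by rewrite (lt_le_trans _ L1).
have f1 (x : V) : 0 <= 1 :> R by [].
apply: (norm_on_le_modular pm0 p_ge mp f1 m1 (measurable_qcube L) (center_norm_gt0 L0)).
  exact: center_mass_ge1.
have t1 : 0 <= 2 ^+ n * G by rewrite mulr_ge0 ?exprn_ge0// ltW.
have t2 : 0 <= 2 ^+ n * (3 `^ (n%:R / p_inf)) `^ pp :> R.
  by rewrite mulr_ge0 ?powR_ge0// exprn_ge0.
have mone (l : R) : measurable_fun [set: lebesgueRn R n] (fun x => (1 / center_norm l) `^ p x).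
  exact: (measurable_modular mp m1).
apply: (centered_chain pm0 p_ge mp f1 m1 center_ratio_bounds (addr_ge0 t1 t2)).
- by move=> l l3; apply: center_norm_gt0; apply: lt_trans l3; rewrite invr_gt0.
- move=> l l3 l1; have l0 : 0 < l by apply: lt_trans l3; rewrite invr_gt0.
  have bd x : qcube l x -> 0 <= (1 / center_norm l) `^ p x <= (3 `^ (n%:R / p_inf)) `^ pp.
    move=> _; rewrite powR_ge0/=.
    have c0 := center_norm_gt0 l0.
    have e0 : 0 <= n%:R / p_inf by rewrite divr_ge0 ?(ltW p_inf_gt0).
    have c1 : center_norm l <= 1.
      by rewrite /center_norm -[leRHS](powRr0 l) ger_powR// l0.
    apply: (@le_trans _ _ ((1 / center_norm l) `^ pp)).
      by rewrite ler_powR// div1r invf_ge1.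
    rewrite ge0_ler_powR ?nnegrE ?divr_ge0 ?powR_ge0 ?(ltW c0)//.
      by rewrite addr_ge0// ltW.
    rewrite div1r /center_norm -powRN.
    rewrite !powR_expR// ler_expR mulNr -mulrN -lnV ?posrE// ler_wpM2l// ler_ln ?posrE ?invr_gt0//.
    by rewrite -[leRHS]invrK lef_pV2 ?posrE ?invr_gt0// ltW.
  apply: (@le_trans _ _ (((3 `^ (n%:R / p_inf)) `^ pp)%:E * mu (qcube l))%E).
    exact: (integral_le_cst mu (measurable_qcube l) (mone l) bd).
  rewrite lebesgue_qcube// -EFinM lee_fin mulrC.
  apply: (@le_trans _ _ (2 ^+ n * (3 `^ (n%:R / p_inf)) `^ pp)); last by rewrite lerDr.
  rewrite ler_wpM2r ?powR_ge0// ler_pXn2r ?nnegrE ?mulr_ge0 ?(ltW l0)//.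
  by rewrite -[leRHS]mulr1 ler_pM2l.
- move=> l l1; have l0 : 0 < l by rewrite (lt_trans _ l1).
  have mA : measurable (qcube l `\` qcube (l / 3) : set (lebesgueRn R n)).
    by apply: measurableD; exact: measurable_qcube.
  have bd x : (qcube l `\` qcube (l / 3)) x -> 0 <= (1 / center_norm l) `^ p x <= G / l ^+ n.
    move=> xA; rewrite powR_ge0/=.
    have /andP[lo _] := far_center_scale (ltW l1) (annulus_far l0 xA).
    have c0 := center_norm_gt0 l0.
    rewrite div1r -powR_inv1 ?(ltW c0)// -powRrM mulN1r powRN -[G]invrK -invfM.
    by rewrite lef_pV2 ?posrE ?mulr_gt0 ?invr_gt0 ?exprn_gt0 ?powR_gt0.
  have Gl : 0 <= G / l ^+ n by rewrite divr_ge0 ?exprn_ge0 ?ltW.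
  apply: (@le_trans _ _ ((G / l ^+ n)%:E * mu (qcube l))%E).
    apply: (le_trans (integral_le_cst mu mA (mone l) bd)).
    apply: lee_wpmul2l; first by rewrite lee_fin.
    by apply: le_measure => [||x []//]; rewrite inE//; exact: measurable_qcube.
  rewrite lebesgue_qcube// -EFinM lee_fin exprMn.
  rewrite (_ : G / l ^+ n * (2 ^+ n * l ^+ n) = 2 ^+ n * G) ?lerDl//.
  by field; rewrite gt_eqF// exprn_gt0.
- move=> l l1; have l0 : 0 < l by rewrite (lt_trans _ l1).
  rewrite /center_norm powRM ?(ltW l0)// mulrC ler_wpM2r ?powR_ge0//.
  by rewrite /center_ratio -powR_inv1// -powRrM mulN1r.
- by apply: lt_le_trans L1; rewrite invf_lt1// ltr1n.
Qed.

Variables (w : V -> R) (W : R).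
Hypothesis wP : is_weight w.
Hypothesis AW : (Ainfty_const p w <= W%:E)%E.

Let w0 x : 0 <= w x. Proof. by case: wP. Qed.
Let mw : measurable_fun [set: lebesgueRn R n] w. Proof. by case: wP. Qed.

Definition center_log_const : R := pm^-1 * 2 `^ pp + 6 * (n%:R * C_inf / (p_inf * pm)).

Lemma center_log_le L N x : 1 <= L -> 0 < N -> 
  Num.max 0 (ln (w x * (center_norm L / N))) <=
  pm^-1 * ((w x / N) `^ p x * L ^+ n) + n%:R / (p_inf * pm) * (`|p x - p_inf| * ln L).
Proof.
move=> L1 N0; have L0 : 0 < L by rewrite (lt_le_trans _ L1).
have lnL : 0 <= ln L by rewrite ln_ge0.
have c0 := center_norm_gt0 L0.
have Ln0 : 0 < L ^+ n by rewrite exprn_gt0.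
have npos : 0 <= n%:R / (p_inf * pm) by rewrite divr_ge0// mulr_ge0 ?ltW.
have T1 : 0 <= pm^-1 * ((w x / N) `^ p x * L ^+ n).
  by rewrite mulr_ge0 ?invr_ge0 ?(ltW pm0)// mulr_ge0 ?powR_ge0 ?ltW.
have T2 : 0 <= n%:R / (p_inf * pm) * (`|p x - p_inf| * ln L) by rewrite mulr_ge0// mulr_ge0.
rewrite ge_max addr_ge0//=.
have [wx|wx] := ltP 0 (w x); last first.
  have -> : w x = 0 by apply/eqP; rewrite eq_le wx w0.
  by rewrite mul0r ln0// addr_ge0// mulr_ge0 ?invr_ge0 ?(ltW pm0)// mulr_ge0 ?powR_ge0 ?ltW.
have wN : 0 < w x / N by rewrite divr_gt0.
rewrite (_ : w x * (center_norm L / N) = (w x / N) * center_norm L); last by ring.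
rewrite lnM ?posrE// /center_norm ln_powR.
have E : ln (w x / N) + n%:R / p_inf * ln L =
   (p x)^-1 * ln ((w x / N) `^ p x * L ^+ n) + n%:R / (p_inf * p x) * ((p x - p_inf) * ln L).
  rewrite [ln (_ * L ^+ n)]lnM ?posrE ?powR_gt0// ln_powR lnXn//.
  rewrite -(mulr_natl (ln L)); field; rewrite !gt_eqF//.
rewrite E; apply: lerD.
  have Z0 : 0 < (w x / N) `^ p x * L ^+ n by rewrite mulr_gt0// powR_gt0.
  apply: (@le_trans _ _ ((p x)^-1 * ((w x / N) `^ p x * L ^+ n))).
    by rewrite ler_wpM2l ?invr_ge0 ?(ltW (p0 x))// ltW// ln_sublinear.
  by rewrite ler_wpM2r ?(ltW Z0)// lef_pV2 ?posrE.
apply: (@le_trans _ _ (n%:R / (p_inf * p x) * (`|p x - p_inf| * ln L))).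
  rewrite ler_wpM2l ?divr_ge0 ?mulr_ge0 ?(ltW p_inf_gt0) ?(ltW (p0 x))//.
  by rewrite ler_wpM2r// ler_norm.
rewrite ler_wpM2r ?mulr_ge0// ler_wpM2l// lef_pV2 ?posrE ?mulr_gt0//.
by rewrite ler_wpM2l ?(ltW p_inf_gt0).
Qed.

(** The term that p_inf adds is bounded outside the cube of half-side the square root
    of L, and inside it the factor ln L is absorbed by the measure of this
    cube. *)
Lemma center_log_integral L N : 1 <= L -> 0 < N -> norm_on p (qcube L) w = N%:E ->
  (\int[mu]_(x in qcube L) (Num.max 0 (ln (w x * (center_norm L / N))))%:E <=
    (center_log_const * (2 * L) ^+ n)%:E)%E.
Proof.
move=> L1 N0 NE; have L0 : 0 < L by rewrite (lt_le_trans _ L1).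
have lnL : 0 <= ln L by rewrite ln_ge0.
have Ln0 : 0 < L ^+ n by rewrite exprn_gt0.
pose S := Num.sqrt L.
have S0 : 0 < S by rewrite sqrtr_gt0.
have SS : L = S ^+ 2 by rewrite sqr_sqrtr// ltW.
have S1 : 1 <= S by rewrite -[leLHS]sqrtr1 ler_sqrt// ltW.
have SL : S <= L by rewrite SS expr2 ler_peMr// ltW.
have lnS : ln L = 2 * ln S by rewrite SS lnXn// mulr_natl.
pose e := n%:R * C_inf / (p_inf * pm).
have e0 : 0 <= e by rewrite divr_ge0 ?mulr_ge0 ?ltW.
have mL := @measurable_qcube R n L; have mS := @measurable_qcube R n S.
pose g1 x := pm^-1 * L ^+ n * (w x / N) `^ p x.
pose g2 (x : V) := e * ln L * \1_(qcube S) x.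
have mod := norm_on_modular_le pm0 p_ge p_le mp w0 mw mL N0 NE.
have mg1 : measurable_fun [set: lebesgueRn R n] g1.
  by apply: measurable_funM _ (measurable_modular mp mw N); exact: measurable_cst.
have mg2 : measurable_fun [set: lebesgueRn R n] g2.
  apply: measurable_funM; first exact: measurable_cst.
  exact: measurable_indic.
have mcst : measurable_fun [set: lebesgueRn R n] (fun=> 4 * e : R) by exact: measurable_cst.
have k1 : 0 <= pm^-1 * L ^+ n by rewrite mulr_ge0 ?invr_ge0 ?ltW.
have k2 : 0 <= e * ln L by rewrite mulr_ge0.
have g10 x : 0 <= g1 x by rewrite mulr_ge0 ?powR_ge0.
have g20 x : 0 <= g2 x by rewrite mulr_ge0// indicE.
have c4 : 0 <= 4 * e by rewrite mulr_ge0.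
have bound x : Num.max 0 (ln (w x * (center_norm L / N))) <= g1 x + (4 * e + g2 x).
  apply: le_trans (center_log_le x L1 N0) _.
  rewrite /g1 -[pm^-1 * L ^+ n * _]mulrA [L ^+ n * _]mulrC lerD2l.
  rewrite (_ : n%:R / (p_inf * pm) * (`|p x - p_inf| * ln L) =
    e * (`|p x - p_inf| * ln L / C_inf)); last by rewrite /e; field; rewrite !gt_eqF.
  rewrite /g2 indicE; case: (boolP (x \in _)) => xS.
    have d := exponent_dist_inf LH x.
    rewrite mulr1 (mulrC 4) -mulrDr ler_wpM2l// ler_pdivrMr//.
    have : `|p x - p_inf| * ln L <= C_inf * ln L by rewrite ler_wpM2r.
    have : 0 <= C_inf * 4 by rewrite mulr_ge0// ltW.
    lra.
  have far : exists i, S / 1 <= `|x ord0 i|.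
    have nS : ~ qcube S x by move=> h; move/negP: xS; apply; rewrite inE.
    by have [i xi] := notin_qcube nS; exists i; rewrite divr1.
  have := exponent_dist_far LH S1 (lexx 1) far => d.
  rewrite mulr0 addr0 (mulrC 4) ler_wpM2l// ler_pdivrMr// lnS; lra.
apply: (@le_trans _ _ (\int[mu]_(x in qcube L) (g1 x + (4 * e + g2 x))%:E)%E).
  apply: (le_integral_on mu mL).
  - apply: measurable_maxr; first exact: measurable_cst.
    apply: measurableT_comp; first exact: measurable_ln.
    by apply: measurable_funM mw _; exact: measurable_cst.
  - exact: measurable_funD mg1 (measurable_funD mcst mg2).
  by move=> x _; rewrite le_max lexx bound.
have m42 : measurable_fun [set: lebesgueRn R n] (fun x => 4 * e + g2 x).
  exact: measurable_funD mcst mg2.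
have c42 x : 0 <= 4 * e + g2 x by rewrite addr_ge0.
rewrite (integralD_on mu mL mg1 m42 g10 c42) (integralD_on mu mL mcst mg2 (fun=> c4) g20).
have I1 : (\int[mu]_(x in qcube L) (g1 x)%:E <= (pm^-1 * L ^+ n * 2 `^ pp)%:E)%E.
  rewrite (integralZ_on mu mL (measurable_modular mp mw N) k1); last first.
    by move=> x _; exact: powR_ge0.
  by rewrite [leRHS]EFinM; apply: lee_wpmul2l; rewrite ?lee_fin.
have I2 : (\int[mu]_(x in qcube L) (4 * e)%:E = (4 * e * (2 * L) ^+ n)%:E)%E.
  by rewrite integral_cst// [RHS]EFinM; congr (_ * _)%E; exact: lebesgue_qcube.
have I3 : (\int[mu]_(x in qcube L) (g2 x)%:E <= (e * ln L * (2 * S) ^+ n)%:E)%E.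
  have mS1 : measurable_fun [set: lebesgueRn R n] (\1_(qcube S) : V -> R).
    exact: measurable_indic.
  rewrite (integralZ_on mu mL mS1 k2); last by move=> x _; rewrite indicE.
  rewrite integral_indic// [leRHS]EFinM; apply: lee_wpmul2l; first by rewrite lee_fin.
  rewrite -lebesgue_qcube//; apply: le_measure; rewrite ?inE//.
  exact: measurableI.
apply: (le_trans (leeD I1 (leeD (lexx _) I3))).
rewrite I2 -!EFinD lee_fin /center_log_const -/e.
have L2 : L ^+ n <= (2 * L) ^+ n.
  rewrite ler_pXn2r ?nnegrE ?mulr_ge0 ?(ltW L0)//; lra.
have lnSn : ln L * (2 * S) ^+ n <= 2 * (2 * L) ^+ n.
  have : ln S <= S by rewrite ltW// ln_sublinear.
  have Sn1 : S <= S ^+ n.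
    by case: (n) n0 => // m _; rewrite exprS ler_peMr ?exprn_ege1// ltW.
  rewrite lnS !exprMn SS -exprM mulnC exprM => lS.
  have t0 : 0 <= 2 ^+ n :> R by rewrite exprn_ge0.
  have : ln S * S ^+ n <= (S ^+ n) ^+ 2.
    rewrite expr2 ler_wpM2r ?exprn_ge0 ?(ltW S0)//; exact: le_trans Sn1.
  nra.
have : e * (ln L * (2 * S) ^+ n) <= e * (2 * (2 * L) ^+ n) by rewrite ler_wpM2l.
have P2 : 0 <= pm^-1 * 2 `^ pp by rewrite mulr_ge0 ?invr_ge0 ?powR_ge0 ?ltW.
have : pm^-1 * 2 `^ pp * L ^+ n <= pm^-1 * 2 `^ pp * (2 * L) ^+ n by rewrite ler_wpM2l.
lra.
Qed.

Lemma center_half L : 1 <= L ->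
  exists N, [/\ 0 < N, norm_on p (qcube L) w = N%:E, 0 < W,
    0 <= center_log_const + ln (center_mass `^ pm^-1 * W) &
    forall t, 0 <= t ->
      (t%:E * mu (qcube L `&` [set x : V | (w x <= expR (- t) / (center_norm L / N))%R]) <=
       ((center_log_const + ln (center_mass `^ pm^-1 * W)) * (2 * L) ^+ n)%:E)%E].
Proof.
move=> L1; have L0 : 0 < L by rewrite (lt_le_trans _ L1).
apply: (half_set pm0 p_ge mp wP AW _ (center_norm_gt0 L0)).
- by rewrite mulr_gt0.
- by rewrite powR_gt0// (lt_le_trans _ center_mass_ge1).
- exact: le_norm_on_center.
- by move=> N N0 NE; exact: center_log_integral.
Qed.

(** * Reverse doubling of the norm on centered cubes *)

Variable H : R.
Hypothesis H0 : 0 < H.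
Hypothesis HW : 1 + (pm^-1 * (2 `^ pp * G) + ln (G `^ pm^-1 * W)) <= ln H.
Hypothesis HC : 1 + (center_log_const +
  ln (center_mass `^ pm^-1 * W)) <= ln H.

Lemma H_ge1 : 1 <= H.
Proof.
have [N [_ _ _ S0 _]] := center_half (lexx 1).
rewrite -[H]lnK ?posrE// -[leLHS](@expR0 R) ler_expR.
by apply: le_trans HC; rewrite addr_ge0.
Qed.

Lemma center_small_set L N k : 1 <= L -> 0 < k -> norm_on p (qcube L) w = N%:E ->
  0 < N /\ (mu (qcube L `&` [set x : V | (w x <= H `^ (- k) / (center_norm L / N))%R]) <=
    (k^-1 * (2 * L) ^+ n)%:E)%E.
Proof.
move=> L1 k0 NE.
have [N' [N0 NE' W0 S0 cheb]] := center_half L1.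
move: NE'; rewrite NE => -[NN']; rewrite -NN' in N0 cheb.
split => //; apply: (small_set_of_log H0 k0 _ HC S0 cheb).
by rewrite exprn_ge0// mulr_ge0// (le_trans _ L1).
Qed.

(** The part of the modular that the annulus is sure to carry. *)
Definition doubling_gain : R := (H `^ (- 3) / 2) `^ pp / (3 * G).
Local Notation eta := doubling_gain.

Lemma doubling_gain_bounds : 0 < eta <= 3^-1.
Proof.
have H1 := H_ge1.
have h0 : 0 < H `^ (- 3) / 2 by rewrite divr_gt0// powR_gt0.
have h1 : 0 < (H `^ (- 3) / 2) `^ pp by rewrite powR_gt0.
rewrite /doubling_gain; apply/andP; split; first by rewrite divr_gt0// mulr_gt0.
rewrite ler_pdivrMr ?mulr_gt0// mulrA mulVf// mul1r (le_trans _ G1)//.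
rewrite -[leRHS](powRr0 (H `^ (- 3) / 2)) ger_powR ?(ltW pp0)// h0/=.
rewrite ler_pdivrMr// mul1r (@le_trans _ _ 1)// ?ler1n//.
by rewrite -[leRHS](powRr0 H) ler_powR// oppr_le0.
Qed.

Lemma doubling_gainE : eta = (2 `^ pp * (3 * G) * H `^ (3 * pp))^-1.
Proof.
rewrite /doubling_gain powRM ?invr_ge0 ?powR_ge0// -powRrM mulNr powRN.
rewrite -[2^-1]powR_inv1// -powRrM mulN1r powRN.
by field; rewrite !gt_eqF ?powR_gt0.
Qed.

(** The weight is not small on most of a centered cube, so that the annulus carries
    a fixed part of the modular: the norm decreases geometrically towards 0. *)
Lemma reverse_doubling L N : 1 <= L -> norm_on p (qcube L) w = N%:E ->
  (norm_on p (qcube (L / 3)) w <= ((1 - eta) `^ pp^-1 * N)%:E)%E.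
Proof.
move=> L1 NE; have L0 : 0 < L by rewrite (lt_le_trans _ L1).
have [N0 small] := center_small_set L1 (ltr0n R 3) NE.
have /andP[e0 e3] := doubling_gain_bounds.
have H1 := H_ge1.
have ome0 : 0 < 1 - eta by lra.
have ome1 : 1 - eta <= 1 by lra.
set rho := (1 - eta) `^ pp^-1.
have rho0 : 0 < rho by rewrite powR_gt0.
have rho1 : rho <= 1.
  by rewrite -[leRHS](powRr0 (1 - eta)) ger_powR ?invr_ge0 ?(ltW pp0)// ome0.
have rhop : rho `^ pp = 1 - eta.
  by rewrite /rho -powRrM mulVf ?gt_eqF// powRr1// ltW.
have Ln0 : 0 < L ^+ n by rewrite exprn_gt0.
have c0 := center_norm_gt0 L0.
have mL := @measurable_qcube R n L; have mL3 := @measurable_qcube R n (L / 3).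
pose Bad : set (lebesgueRn R n) := [set x : V | (w x <= H `^ (- 3) / (center_norm L / N))%R].
have mBad : measurable Bad by exact: measurable_sublevel mw.
pose A : set (lebesgueRn R n) := qcube L `\` qcube (L / 3).
have mA : measurable A by exact: measurableD.
pose F := A `\` Bad.
have mF : measurable F by exact: measurableD.
have muF : ((L ^+ n / 3)%:E <= mu F)%E.
  have cov : (mu (qcube L) <= mu F + (mu (qcube (L / 3)) + mu (qcube L `&` Bad)))%E.
    apply: (@le_trans _ _ (mu (F `|` (qcube (L / 3) `|` (qcube L `&` Bad))))).
      apply: le_lebesgue_outer => x xL.
      have [x3|x3] := pselect (qcube (L / 3) x); first by right; left.
      by have [xB|xB] := pselect (Bad x); [right; right|left].
    have mLB : measurable (qcube L `&` Bad) by exact: measurableI.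
    have mLB3 : measurable (qcube (L / 3) `|` (qcube L `&` Bad)) by exact: measurableU.
    apply: (le_trans (measureU2 mu mF mLB3)); apply: leeD; first exact: lexx.
    exact: measureU2.
  rewrite lebesgue_qcube// (lebesgue_qcube (divr_gt0 L0 (ltr0n R 3))) in cov.
  have s2 : (mu (qcube L `&` Bad) <= (3^-1 * (2 * L) ^+ n)%:E)%E := small.
  have {}cov : (((2 * L) ^+ n)%:E <= mu F + (((2 * (L / 3)) ^+ n)%:E + (3^-1 * (2 * L) ^+ n)%:E))%E.
    by apply: (le_trans cov); rewrite leeD2l// leeD2l.
  have third : (2 * (L / 3)) ^+ n <= 3^-1 * (2 * L) ^+ n.
    rewrite mulrA exprMn [leRHS]mulrC ler_wpM2l ?exprn_ge0 ?mulr_ge0 ?(ltW L0)//.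
    by rewrite exprVn lef_pV2 ?posrE ?exprn_gt0// -[leLHS]expr1 ler_weXn2l// ler1n.
  have L2 : L ^+ n <= (2 * L) ^+ n.
    by rewrite ler_pXn2r ?nnegrE ?mulr_ge0 ?(ltW L0)// ler_peMl ?ler1n// ltW.
  have F0 : (0 <= mu F)%E by exact: measure_ge0.
  move: F0 cov.
  case: (mu F) => [v _|_ _|]; [|by rewrite leey|by rewrite leeNy_eq].
  rewrite -!EFinD !lee_fin; lra.
apply/lee_addgt0Pr => d d0.
pose lam := Num.min (N + d / rho) (N * (3 / 2)).
have lamN : N < lam by rewrite lt_min ltrDl divr_gt0//= ltr_pMr//; lra.
have lam2 : lam < 2 * N by rewrite gt_min; apply/orP; right; lra.
have lam0 : 0 < lam by rewrite (lt_trans N0).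
apply: (@le_trans _ _ (rho * lam)%:E); last first.
  rewrite -EFinD lee_fin (@le_trans _ _ (rho * (N + d / rho)))//.
    by rewrite ler_wpM2l ?(ltW rho0)// ge_min lexx.
  by rewrite mulrDr mulrCA mulfV ?mulr1// gt_eqF.
have mlam := measurable_modular mp mw lam.
have g0 x : 0 <= (w x / lam) `^ p x by exact: powR_ge0.
have modL : (\int[mu]_(x in qcube L) ((w x / lam) `^ p x)%:E <= 1)%E.
  by apply: (norm_on_modular_le1 p0 mp w0 mw mL); rewrite NE lte_fin.
have modA : (eta%:E <= \int[mu]_(x in A) ((w x / lam) `^ p x)%:E)%E.
  apply: (@le_trans _ _ (\int[mu]_(x in F) ((w x / lam) `^ p x)%:E)%E); last first.
    by apply: (integral_sub_on mu mF mA mlam) => // x [].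
  have k0 : 0 <= (H `^ (- 3) / 2) `^ pp / (G * L ^+ n).
    by rewrite divr_ge0 ?powR_ge0// mulr_ge0 ?ltW.
  apply: (@le_trans _ _ (((H `^ (- 3) / 2) `^ pp / (G * L ^+ n))%:E * mu F)%E).
    apply: le_trans (lee_wpmul2l _ muF); last by rewrite lee_fin.
    rewrite -EFinM lee_fin /doubling_gain le_eqVlt; apply/orP; left; apply/eqP.
    by field; rewrite !gt_eqF.
  apply: (integral_ge_cst mu mF mlam k0) => x [xA xB].
  have /andP[_ hi] := far_center_scale L1 (annulus_far L0 xA).
  have wx : H `^ (- 3) / (center_norm L / N) < w x by rewrite ltNge; apply/negP.
  have h30 : 0 < H `^ (- 3) by rewrite powR_gt0.
  have wlam : H `^ (- 3) / 2 / center_norm L <= w x / lam.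
    rewrite ler_pdivlMr//; apply: ltW; apply: le_lt_trans wx.
    rewrite invf_div (_ : H `^ (- 3) / 2 / center_norm L * lam = H `^ (- 3) / center_norm L * (lam / 2)); last by ring.
    rewrite (_ : H `^ (- 3) * (N / center_norm L) = H `^ (- 3) / center_norm L * N); last by ring.
    by rewrite ler_pM2l ?divr_gt0// ler_pdivrMr// mulrC ltW.
  have h0 : 0 < H `^ (- 3) / 2 by rewrite divr_gt0.
  apply: (@le_trans _ _ ((H `^ (- 3) / 2 / center_norm L) `^ p x)); last first.
    by rewrite ge0_ler_powR ?nnegrE ?(ltW (p0 x)) ?divr_ge0 ?(ltW lam0) ?(ltW c0) ?(ltW h30).
  rewrite [leRHS]powRM ?invr_ge0 ?(ltW c0) ?(ltW h0)//.
  apply: ler_pM; rewrite ?powR_ge0 ?invr_ge0 ?mulr_ge0 ?(ltW G0) ?(ltW Ln0)//.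
    rewrite ger_powR// h0/= ler_pdivrMr// mul1r (@le_trans _ _ 1)// ?ler1n//.
    by rewrite -[leRHS](powRr0 H) ler_powR// oppr_le0.
  rewrite -[(center_norm L)^-1]powR_inv1 ?(ltW c0)// -powRrM mulN1r powRN.
  by rewrite lef_pV2 ?posrE ?powR_gt0 ?mulr_gt0.
have modL3 : (\int[mu]_(x in qcube (L / 3)) ((w x / lam) `^ p x)%:E <= (1 - eta)%:E)%E.
  have sub : qcube (L / 3) `<=` (qcube L : set (lebesgueRn R n)) by apply: qcube_sub; lra.
  move: modL; rewrite (integral_splitI mu mL mL3 mlam) // (setIidr sub).
  set X := (X in (X + _)%E) => XA.
  have : (X + eta%:E <= 1%:E)%E by apply: le_trans XA; rewrite leeD2l.
  by rewrite EFinB leeBrDr.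
apply: (norm_on_le p0 w0); first by rewrite mulr_gt0.
have rV : 0 <= (rho `^ pp)^-1 by rewrite invr_ge0 powR_ge0.
apply: (@le_trans _ _ (\int[mu]_(x in qcube (L / 3)) ((rho `^ pp)^-1 * (w x / lam) `^ p x)%:E)%E).
  apply: (le_integral_on mu mL3 (measurable_modular mp mw _)).
    by apply: measurable_funM _ mlam; exact: measurable_cst.
  move=> x _; rewrite powR_ge0/=.
  have -> : w x / (rho * lam) = rho^-1 * (w x / lam) by rewrite invfM mulrCA.
  rewrite [leLHS]powRM ?invr_ge0 ?divr_ge0 ?(ltW rho0) ?(ltW lam0)//.
  rewrite ler_wpM2r ?powR_ge0// -[rho^-1]powR_inv1 ?(ltW rho0)// -powRrM mulN1r powRN.
  by rewrite lef_pV2 ?posrE ?powR_gt0// ger_powR ?p_le// rho0.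
rewrite (integralZ_on mu mL3 mlam rV) //.
apply: (le_trans (lee_wpmul2l _ modL3)); first by rewrite lee_fin.
by rewrite -EFinM lee_fin rhop mulVf// gt_eqF.
Qed.

(** * The reverse Hoelder inequality on centered cubes *)

Variable r : R.
Hypothesis r1 : 1 < r.
Hypothesis r2 : r <= 2.
Hypothesis r_tame : 8 * 2 ^+ n.+1 * (r - 1) <= (@tame_beta R n pm p_inf C0 C_inf H) ^+ 2.
Hypothesis r_gain : (r - 1) * (8 * n%:R * pp / p_inf) <= eta.

Let r0 : 0 < r. Proof. exact: lt_trans r1. Qed.
Let mrp : measurable_fun [set: lebesgueRn R n] (fun x => r * p x).
Proof. by apply: measurable_funM mp; exact: measurable_cst. Qed.
Let rp_ge x : pm <= r * p x.
Proof. by rewrite (le_trans (p_ge x))// ler_peMl// ltW. Qed.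

Definition gap_exponent : R := (1 - r^-1) / p_inf.
Local Notation kap := gap_exponent.

Lemma gap_exponentE : kap * r = (r - 1) / p_inf.
Proof. by rewrite /gap_exponent; field; rewrite !gt_eqF. Qed.

Lemma gap_exponent_bounds : 0 <= kap <= (r - 1) / p_inf.
Proof.
have k0 : 0 <= kap by rewrite divr_ge0 ?(ltW p_inf_gt0)// subr_ge0 invf_le1// ltW.
by rewrite k0/= -gap_exponentE ler_peMr// ltW.
Qed.

(** The value of the norm with exponent r * p that the estimate predicts, up to a
    constant. *)
Definition center_scale L : R := fine (norm_on p (qcube L) w) * L `^ (- (n%:R * kap)).

Lemma center_norm_fin L : 3^-1 < L -> exists2 N, 0 < N & norm_on p (qcube L) w = N%:E.
Proof.
move=> L3; have L0 : 0 < L by apply: lt_trans L3; rewrite invr_gt0.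
have [L1|L1] := leP L 1; last first.
  by have [N [N0 NE _ _ _]] := center_half (ltW L1); exists N.
have L20 : 0 < 2 * L by rewrite mulr_gt0.
have tm : tame (const_mx (- L)) (2 * L).
  by apply: (tame_small n0 LH); rewrite L20/= -[leRHS]mulr1 ler_pM2l.
by have [N [N0 NE _ _ _]] := tame_half n0 LH pm0 p_ge wP AW L20 tm; exists N.
Qed.

Lemma center_scaleE L N : norm_on p (qcube L) w = N%:E ->
  center_scale L = N * L `^ (- (n%:R * kap)).
Proof. by rewrite /center_scale => ->. Qed.

Lemma center_scale_gt0 L : 3^-1 < L -> 0 < center_scale L.
Proof.
move=> L3; have L0 : 0 < L by apply: lt_trans L3; rewrite invr_gt0.
have [N N0 NE] := center_norm_fin L3.
by rewrite (center_scaleE NE) mulr_gt0// powR_gt0.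
Qed.

Lemma modular_transfer (A : set (lebesgueRn R n)) (c s D E : R) : measurable A ->
  0 <= c -> 0 <= s -> 0 <= E -> (forall x, A x -> s `^ (r * p x) <= E) ->
  (\int[mu]_(x in A) ((w x * c) `^ (r * p x))%:E <= D%:E)%E ->
  (\int[mu]_(x in A) ((w x * (c * s)) `^ (r * p x))%:E <= (E * D)%:E)%E.
Proof.
move=> mA c0 s0 E0 sE intD.
have g0 x : A x -> 0 <= (w x * c) `^ (r * p x) by move=> _; exact: powR_ge0.
rewrite [leRHS]EFinM; apply: le_trans (lee_wpmul2l _ intD); last by rewrite lee_fin.
rewrite -(integralZ_on mu mA (measurable_wpow wP c mrp) E0 g0).
apply: (le_integral_on mu mA (measurable_wpow wP _ mrp)).
  by apply: measurable_funM _ (measurable_wpow wP _ mrp); exact: measurable_cst.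
move=> x Ax; rewrite powR_ge0/= mulrA powRM ?mulr_ge0// mulrC.
by rewrite ler_wpM2r ?powR_ge0// sE.
Qed.

Definition third_const : R := 2 ^+ n * G ^+ 3 * (2 * Lam ^+ 2).

(** A cube of the annulus is tame, and it is no larger, in norm of w, than the centered
    cube; its scale is of the same order, because both are far from the origin. *)
Lemma center_third b L : 1 <= L -> hcube b (2 * L / 3) `<=` qcube L ->
  (forall x, hcube b (2 * L / 3) x -> exists i, L / 3 <= `|x ord0 i|) ->
  (\int[mu]_(x in hcube b (2 * L / 3)) ((w x / center_scale L) `^ (r * p x))%:E <=
    third_const%:E)%E.
Proof.
move=> L1 sub far; have L0 : 0 < L by rewrite (lt_le_trans _ L1).
have L3 : 3^-1 < L by apply: lt_le_trans L1; rewrite invf_lt1// ltr1n.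
have [N N0 NE] := center_norm_fin L3.
set l := 2 * L / 3 in sub far *.
have l0 : 0 < l by rewrite divr_gt0// mulr_gt0.
have lL : L = 3 / 2 * l by rewrite /l; field.
have tm : tame b l.
  have [l1|l1] := leP 1 l; last first.
    by apply: (tame_small n0 LH); rewrite l0/= (le_trans (ltW l1))// ler1n.
  apply: (tame_far n0 LH l1) => x xb; have [i xi] := far x xb; exists i.
  by apply: le_trans xi; rewrite /l; lra.
have r12 : 1 < r <= 2 by rewrite r1.
have [M [M0 ME rh]] := tame_reverse_hoelder n0 LH pm0 p_ge wP AW H0 HW l0 tm r12 r_tame.
have mP := measurable_hcube b l.
have MN : M <= N.
  by rewrite -lee_fin -ME -NE; apply: (norm_on_sub p0 mp w0 mw) => //; exact: measurable_qcube.
have m0 := tame_norm_gt0 p b l0; set m := tame_norm b l in m0 rh.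
pose s := M / N * (L `^ (n%:R * kap) / m).
have LL0 : 0 < L `^ (n%:R * kap) by rewrite powR_gt0.
have s0 : 0 <= s by rewrite mulr_ge0// divr_ge0 ?ltW.
have E0 : 0 <= 2 ^+ n * G ^+ 3 / l ^+ n.
  by rewrite divr_ge0 ?mulr_ge0 ?exprn_ge0 ?(ltW G0) ?(ltW l0).
have c0 : 0 <= m / M by rewrite divr_ge0 ?ltW.
have sE x : hcube b l x -> s `^ (r * p x) <= 2 ^+ n * G ^+ 3 / l ^+ n.
  move=> xb.
  have rp0 : 0 <= r * p x by rewrite mulr_ge0 ?ltW.
  apply: (@le_trans _ _ ((L `^ (n%:R * kap) / m) `^ (r * p x))).
    rewrite ge0_ler_powR ?nnegrE ?divr_ge0 ?(ltW LL0) ?(ltW m0)//.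
    by rewrite ler_piMl ?divr_ge0 ?(ltW LL0) ?(ltW m0)// ler_pdivrMr// mul1r.
  rewrite powRM ?invr_ge0 ?(ltW LL0) ?(ltW m0)//.
  have X0 : 0 < l ^+ n by rewrite exprn_gt0.
  have farx : exists i, L / 16 <= `|x ord0 i|.
    by have [i xi] := far x xb; exists i; apply: le_trans xi; rewrite ler_pM2l// lef_pV2 ?posrE// ler_nat.
  have /andP[_ hiL] := far_center_scale L1 farx.
  have /andP[lom _] := tame_scale LH pm0 p_ge tm l0 (@subset_refl _ _) xb.
  have -> : (L `^ (n%:R * kap)) `^ (r * p x) = (center_norm L `^ p x) `^ (r - 1).
    rewrite -!powRrM; congr (_ `^ _).
    rewrite (_ : n%:R * kap * (r * p x) = n%:R * p x * (kap * r)); last by ring.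
    by rewrite gap_exponentE; ring.
  have -> : (m^-1) `^ (r * p x) = ((m `^ p x) `^ r)^-1.
    by rewrite -[m^-1]powR_inv1 ?(ltW m0)// -powRrM mulN1r powRN [r * p x]mulrC powRrM.
  have c1 : 1 <= 2 ^+ n :> R by rewrite exprn_ege1// ler1n.
  have r12' : 1 <= r <= 2 by rewrite (ltW r1).
  have hi : center_norm L `^ p x <= G * (2 ^+ n * l ^+ n).
    apply: (le_trans hiL); rewrite ler_wpM2l ?(ltW G0)//.
    rewrite -exprMn ler_pXn2r ?nnegrE ?mulr_ge0 ?(ltW l0) ?(ltW L0)//.
    by rewrite lL ler_wpM2r ?(ltW l0)// ler_pdivrMr// -natrM ler_nat.
  exact: (scale_quotient_le X0 G1 c1 r12' (powR_ge0 _ _) hi lom).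
have := modular_transfer mP c0 s0 E0 sE rh.
have -> : third_const = 2 ^+ n * G ^+ 3 / l ^+ n * (2 * Lam ^+ 2 * l ^+ n).
  by rewrite /third_const; field; rewrite gt_eqF// exprn_gt0.
have -> : m / M * s = (center_scale L)^-1.
  rewrite (center_scaleE NE) powRN /s; field; rewrite !gt_eqF//.
exact: id.
Qed.

Definition base_const : R := ((3 / 2) `^ (n%:R / pm)) `^ (2 * pp) * (2 * Lam ^+ 2 * 2 ^+ n).

(** Cubes of side at most 2 are tame wherever they are. *)
Lemma center_base L : 3^-1 < L -> L <= 1 ->
  (\int[mu]_(x in qcube L) ((w x / center_scale L) `^ (r * p x))%:E <= base_const%:E)%E.
Proof.
move=> L3 L1; have L0 : 0 < L by apply: lt_trans L3; rewrite invr_gt0.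
have L20 : 0 < 2 * L by rewrite mulr_gt0.
have L22 : 2 * L <= 2 by rewrite -[leRHS]mulr1 ler_pM2l.
have tm : tame (const_mx (- L)) (2 * L) by apply: (tame_small n0 LH); rewrite L20.
have r12 : 1 < r <= 2 by rewrite r1.
have [N [N0 NE rh]] := tame_reverse_hoelder n0 LH pm0 p_ge wP AW H0 HW L20 tm r12 r_tame.
have m0 := tame_norm_gt0 p (const_mx (- L)) L20.
set m := tame_norm _ _ in m0 rh.
pose s := L `^ (n%:R * kap) / m.
have LL0 : 0 < L `^ (n%:R * kap) by rewrite powR_gt0.
have s0 : 0 <= s by rewrite divr_ge0 ?ltW.
have c0 : 0 <= m / N by rewrite divr_ge0 ?ltW.
have E0 : 0 <= ((3 / 2) `^ (n%:R / pm)) `^ (2 * pp) :> R by exact: powR_ge0.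
have t32 : 1 <= 3 / 2 :> R by rewrite ler_pdivlMr// mul1r ler_nat.
have t1 : 1 <= (3 / 2) `^ (n%:R / pm) :> R.
  by rewrite -[leLHS](powRr0 (3 / 2)) ler_powR// divr_ge0// ltW.
have s1 : s <= (3 / 2) `^ (n%:R / pm).
  apply: (@le_trans _ _ m^-1).
    have /andP[k0 _] := gap_exponent_bounds.
    rewrite /s ler_piMl ?invr_ge0 ?(ltW m0)//.
    have L01 : 0 < L <= 1 by rewrite L0.
    by rewrite -[leRHS](powRr0 L) (ger_powR L01)// mulr_ge0.
  have pa := p_ge (const_mx (- L)).
  rewrite /m /tame_norm -powRN.
  apply: (@le_trans _ _ ((3 / 2) `^ (n%:R / p (const_mx (- L))))); last first.
    by rewrite ler_powR// ler_wpM2l// lef_pV2 ?posrE.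
  rewrite !powR_expR// ler_expR mulNr -mulrN -lnV ?posrE//.
  rewrite ler_wpM2l ?divr_ge0 ?(ltW (p0 _))// ler_ln ?posrE ?invr_gt0//.
  rewrite -[leRHS]invrK lef_pV2 ?posrE ?invr_gt0// invf_div.
  by rewrite ler_pM2l// ltW.
have sE x : qcube L x -> s `^ (r * p x) <= ((3 / 2) `^ (n%:R / pm)) `^ (2 * pp).
  move=> _; have rp0 : 0 <= r * p x by rewrite mulr_ge0 ?ltW.
  apply: (@le_trans _ _ (((3 / 2) `^ (n%:R / pm)) `^ (r * p x))).
    by rewrite ge0_ler_powR ?nnegrE ?powR_ge0.
  by rewrite ler_powR// ler_pM// ltW.
have := modular_transfer (measurable_qcube L) c0 s0 E0 sE rh.
have -> : m / N * s = (center_scale L)^-1.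
  by rewrite (center_scaleE NE) powRN /s; field; rewrite !gt_eqF.
move=> h; apply: (le_trans h); rewrite lee_fin ler_wpM2l// ler_wpM2l ?mulr_ge0 ?exprn_ge0 ?(ltW Lam0) ?(ltW G0)//.
by rewrite ler_pXn2r ?nnegrE ?mulr_ge0 ?(ltW L0).
Qed.

Definition chain_ratio : R := (1 - eta / 2) `^ pp^-1.
Local Notation tau := chain_ratio.

Let eta_bounds := doubling_gain_bounds.

Lemma chain_ratio_bounds : 0 < tau < 1.
Proof.
have /andP[e0 e3] := eta_bounds.
have t0 : 0 < 1 - eta / 2 by lra.
rewrite /chain_ratio powR_gt0//= -[ltRHS](powRr0 (1 - eta / 2)) /powR gt_eqF//.
by rewrite ltr_expR mul0r pmulr_rlt0 ?invr_gt0// ln_lt0// t0/=; lra.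
Qed.

Lemma expR_le_inv (t : R) : t < 1 -> expR t <= (1 - t)^-1.
Proof.
move=> t1; rewrite -[leLHS]invrK -expRN lef_pV2 ?posrE ?expR_gt0 ?subr_gt0//.
exact: expR_ge1Dx.
Qed.

Lemma chain_ratio_gap : pm / pp * (eta / 4) <= 1 - tau `^ pm.
Proof.
have /andP[e0 e3] := eta_bounds.
have t0 : 0 < 1 - eta / 2 by lra.
have a0 : 0 < pm / pp by rewrite divr_gt0.
have a1 : pm / pp <= 1 by rewrite ler_pdivrMr// mul1r (le_trans (p_ge 0)).
rewrite /chain_ratio -powRrM [pp^-1 * pm]mulrC powR_expR//.
have lnt : ln (1 - eta / 2) <= - (eta / 2).
  have := @le_ln1Dx R (- (eta / 2)); rewrite (_ : 1 + - (eta / 2) = 1 - eta / 2)//.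
  by apply; lra.
have : expR (pm / pp * ln (1 - eta / 2)) <= expR (- (pm / pp * (eta / 2))).
  by rewrite ler_expR -[leRHS]mulrN ler_wpM2l// ltW.
rewrite expRN => h1.
have h2 := expR_ge1Dx (pm / pp * (eta / 2)).
move: (pm / pp) a0 a1 h1 h2 => a a0 a1 h1 h2.
have ae0 : 0 < a * (eta / 2) by rewrite mulr_gt0// divr_gt0.
have ae1 : a * (eta / 2) <= 1.
  have e2 : eta / 2 <= 1 by lra.
  have e20 : 0 <= eta / 2 by lra.
  by rewrite -[leRHS]mulr1; exact: (ler_pM (ltW a0) e20 a1 e2).
have h3 : (expR (a * (eta / 2)))^-1 <= (1 + a * (eta / 2))^-1.
  by rewrite lef_pV2 ?posrE ?expR_gt0 ?addr_gt0.
have h4 : (1 + a * (eta / 2))^-1 <= 1 - a * (eta / 2) / 2.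
  rewrite -[leLHS]mul1r ler_pdivrMr ?addr_gt0//.
  by move: (a * (eta / 2)) ae0 ae1 => t t0' t1; nra.
have := le_trans h1 (le_trans h3 h4).
rewrite (_ : a * (eta / 4) = a * (eta / 2) / 2); last by field.
by move: (expR _) (a * (eta / 2)) => u v; lra.
Qed.

Lemma center_scale_third L : 1 < L -> center_scale (L / 3) <= tau * center_scale L.
Proof.
move=> L1; have L0 : 0 < L by rewrite (lt_trans _ L1).
have L3 : 3^-1 < L by apply: lt_trans L1; rewrite invf_lt1// ltr1n.
have L33 : 3^-1 < L / 3 by rewrite -[ltLHS]mul1r ltr_pM2r// invr_gt0.
have [N N0 NE] := center_norm_fin L3; have [M M0 ME] := center_norm_fin L33.
rewrite (center_scaleE NE) (center_scaleE ME).
have := reverse_doubling (ltW L1) NE.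
rewrite ME lee_fin => MN.
have /andP[e0 e3] := eta_bounds.
have ome0 : 0 < 1 - eta by lra.
have o2 : 0 < 1 - eta / 2 by lra.
have /andP[k0 k1] := gap_exponent_bounds.
(* Dividing L by three costs 3 ^ (n * kap), which the smallness of r - 1 makes
   negligible against the gain eta of the reverse doubling. *)
have cost : (1 - eta) `^ pp^-1 * 3 `^ (n%:R * kap) <= tau.
  have -> : 3 `^ (n%:R * kap) = (expR (n%:R * kap * pp * ln 3)) `^ pp^-1 :> R.
    rewrite (powR_expR _ (expR_gt0 _)) expRK powR_expR//.
    by congr expR; field; rewrite gt_eqF.
  rewrite /chain_ratio -powRM ?(ltW ome0) ?expR_ge0//.
  rewrite ge0_ler_powR ?nnegrE ?invr_ge0 ?(ltW pp0) ?mulr_ge0 ?expR_ge0 ?(ltW ome0) ?(ltW o2)//.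
  have small : n%:R * kap * pp * ln 3 <= eta / 4.
    have l3 : ln (3 : R) <= 2.
      by rewrite (_ : 3 = 1 + 2 :> R) ?le_ln1Dx//; lra.
    apply: (@le_trans _ _ (n%:R * ((r - 1) / p_inf) * pp * 2)); last first.
      by apply: (@le_trans _ _ ((r - 1) * (8 * n%:R * pp / p_inf) / 4)); [lra|rewrite ler_pM2r].
    have a0 : 0 <= n%:R * kap * pp by rewrite mulr_ge0 ?(ltW pp0)// mulr_ge0.
    have b0 : 0 <= ln (3 : R) by rewrite ln_ge0// ler1n.
    apply: (ler_pM a0 b0 _ l3).
    by rewrite ler_wpM2r ?(ltW pp0)// ler_wpM2l.
  have e41 : eta / 4 < 1 by lra.
  have h1 : expR (n%:R * kap * pp * ln 3) <= (1 - eta / 4)^-1.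
    by apply: le_trans (expR_le_inv e41); rewrite ler_expR.
  have h2 : (1 - eta) * (1 - eta / 4)^-1 <= 1 - eta / 2.
    rewrite ler_pdivrMr; last by lra.
    by move: eta e0 e3 => t t0 t3; nra.
  by apply: le_trans h2; rewrite ler_wpM2l ?(ltW ome0).
rewrite powRM ?(ltW L0)// -[3^-1]powR_inv1// -powRrM mulN1r opprK.
have LL0 : 0 < L `^ (- (n%:R * kap)) by rewrite powR_gt0.
apply: (@le_trans _ _ ((1 - eta) `^ pp^-1 * N * (L `^ (- (n%:R * kap)) * 3 `^ (n%:R * kap)))).
  by rewrite ler_wpM2r// mulr_ge0 ?powR_ge0.
rewrite (_ : _ * N * _ = (1 - eta) `^ pp^-1 * 3 `^ (n%:R * kap) * (N * L `^ (- (n%:R * kap)))); last by ring.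
by rewrite ler_wpM2r// mulr_ge0 ?(ltW N0) ?(ltW LL0).
Qed.

Definition center_const : R := 3 ^+ n * third_const + base_const.

(** Cubes that contain the origin are not tame, but they are unions of tame annuli
    whose contributions decrease geometrically, by reverse doubling. *)
Lemma center_reverse_hoelder L : 1 <= L ->
  (\int[mu]_(x in qcube L) ((w x / center_scale L) `^ (r * p x))%:E <=
    (center_const / (1 - tau `^ pm))%:E)%E.
Proof.
move=> L1.
have t0 : 0 <= third_const.
  by rewrite !mulr_ge0 ?exprn_ge0 ?(ltW G0) ?(ltW Lam0).
have b0 : 0 <= base_const by rewrite !mulr_ge0 ?powR_ge0 ?exprn_ge0 ?(ltW Lam0) ?(ltW G0).
have s0 : 0 <= 3 ^+ n * third_const by rewrite mulr_ge0// exprn_ge0.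
apply: (centered_chain pm0 rp_ge mrp w0 mw chain_ratio_bounds (addr_ge0 s0 b0)).
- exact: center_scale_gt0.
- by move=> l l3 l1; apply: (le_trans (center_base l3 l1)); rewrite lee_fin lerDr.
- move=> l l1; have l0 : 0 < l by rewrite (lt_trans _ l1).
  apply: (@le_trans _ _ (3 ^+ n * third_const)%:E); last by rewrite lee_fin lerDl.
  apply: integral_annulus_le => //.
  - exact: (measurable_modular mrp mw).
  - by move=> x; exact: powR_ge0.
  - by move=> b; exact: center_third (ltW l1).
- exact: center_scale_third.
- by apply: lt_le_trans L1; rewrite invf_lt1// ltr1n.
Qed.

(** * The improved norm ratio on half-open cubes *)

Let rp0 x : 0 < r * p x. Proof. exact: lt_le_trans (rp_ge x). Qed.
Local Notation rp := (fun x : V => r * p x).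
Let H1 : 1 <= H. Proof. exact: H_ge1. Qed.

(** With exponent r * p the size of a norm of 1 is the r-th root of what it is
    with exponent p. *)
Let root_powR (m : R) x : 0 < m -> (m `^ r^-1) `^ (r * p x) = m `^ p x.
Proof. by move=> m0; rewrite -powRrM mulrA mulVf ?mul1r// gt_eqF. Qed.

Definition tame_ratio_const : R :=
  (2 * Lam ^+ 2 * G) `^ pm^-1 * (2 * G) `^ pm^-1 * G `^ pm^-1.

(** The scale of the norm with exponent r * p is the r-th root s of the scale m. *)
Lemma tame_cube_norm_ratio a l : 0 < l -> tame a l ->
  (cube_norm_ratio rp w (hcube a l) <=
   tame_ratio_const%:E * cube_norm_ratio p w (hcube a l))%E.
Proof.
move=> l0 tm; have r12 : 1 < r <= 2 by rewrite r1.
have [N [N0 NE rh]] := tame_reverse_hoelder n0 LH pm0 p_ge wP AW H0 HW l0 tm r12 r_tame.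
have mQ := measurable_hcube a l.
have m0 := tame_norm_gt0 p a l0; have norm1 := norm_on_tame_le n0 LH pm0 p_ge l0 tm.
have scale x (xa : hcube a l x) := tame_scale LH pm0 p_ge tm l0 (@subset_refl _ _) xa.
rewrite -/(tame_norm a l) in scale.
set m := tame_norm a l in m0 norm1 rh scale.
have ln0 : 0 < l ^+ n by rewrite exprn_gt0.
pose s := m `^ r^-1; have s0 : 0 < s by rewrite powR_gt0.
have D1 : 1 <= 2 * Lam ^+ 2 * G.
  have L1 : 1 <= Lam ^+ 2 by rewrite exprn_ege1.
  have L2 : 1 <= 2 * Lam ^+ 2 by move: (Lam ^+ 2) L1 => t t1; lra.
  by rewrite -[leLHS]mulr1; exact: (ler_pM ler01 ler01 L2 G1).
have up : (norm_on rp (hcube a l) w <=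
    ((2 * Lam ^+ 2 * G) `^ pm^-1 * (N / m * s))%:E)%E.
  apply: (norm_on_le_modular pm0 rp_ge mrp w0 mw mQ _ D1).
    by rewrite mulr_gt0// divr_gt0.
  have c0 : 0 <= m / N by rewrite divr_ge0 ?ltW.
  have sV0 : 0 <= s^-1 by rewrite invr_ge0 ltW.
  have E0 : 0 <= G / l ^+ n by rewrite divr_ge0 ?ltW.
  have sE x : hcube a l x -> s^-1 `^ (r * p x) <= G / l ^+ n.
    move=> /scale/andP[low _].
    rewrite -[s^-1]powR_inv1 ?(ltW s0)// -powRrM mulN1r powRN root_powR//.
    rewrite -[leRHS]invrK invf_div lef_pV2 ?posrE ?powR_gt0 ?divr_gt0//.
    by rewrite mulrC.
  have := modular_transfer mQ c0 sV0 E0 sE rh.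
  have -> : G / l ^+ n * (2 * Lam ^+ 2 * l ^+ n) = 2 * Lam ^+ 2 * G.
    by field; rewrite gt_eqF.
  have -> : m / N * s^-1 = (N / m * s)^-1 by field; rewrite !gt_eqF.
  exact: id.
have low : ((((2 * G * 1) `^ pm^-1)^-1 * s)%:E <= norm_on rp (hcube a l) (fun=> 1%R))%E.
  apply: (@norm_on_ge_of_large _ _ _ _ (hcube a l) (hcube a l) pm s (l ^+ n) G 1 s) => //.
  - by move=> x _; rewrite divff// gt_eqF.
  - by move=> x /scale/andP[_]; rewrite root_powR.
  - by rewrite divr1 lebesgue_hcube.
have cpos : 0 < ((2 * G * 1) `^ pm^-1)^-1 * s.
  by rewrite mulr_gt0// invr_gt0 powR_gt0// mulr1 mulr_gt0.
apply: (le_trans (cube_norm_ratio_le rp0 w0 cpos low up)).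
have Ct0 : 0 <= tame_ratio_const by rewrite !mulr_ge0// powR_ge0.
apply: le_trans (lee_wpmul2l _ (cube_norm_ratio_ge p0 (ltW N0) norm1 NE)); last by rewrite lee_fin.
rewrite -EFinM lee_fin le_eqVlt; apply/orP; left; apply/eqP.
have g0 : 0 < G `^ pm^-1 by rewrite powR_gt0.
have h0 : 0 < (2 * G) `^ pm^-1 by rewrite powR_gt0// mulr_gt0.
rewrite /tame_ratio_const mulr1.
move: (G `^ pm^-1) ((2 * G) `^ pm^-1) (_ `^ pm^-1) g0 h0 => g h d g0 h0.
by field; rewrite !gt_eqF.
Qed.

(** Sets of relative measure 1 / center_level in qcube (2 * l) have at most a quarter
    of the measure of a cube of side l. *)
Definition center_level : R := 4 * 4 ^+ n.
Local Notation k := center_level.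

Let k0 : 0 < k. Proof. by rewrite /center_level mulr_gt0// exprn_gt0. Qed.

(** Half of a large cube near the origin is far from the origin and carries large
    values of w: the exceptional sets are too small to fill the other half. *)
Lemma center_large_set a l N : 1 <= l -> hcube a l `<=` qcube (2 * l) ->
  norm_on p (qcube (2 * l)) w = N%:E ->
  exists F : set (lebesgueRn R n), [/\ measurable F, F `<=` hcube a l,
    (((2 * l) ^+ n / 2 ^+ n.+1)%:E <= mu F)%E,
    forall x, F x -> exists i, 2 * l / 16 <= `|x ord0 i| &
    forall x, F x -> H `^ (- k) * N / center_norm (2 * l) <= w x].
Proof.
move=> l1 sub NE; have l0 : 0 < l by rewrite (lt_le_trans _ l1).
have L1 : 1 <= 2 * l by lra.
have [N0 small] := center_small_set L1 k0 NE.
set B := qcube (2 * l) `&` _ in small.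
have mB : measurable B.
  by apply: measurableI; [exact: measurable_qcube|exact: measurable_sublevel].
have mQ := measurable_hcube a l.
have mC := @measurable_qcube R n (2 * l / 16).
have mBC : measurable (qcube (2 * l / 16) `|` B) by exact: measurableU.
exists (hcube a l `\` (qcube (2 * l / 16) `|` B)); split.
- exact: measurableD.
- by move=> x [].
- have mF : measurable (hcube a l `\` (qcube (2 * l / 16) `|` B)) by exact: measurableD.
  set F := hcube a l `\` _ in mF *.
  have bound : (mu (hcube a l) <= mu F + (mu (qcube (2 * l / 16)) + mu B))%E.
    apply: (@le_trans _ _ (mu (F `|` (qcube (2 * l / 16) `|` B)))).
      apply: le_measure; rewrite ?inE//; first exact: measurableU.
      move=> x Qx; have [CBx|CBx] := pselect ((qcube (2 * l / 16) `|` B) x); first by right.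
      by left.
    have U1 : (mu (F `|` (qcube (2 * l / 16) `|` B)) <=
        mu F + mu (qcube (2 * l / 16) `|` B))%E by exact: measureU2.
    have U2 : (mu (qcube (2 * l / 16) `|` B) <= mu (qcube (2 * l / 16)) + mu B)%E.
      exact: measureU2.
    by apply: (le_trans U1); exact: leeD.
  have l16 : 0 < 2 * l / 16 by rewrite divr_gt0// mulr_gt0.
  rewrite (lebesgue_hcube a l0) (lebesgue_qcube l16) in bound.
  have X0 : 0 < l ^+ n by rewrite exprn_gt0.
  have c1 : (2 * (2 * l / 16)) ^+ n <= l ^+ n / 4.
    rewrite (_ : 2 * (2 * l / 16) = l / 4); last by field.
    rewrite expr_div_n ler_wpM2l ?(ltW X0)// lef_pV2 ?posrE ?exprn_gt0//.
    by rewrite -[leLHS]expr1 ler_eXn2l// ltr1n.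
  have c2 : k^-1 * (2 * (2 * l)) ^+ n = l ^+ n / 4.
    rewrite (_ : 2 * (2 * l) = 4 * l); last by ring.
    by rewrite /center_level exprMn; field; rewrite gt_eqF// exprn_gt0.
  have c3 : (2 * l) ^+ n / 2 ^+ n.+1 = l ^+ n / 2.
    by rewrite exprMn exprS; field; rewrite gt_eqF// exprn_gt0.
  rewrite c2 in small; rewrite c3.
  have {}bound : ((l ^+ n)%:E <= mu F + (l ^+ n / 2)%:E)%E.
    apply: (le_trans bound); apply: leeD => //.
    rewrite (_ : l ^+ n / 2 = l ^+ n / 4 + l ^+ n / 4); last by field.
    by rewrite EFinD; apply: leeD => //; rewrite lee_fin.
  rewrite -leeBlDr// -EFinB in bound.
  by apply: le_trans bound; rewrite lee_fin; lra.
- by move=> x [_ /not_orP[]] /notin_qcube.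
- move=> x [Qx /not_orP[_ nB]]; rewrite leNgt; apply/negP => wx; apply: nB.
  split; first exact: sub.
  by rewrite /= invf_div mulrA ltW.
Qed.

Definition center_modular_const : R :=
  1 + center_const * (4 * pp / pm) * (3 * G * 2 `^ pp).

Lemma center_const_ge0 : 0 <= center_const.
Proof.
have G3 : 0 <= G ^+ 3 by rewrite exprn_ge0// ltW.
have L2 : 0 <= 2 * Lam ^+ 2 by rewrite mulr_ge0// exprn_ge0// ltW.
have t0 m : 0 <= 2 ^+ m :> R by rewrite exprn_ge0.
apply: addr_ge0; first by rewrite mulr_ge0 ?exprn_ge0// /third_const mulr_ge0// mulr_ge0.
exact: (mulr_ge0 (powR_ge0 _ _) (mulr_ge0 L2 (t0 n))).
Qed.

Lemma center_modular_const_ge1 : 1 <= center_modular_const.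
Proof.
rewrite lerDl mulr_ge0//; last by rewrite !mulr_ge0 ?powR_ge0 ?(ltW G0).
by rewrite mulr_ge0 ?center_const_ge0// divr_ge0 ?mulr_ge0 ?(ltW pp0) ?(ltW pm0).
Qed.

Lemma center_modular_le : center_const / (1 - tau `^ pm) <=
  center_modular_const * H `^ (3 * pp).
Proof.
have gap := chain_ratio_gap.
have Hp : 0 < H `^ (3 * pp) by rewrite powR_gt0.
have etaV : eta^-1 = 3 * G * 2 `^ pp * H `^ (3 * pp).
  by rewrite (doubling_gainE) invrK; ring.
have /andP[e0 _] := doubling_gain_bounds.
have e4 : 0 < eta / 4 by rewrite divr_gt0.
have g0 : 0 < pm / pp * (eta / 4) by exact: (mulr_gt0 (divr_gt0 pm0 pp0) e4).
apply: (@le_trans _ _ (center_const * (pm / pp * (eta / 4))^-1)).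
  rewrite ler_wpM2l ?center_const_ge0// lef_pV2 ?posrE//.
  exact: lt_le_trans gap.
rewrite (_ : (pm / pp * (eta / 4))^-1 = 4 * pp / pm * eta^-1); last first.
  by field; rewrite !gt_eqF.
rewrite etaV mulrA /center_modular_const [leRHS]mulrDl mul1r.
by rewrite !mulrA lerDr ltW.
Qed.

Definition center_ratio_const : R := center_modular_const `^ pm^-1 *
  ((2 * G * 2 ^+ n.+1) `^ pm^-1) ^+ 2 * center_mass `^ pm^-1.

Definition center_ratio_exponent : R := 3 * pp / pm + k.

Lemma center_cube_norm_ratio a l : 1 <= l -> hcube a l `<=` qcube (2 * l) ->
  (cube_norm_ratio rp w (hcube a l) <=
   (center_ratio_const * H `^ center_ratio_exponent)%:E * cube_norm_ratio p w (hcube a l))%E.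
Proof.
move=> l1 sub; set L := 2 * l in sub *.
have L1 : 1 <= L by rewrite /L; lra.
have L0 : 0 < L by rewrite (lt_le_trans _ L1).
have L3 : 3^-1 < L by apply: lt_le_trans L1; rewrite invf_lt1// ltr1n.
have [N N0 NE] := center_norm_fin L3.
have [F [mF FQ muF far big]] := center_large_set l1 sub NE.
rewrite -/L in muF far big.
have mQ := measurable_hcube a l; have mL := @measurable_qcube R n L.
have m0 : 0 < center_norm L by exact: center_norm_gt0.
set m := center_norm L in m0 big.
pose s := m `^ r^-1; have s0 : 0 < s by rewrite powR_gt0.
have X0 : 0 < L ^+ n by rewrite exprn_gt0.
have e1 : 1 <= 2 ^+ n.+1 :> R by rewrite exprn_ege1// ler1n.
have mF_le x : F x -> m `^ p x <= G * L ^+ n.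
  by move=> /far xi; have /andP[] := far_center_scale L1 xi.
set E := (2 * G * 2 ^+ n.+1) `^ pm^-1.
have E0 : 0 < E.
  by apply: powR_gt0; apply: mulr_gt0; [exact: mulr_gt0|exact: lt_le_trans e1].
have Hk0 : 0 < H `^ (- k) by rewrite powR_gt0.
have low1 : ((E^-1 * s)%:E <= norm_on rp (hcube a l) (fun=> 1%R))%E.
  apply: (norm_on_ge_of_large pm0 rp_ge mrp (fun=> ler01) m1 mF mQ FQ s0 X0 G1 e1 s0 _ _ muF).
    by move=> x _; rewrite divff// gt_eqF.
  by move=> x /mF_le; rewrite root_powR.
have t0 : 0 < H `^ (- k) * N by rewrite mulr_gt0.
have loww : ((E^-1 * (H `^ (- k) * N))%:E <= norm_on p (hcube a l) w)%E.
  exact: (norm_on_ge_of_large pm0 p_ge mp w0 mw mF mQ FQ m0 X0 G1 e1 t0 big mF_le muF).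
have upw : (norm_on p (hcube a l) w <= N%:E)%E.
  by rewrite -NE; exact: (norm_on_sub p0 mp w0 mw mQ mL sub).
have up1 : (norm_on p (hcube a l) (fun=> 1%R) <= (center_mass `^ pm^-1 * m)%:E)%E.
  apply: le_trans (le_norm_on_center L1).
  exact: (norm_on_sub p0 mp (fun=> ler01) m1 mQ mL sub).
have [M ME] : exists M, norm_on p (hcube a l) w = M%:E.
  by move: upw loww; case: (norm_on p (hcube a l) w) => // M _ _; exists M.
rewrite ME lee_fin in loww.
have M0 : 0 <= M by apply: le_trans loww; rewrite mulr_ge0 ?invr_ge0 ?(ltW E0) ?(ltW t0).
have D1 : 1 <= center_modular_const * H `^ (3 * pp).
  have Hp1 : 1 <= H `^ (3 * pp).
    by rewrite -[leLHS](powRr0 H) ler_powR// mulr_ge0// ltW.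
  by rewrite -[leLHS]mulr1; exact: (ler_pM ler01 ler01 center_modular_const_ge1 Hp1).
have c0 := center_scale_gt0 L3.
have uprp : (norm_on rp (hcube a l) w <=
    ((center_modular_const * H `^ (3 * pp)) `^ pm^-1 * center_scale L)%:E)%E.
  apply: (le_trans (norm_on_sub rp0 mrp w0 mw mQ mL sub)).
  apply: (norm_on_le_modular pm0 rp_ge mrp w0 mw mL c0 D1).
  apply: (le_trans (center_reverse_hoelder L1)).
  by rewrite lee_fin center_modular_le.
have Es0 : 0 < E^-1 * s by rewrite mulr_gt0// invr_gt0.
apply: (le_trans (cube_norm_ratio_le rp0 w0 Es0 low1 uprp)).
have Cc0 : 0 <= center_ratio_const * H `^ center_ratio_exponent.
  by rewrite !mulr_ge0 ?exprn_ge0 ?powR_ge0.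
apply: le_trans (lee_wpmul2l _ (cube_norm_ratio_ge p0 M0 up1 ME)); last by rewrite lee_fin.
rewrite -EFinM lee_fin (center_scaleE NE).
(* The powers of L match: this is where the factor L ^ (- n * kap) is spent. *)
have Ln : L != 0 by rewrite gt_eqF.
have sL : L `^ (- (n%:R * gap_exponent)) = s / m.
  apply: (canRL (mulfK _)); first by rewrite gt_eqF.
  rewrite /s /m /center_norm -powRD ?Ln ?implybT// -powRrM.
  by congr (_ `^ _); rewrite /gap_exponent; field; rewrite !gt_eqF.
set g := center_mass `^ pm^-1.
have g0 : 0 < g by rewrite powR_gt0// (lt_le_trans _ (center_mass_ge1)).
have cm0 : 0 <= center_modular_const by rewrite (le_trans ler01 center_modular_const_ge1).
rewrite sL /center_ratio_const -/E -/g powRM ?powR_ge0// -powRrM.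
have -> : H `^ center_ratio_exponent = H `^ (3 * pp * pm^-1) * (H `^ (- k))^-1.
  have Hn : H != 0 by rewrite gt_eqF.
  by rewrite powRN invrK /center_ratio_exponent powRD ?Hn ?implybT.
set d := center_modular_const `^ _; set h := H `^ (3 * pp * pm^-1).
have dh0 : 0 <= d * h by rewrite mulr_ge0 ?powR_ge0.
rewrite [leLHS](_ : _ = d * h * E / m * N); last by field; rewrite !gt_eqF.
rewrite [leRHS](_ : _ = d * h * E / m * ((E / H `^ (- k)) * M)); last first.
  by field; rewrite !gt_eqF.
apply: ler_wpM2l.
  by rewrite divr_ge0 ?(ltW m0)//; exact: mulr_ge0 dh0 (ltW E0).
rewrite mulrAC ler_pdivlMr// mulrC -ler_pdivrMl//.
Qed.

Lemma center_ratio_exponent_gt0 : 0 < center_ratio_exponent.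
Proof. by rewrite addr_gt0// divr_gt0// mulr_gt0. Qed.

Lemma center_ratio_const_ge0 : 0 <= center_ratio_const.
Proof. by rewrite !mulr_ge0 ?exprn_ge0 ?powR_ge0. Qed.

Lemma tame_ratio_const_gt0 : 0 < tame_ratio_const.
Proof.
have L2 : 0 < 2 * Lam ^+ 2 by rewrite mulr_gt0// exprn_gt0.
apply: mulr_gt0; last exact: powR_gt0.
by apply: mulr_gt0; apply: powR_gt0; exact: mulr_gt0.
Qed.

(** A large cube either stays away from the origin by half of its side, and is tame,
    or lies in a centered cube of comparable side. *)
Lemma hcube_norm_ratio a l : 0 < l ->
  (cube_norm_ratio rp w (hcube a l) <=
   ((tame_ratio_const + center_ratio_const) * H `^ center_ratio_exponent)%:E *
     cube_norm_ratio p w (hcube a l))%E.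
Proof.
move=> l0.
have Ct0 := tame_ratio_const_gt0; have Cc0 := center_ratio_const_ge0.
have Hp1 : 1 <= H `^ center_ratio_exponent.
  by rewrite -[leLHS](powRr0 H) ler_powR// ltW// center_ratio_exponent_gt0.
have ratio0 := cube_norm_ratio_ge0 (hcube a l) p0 w0.
have [tm|[l1 sub]] : tame a l \/ (1 <= l /\ hcube a l `<=` qcube (2 * l)).
  have [l2|l2] := leP l 2; first by left; apply: (tame_small n0 LH); rewrite l0.
  have l1 : 1 <= l by rewrite (le_trans _ (ltW l2))// ler1n.
  have [[x ax near]|away] := pselect (exists2 x, hcube a l x & forall i, `|x ord0 i| < l / 2).
    right; split => // y ay; apply/qcubeP => i.
    have := near i; have := ax i; have := ay i; rewrite ltr_norml.
    by move=> /andP[? ?] /andP[? ?] /andP[? ?]; apply/andP; split; lra.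
  left; apply: (tame_far n0 LH l1) => x ax.
  apply: contrapT => nofar; apply: away; exists x => // i.
  by rewrite ltNge; apply/negP => xi; apply: nofar; exists i.
- apply: (le_trans (tame_cube_norm_ratio l0 tm)); apply: lee_wpmul2r => //.
  rewrite lee_fin -[leLHS]mulr1; apply: (ler_pM (ltW Ct0) ler01 _ Hp1).
  by rewrite lerDl.
- apply: (le_trans (center_cube_norm_ratio l1 sub)); apply: lee_wpmul2r => //.
  by rewrite lee_fin ler_wpM2r ?powR_ge0// lerDr ltW.
Qed.

End CenteredCubesOfWeight.

(** * The choice of the constants *)

Section Threshold.
Context {R : realType} {n : nat}.
Local Notation V := 'rV[R]_n.
Variables (p : V -> R) (pm p_inf C0 C_inf : R).
Hypothesis n0 : (0 < n)%N.
Hypothesis LH : LH_with p_inf C0 C_inf p.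
Hypothesis pm0 : 0 < pm.
Hypothesis p_ge : forall x, pm <= p x.

Local Notation pp := (p_inf + C_inf).
Local Notation G := (@scale_const R n pm p_inf C0 C_inf).
Local Notation Lam := (@doubling_excess R n pm p_inf C0 C_inf).
Local Notation center_mass := (@center_mass R n pm p_inf C0 C_inf).
Local Notation center_log_const := (@center_log_const R n pm p_inf C_inf).

Let p0 x : 0 < p x. Proof. exact: lt_le_trans (p_ge x). Qed.
Let pp0 : 0 < pp. Proof. exact: lt_le_trans (p0 0) (exponent_le LH 0). Qed.
Let G1 : 1 <= G. Proof. exact: scale_const_ge1 n0 LH pm0. Qed.
Let G0 : 0 < G. Proof. exact: lt_le_trans G1. Qed.
Let p_inf_gt0 : 0 < p_inf. Proof. by case: LH. Qed.
Let C_inf_gt0 : 0 < C_inf. Proof. by case: LH. Qed.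
Let pmV0 : 0 <= pm^-1. Proof. by rewrite invr_ge0 ltW. Qed.
Let Lam0 : 0 < Lam. Proof. exact: lt_le_trans (doubling_excess_ge1 n0 LH pm0 p_ge). Qed.

(** A multiple H of W by this factor satisfies both conditions that relate ln H to
    ln W in the estimates of the sets where the weight is small. *)
Definition weight_factor : R :=
  expR (1 + pm^-1 * (2 `^ pp * G) + center_log_const) *
  (G `^ pm^-1 * center_mass `^ pm^-1).

Let g1 : 1 <= G `^ pm^-1.
Proof. by rewrite -[leLHS](powRr0 G) ler_powR. Qed.

Let c1 : 1 <= center_mass `^ pm^-1.
Proof.
by rewrite -[leLHS](powRr0 center_mass) ler_powR// (center_mass_ge1 n0 LH pm0).
Qed.

Let a0 : 0 <= pm^-1 * (2 `^ pp * G).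
Proof. by rewrite mulr_ge0// mulr_ge0 ?powR_ge0 ?(ltW G0). Qed.

Let b0 : 0 <= center_log_const.
Proof.
apply: addr_ge0; first by rewrite mulr_ge0 ?powR_ge0.
by rewrite mulr_ge0// divr_ge0// mulr_ge0 ?(ltW pm0) ?(ltW p_inf_gt0) ?(ltW C_inf_gt0).
Qed.

Lemma weight_factor_gt0 : 0 < weight_factor.
Proof.
rewrite mulr_gt0 ?expR_gt0// mulr_gt0//.
  exact: lt_le_trans g1.
exact: lt_le_trans c1.
Qed.

Lemma le_ln_weight_factor (W : R) : 0 < W ->
  1 + (pm^-1 * (2 `^ pp * G) + ln (G `^ pm^-1 * W)) <= ln (weight_factor * W) /\
  1 + (center_log_const + ln (center_mass `^ pm^-1 * W)) <= ln (weight_factor * W).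
Proof.
move=> W0.
have g0 : 0 < G `^ pm^-1 by exact: lt_le_trans g1.
have c0 : 0 < center_mass `^ pm^-1 by exact: lt_le_trans c1.
have lnc := ln_ge0 c1; have lng := ln_ge0 g1.
rewrite /weight_factor !lnM ?posrE ?mulr_gt0 ?expR_gt0// expRK.
have := a0; have := b0.
move: (ln _) (ln (center_mass `^ _)) (ln W) lng lnc => u v z u0 v0.
by move: (pm^-1 * _) center_log_const => s t s0 t0; split; lra.
Qed.

Definition gap_const : R := 1 + 8 * 2 ^+ n.+1 * (Lam * G ^+ 2) ^+ 2 +
  8 * n%:R * pp / p_inf * (2 `^ pp * (3 * G)).

Let tame0 : 0 <= 8 * 2 ^+ n.+1 * (Lam * G ^+ 2) ^+ 2.
Proof.
have t0 : 0 <= 2 ^+ n.+1 :> R by exact: exprn_ge0.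
exact: (mulr_ge0 (mulr_ge0 (ler0n R 8) t0) (sqr_ge0 _)).
Qed.

Let center0 : 0 <= 8 * n%:R * pp / p_inf * (2 `^ pp * (3 * G)).
Proof.
apply: mulr_ge0; last by rewrite mulr_ge0 ?powR_ge0// mulr_ge0 ?(ltW G0).
by rewrite divr_ge0 ?(ltW p_inf_gt0)// mulr_ge0 ?(ltW pp0)// mulr_ge0.
Qed.

Lemma gap_const_ge1 : 1 <= gap_const.
Proof. by rewrite /gap_const -addrA lerDl addr_ge0. Qed.

(** Both thresholds on r - 1 are negative powers of H: H ^ (- 4 * pp) from the square
    of tame_beta and H ^ (- 3 * pp) from doubling_gain. *)
Lemma small_gap (H r : R) : 1 <= H -> 1 < r -> (r - 1) * (gap_const * H `^ (4 * pp)) <= 1 ->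
  [/\ r <= 2, 8 * 2 ^+ n.+1 * (r - 1) <= (@tame_beta R n pm p_inf C0 C_inf H) ^+ 2 &
    (r - 1) * (8 * n%:R * pp / p_inf) <= @doubling_gain R n pm p_inf C0 C_inf H].
Proof.
move=> H1 r1; have H0 : 0 < H by exact: lt_le_trans H1.
have e0 : 0 <= r - 1 by rewrite subr_ge0 ltW.
have K1 : 1 <= H `^ (4 * pp) by rewrite -[leLHS](powRr0 H) ler_powR// mulr_ge0// ltW.
have K0 : 0 < H `^ (4 * pp) by exact: lt_le_trans K1.
have gap1 := gap_const_ge1.
have g0 : 0 <= gap_const by exact: le_trans gap1.
have part (s : R) : s <= gap_const -> (r - 1) * (gap_const * H `^ (4 * pp)) <= 1 ->
    (r - 1) * (s * H `^ (4 * pp)) <= 1.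
  by move=> sg; apply: le_trans; rewrite ler_wpM2l// ler_wpM2r// ltW.
move=> small; split.
- have := part _ gap1 small; rewrite mul1r => h.
  have : r - 1 <= 1 by apply: le_trans h; rewrite ler_peMr.
  by lra.
- have sg : 8 * 2 ^+ n.+1 * (Lam * G ^+ 2) ^+ 2 <= gap_const.
    by rewrite /gap_const; move: tame0 center0; lra.
  have D0 : 0 < Lam * G ^+ 2 by rewrite mulr_gt0// exprn_gt0.
  have -> : (@tame_beta R n pm p_inf C0 C_inf H) ^+ 2 =
      ((Lam * G ^+ 2) ^+ 2 * H `^ (4 * pp))^-1.
    rewrite /tame_beta expr_div_n -[(H `^ _) ^+ 2]powR_mulrn ?powR_ge0// -powRrM.
    rewrite (_ : - (2 * pp) * 2 = - (4 * pp)); last by ring.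
    by rewrite powRN [RHS]invfM mulrC.
  rewrite -[leRHS]mul1r ler_pdivlMr ?mulr_gt0 ?exprn_gt0//.
  apply: le_trans (part _ sg small); rewrite le_eqVlt; apply/orP; left; apply/eqP.
  by ring.
have sg : 8 * n%:R * pp / p_inf * (2 `^ pp * (3 * G)) <= gap_const.
  by rewrite /gap_const; move: tame0 center0; lra.
have D0 : 0 < 2 `^ pp * (3 * G) by rewrite mulr_gt0 ?powR_gt0// mulr_gt0.
apply: (@le_trans _ _ (2 `^ pp * (3 * G) * H `^ (4 * pp))^-1).
  rewrite -[leRHS]mul1r ler_pdivlMr ?(mulr_gt0 D0 K0)//.
  apply: le_trans (part _ sg small); rewrite le_eqVlt; apply/orP; left; apply/eqP.
  by ring.
rewrite (doubling_gainE n0 LH pm0 H0).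
have L0 : 0 < H `^ (3 * pp) by rewrite powR_gt0.
rewrite lef_pV2 ?posrE ?(mulr_gt0 D0)// ler_pM2l//.
by rewrite ler_powR// ler_pM2r// ler_nat.
Qed.

End Threshold.

(** * The theorem *)

(** The whole space is not null. *)
Lemma exponent_inf_lty (R : realType) (n : nat) (p : 'rV[R]_n -> R) :
  (exponent_inf (EFin \o p) < +oo)%E.
Proof.
rewrite ltey; apply/eqP => infp.
have := @ess_inf_le _ _ _ (@lebesgue R n) (EFin \o p).
rewrite -/(exponent_inf _) infp => -[N [mN N0 hN]].
have : @lebesgue R n (hcube 0 1) = 0%E.
  apply: (subset_measure0 (measurable_hcube _ _) mN _ N0) => x _.
  by apply: hN => /=; rewrite leye_eq.
by rewrite lebesgue_hcube// expr1n => -[] /eqP; rewrite oner_eq0.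
Qed.

Theorem theorem2p47 (R : realType) (n : nat) (n_gt0 : (0 < n)%N)
    (p_minus p_plus : \bar R) (p_inf C0 C_inf : R) :
  exists C C1 C2 A A1 : R,
    [/\ 0 < C, 0 < C1, 0 < C2, 0 < A & 0 < A1] /\
    forall p : 'rV[R]_n -> R,
      P0 (EFin \o p) ->
      LH_with p_inf C0 C_inf p ->
      exponent_inf (EFin \o p) = p_minus ->
      exponent_sup (EFin \o p) = p_plus ->
      forall w : 'rV[R]_n -> R, Ainfty p w ->
      let W := fine (Ainfty_const p w) in
      let r_w := 1 + 1 / (C1 * W `^ A1 * 2 `^ (C2 * W)) in
      forall r : R, 1 < r -> r <= r_w ->
      forall Q : set 'rV[R]_n, is_cube Q ->
        (cube_norm_ratio (fun x => r * p x)%R w Q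
          <= (C * W `^ A)%:E * cube_norm_ratio p w Q)%E.
Proof.
(* The constants involve p_minus, p_inf, C0 and C_inf alone; an exponent with these
   parameters serves to see that they are positive. *)
have [[q [P0q LHq infq]]|none] := pselect (exists q : 'rV[R]_n -> R,
    [/\ P0 (EFin \o q), LH_with p_inf C0 C_inf q & exponent_inf (EFin \o q) = p_minus]);
  last first.
  exists 1, 1, 1, 1, 1; split => // p P0p LHp infp.
  by case: none; exists p.
pose pm := fine p_minus.
have pmE : p_minus = pm%:E.
  have := exponent_inf_lty q; have [_ _] := P0q; rewrite infq /pm.
  by case: p_minus {infq pm}.
have pm0 : 0 < pm by have [_ _] := P0q; rewrite infq pmE lte_fin.
have q_ge : forall x, pm <= q x by apply: (exponent_ge n_gt0 LHq P0q); rewrite infq.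
pose pp := p_inf + C_inf.
have pp0 : 0 < pp by have [_ _ ? ? _] := LHq; exact: addr_gt0.
pose Ct := @tame_ratio_const R n pm p_inf C0 C_inf.
pose Cc := @center_ratio_const R n pm p_inf C0 C_inf.
pose A := @center_ratio_exponent R n pm p_inf C_inf.
pose Xi := @weight_factor R n pm p_inf C0 C_inf.
pose gap := @gap_const R n pm p_inf C0 C_inf.
have Xi0 : 0 < Xi by exact: (weight_factor_gt0 n_gt0 LHq pm0).
have gap0 : 0 < gap by exact: lt_le_trans (gap_const_ge1 n_gt0 LHq pm0 q_ge).
have Ct0 : 0 < Ct by exact: (tame_ratio_const_gt0 n_gt0 LHq pm0 q_ge).
have Cc0 : 0 <= Cc by exact: center_ratio_const_ge0.
have A0 : 0 < A by exact: (center_ratio_exponent_gt0 LHq pm0 q_ge).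
exists ((Ct + Cc) * Xi `^ A), (gap * Xi `^ (4 * pp)), 1, A, (4 * pp); split.
  split => //; last exact: mulr_gt0.
    by apply: mulr_gt0; [exact: ltr_wpDr|exact: powR_gt0].
  by apply: mulr_gt0 => //; exact: powR_gt0.
move=> p P0p LHp infp _ w [wP Woo] W r_w r r1 r_le Q [a [l [b [c [l0 ->]]]]].
have p_ge : forall x, pm <= p x by apply: (exponent_ge n_gt0 LHp P0p); rewrite infp.
have p0 x : 0 < p x by exact: lt_le_trans (p_ge x).
have rp0 x : 0 < r * p x by rewrite mulr_gt0// (lt_trans _ r1).
have [mw w0 _] := wP.
have mp : measurable_fun [set: lebesgueRn R n] p by case: LHp.
have mrp : measurable_fun [set: lebesgueRn R n] (fun x => r * p x).
  by apply: measurable_funM mp; exact: measurable_cst.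
rewrite (cube_norm_ratio_hcube a l b c rp0 mrp w0 mw).
rewrite (cube_norm_ratio_hcube a l b c p0 mp w0 mw).
have AW : (Ainfty_const p w <= W%:E)%E.
  by rewrite /W; case: (Ainfty_const p w) Woo => [W'|//|] _; rewrite ?leNye ?lexx.
have W0 : 0 < W.
  have tm : tame p C0 C_inf 0 1 by apply: (tame_small n_gt0 LHp); rewrite ltr01 ler1n.
  by have [N [_ _ W0 _ _]] := tame_half n_gt0 LHp pm0 p_ge wP AW ltr01 tm.
pose H := Xi * W; have H0 : 0 < H by exact: mulr_gt0.
have [HW HC] := le_ln_weight_factor n_gt0 LHp pm0 W0.
have H1 := H_ge1 n_gt0 LHp pm0 p_ge wP AW H0 HC.
have HE (s : R) : H `^ s = Xi `^ s * W `^ s by rewrite powRM// ltW.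
have small : (r - 1) * (gap * H `^ (4 * pp)) <= 1.
  have K0 : 0 < gap * H `^ (4 * pp) by rewrite mulr_gt0// powR_gt0.
  rewrite -ler_pdivlMr// lerBlDl; apply: (le_trans r_le).
  rewrite /r_w lerD2l !mul1r.
  have two : 1 <= 2 `^ W by rewrite -[leLHS](powRr0 2) ler_powR ?ler1n// ltW.
  rewrite -(mulrA gap) -HE lef_pV2 ?posrE ?mulr_gt0 ?powR_gt0//.
  by rewrite ler_peMr// ltW.
have [r2 r_tame r_gain] := small_gap n_gt0 LHp pm0 p_ge H1 r1 small.
have := hcube_norm_ratio n_gt0 LHp pm0 p_ge wP AW H0 HW HC r1 r2 r_tame r_gain a l0.
by rewrite -/A HE mulrA.
Qed.
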